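(* Let $\Omega\subset\mathbb{R}^3$ be a bounded domain, $\nu>0$, $\mathbf{f}\in V'$, and let $B$ be a weakly compact subset of $H$. The set of extreme points of $\mathcal{P}_{\mathrm{fp}}(B_{\mathrm{w}})$ is $$\mathcal{E}(\mathcal{P}_{\mathrm{fp}}(B_{\mathrm{w}}))=\left\{\mu\in\mathcal{P}(B_{\mathrm{w}}):\ \mu=\theta_1\delta_{\mathbf{u}_1}+\theta_2\delta_{\mathbf{u}_2},\ (\theta_1,\theta_2,\mathbf{u}_1,\mathbf{u}_2)\in\mathcal{B}_f\right\},$$ where $\mathcal{B}_f=\mathcal{B}_{f,1}\cup\mathcal{B}_{f,2}$, with $$\mathcal{B}_{f,1}=\{(1,0,\mathbf{u},\mathbf{u}):\ \mathbf{u}\in B\cap V,\ \ell(\mathbf{u})\le 0\}$$ and $\mathcal{B}_{f,2}$ the set of all $(\theta_1,\theta_2,\mathbf{u}_1,\mathbf{u}_2)$ such that $0<\theta_1<1$, $\theta_2=1-\theta_1$, $\mathbf{u}_1,\mathbf{u}_2\in B\cap V$, $\|\mathbf{u}_1\|_{L^2}=\|\mathbf{u}_2\|_{L^2}$, $\ell(\mathbf{u}_1)<0<\ell(\mathbf{u}_2)$, and $\theta_1\ell(\mathbf{u}_1)+\theta_2\ell(\mathbf{u}_2)=0$.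
   Context: $H$ (resp. $V$) is the closure of $\{\mathbf{u}\in C_c^\infty(\Omega)^3:\nabla\cdot\mathbf{u}=0\}$ in $L^2(\Omega)^3$ (resp. in $H_0^1(\Omega)^3$), with norm $\|\mathbf{u}\|_{L^2}$ (resp. $\|\nabla\mathbf{u}\|_{L^2}$); $V\subset H=H'\subset V'$ and $\langle\cdot,\cdot\rangle_{V',V}$ is the duality pairing. For $\mathbf{u}\in V$, $\ell(\mathbf{u})=\nu\|\nabla\mathbf{u}\|_{L^2}^2-\langle\mathbf{f},\mathbf{u}\rangle_{V',V}$. $\mathcal{P}(B_{\mathrm{w}})$ is the set of Borel probability measures on $H$ carried by $B$ (the weak and strong topologies of $H$ have the same Borel sets). $\mathcal{P}_{\mathrm{fp}}(B_{\mathrm{w}})$ is the set of $\mu\in\mathcal{P}(B_{\mathrm{w}})$ with $\int_H\|\nabla\mathbf{u}\|_{L^2}^2\,d\mu(\mathbf{u})<\infty$ (where $\|\nabla\mathbf{u}\|_{L^2}=+\infty$ if $\mathbf{u}\notin V$) and $\int_H\psi'(\|\mathbf{u}\|_{L^2}^2)\,\ell(\mathbf{u})\,d\mu(\mathbf{u})\le 0$ for every nonnegative, non-decreasing, continuously differentiable $\psi:[0,\infty)\to\mathbb{R}$ with bounded derivative. An extreme point of a convex set $C$ is a point $x\in C$ that cannot be written as $(1-\theta)y+\theta z$ with $y,z\in C$, $y\ne z$, $0<\theta<1$. $\delta_{\mathbf{u}}$ is the Dirac measure at $\mathbf{u}$. *)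

(* Defs.v *)
From HB Require Import structures.
From mathcomp Require Import all_boot all_order all_algebra.
From mathcomp Require Import all_classical all_reals all_analysis.
From mathcomp Require Import measurable_realfun ring lra.
Set Implicit Arguments.
Unset Strict Implicit.
Unset Printing Implicit Defensive.
Import Order.TTheory GRing.Theory Num.Theory.
Import numFieldNormedType.Exports.
Local Open Scope classical_set_scope.
Local Open Scope ring_scope.
Local Open Scope quotient_scope.

Section L2fun.
Context d (T : measurableType d) (R : realType).
Variable mu : {measure set T -> \bar R}.

Lemma le1_2E : (1 <= 2%:E :> \bar R)%E.
Proof. by rewrite lee_fin ler1n. Qed.

Variable I : finType.

(* Square-integrable families (f_i) of real functions, before identification of
   functions that are equal almost everywhere. *)
Definition L2fun := {ffun I -> LfunType mu le1_2E}.
HB.instance Definition _ := GRing.Lmodule.on L2fun.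

Definition L2ip (f g : L2fun) : R := \sum_i \int[mu]_x (f i x * g i x).

Definition L2null : {pred L2fun} :=
  fun f => `[< forall i, {ae mu, forall x, f i x = 0} >].

Lemma L2_integrable (f g : LfunType mu le1_2E) :
  mu.-integrable setT (EFin \o (fun x => f x * g x)).
Proof. exact/Lfun1_integrable/Lfun2_mul_Lfun1/LfunP/LfunP. Qed.

Lemma L2ipC f g : L2ip f g = L2ip g f.
Proof.
by apply: eq_bigr => i _; apply: eq_Rintegral => x _; rewrite mulrC.
Qed.

Lemma L2ipDl f g h : L2ip (f + g) h = L2ip f h + L2ip g h.
Proof.
rewrite -big_split; apply: eq_bigr => i _ /=.
rewrite -RintegralD//; try exact: L2_integrable.
by apply: eq_Rintegral => x _; rewrite ffunE /= mulrDl.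
Qed.

Lemma L2ipZl a f h : L2ip (a *: f) h = a * L2ip f h.
Proof.
rewrite mulr_sumr; apply: eq_bigr => i _ /=.
rewrite -RintegralZl//; last exact: L2_integrable.
by apply: eq_Rintegral => x _; rewrite ffunE /= mulrA.
Qed.

Lemma L2ip_ge0 f : 0 <= L2ip f f.
Proof.
by apply: sumr_ge0 => i _; apply: Rintegral_ge0 => x _; rewrite -expr2 sqr_ge0.
Qed.

Lemma L2ip_eq0 f : L2ip f f = 0 <-> f \in L2null.
Proof.
have ge0 i : 0 <= \int[mu]_x (f i x * f i x).
  by apply: Rintegral_ge0 => x _; rewrite -expr2 sqr_ge0.
have E i : (\int[mu]_x `|(f i x * f i x)%:E| = (\int[mu]_x (f i x * f i x))%:E)%E.
  have mf := L2_integrable (f i) (f i).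
  rewrite /Rintegral fineK ?integrable_fin_num//.
  apply: eq_integral => x _.
  by rewrite gee0_abs// lee_fin -expr2 sqr_ge0.
have M i : measurable_fun setT (EFin \o (fun x => f i x * f i x) : T -> \bar R).
  by have /integrableP[] := L2_integrable (f i) (f i).
split=> [/eqP|/asboolP f0].
  rewrite psumr_eq0// => /allP f0; apply/asboolP => i.
  have /(_ (mem_index_enum i))/eqP fi0 := f0 i.
  have /(ae_eq_integral_abs mu measurableT) : measurable_fun setT (EFin \o (fun x => f i x * f i x) : T -> \bar R) by [].
  move=> [+ _]; rewrite E fi0 => /(_ erefl).
  by apply: filterS => x /(_ Logic.I)[] /eqP; rewrite mulf_eq0 orbb => /eqP.
rewrite /L2ip big1// => i _; apply/EFin_inj; rewrite -E.
apply/(ae_eq_integral_abs mu measurableT (M i)).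
by apply: filterS (f0 i) => x + _ /= => ->; rewrite mulr0.
Qed.

Definition L2seminorm f : R := Num.sqrt (L2ip f f).

Lemma L2seminorm_eq0 f : L2seminorm f = 0 <-> f \in L2null.
Proof.
rewrite -L2ip_eq0 /L2seminorm; split=> [/eqP|->]; last exact: sqrtr0.
by rewrite sqrtr_eq0 => f0; apply/eqP; rewrite eq_le f0 L2ip_ge0.
Qed.

Lemma L2ipZZ a f : L2ip (a *: f) (a *: f) = a ^+ 2 * L2ip f f.
Proof. by rewrite L2ipZl L2ipC L2ipZl mulrA expr2. Qed.

Lemma L2seminormZ a f : L2seminorm (a *: f) = `|a| * L2seminorm f.
Proof. by rewrite /L2seminorm L2ipZZ sqrtrM ?sqr_ge0// sqrtr_sqr. Qed.

Lemma L2ipDD f g : L2ip (f + g) (f + g) = L2ip f f + L2ip f g *+ 2 + L2ip g g.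
Proof.
by rewrite L2ipDl [L2ip f _]L2ipC [L2ip g _]L2ipC !L2ipDl [L2ip g f]L2ipC; ring.
Qed.

Lemma L2CS f g : L2ip f g <= L2seminorm f * L2seminorm g.
Proof.
set a := L2ip f f; set b := L2ip f g; set c := L2ip g g.
have D t : 0 <= a + b * t *+ 2 + t ^+ 2 * c.
  have := L2ip_ge0 (f + t *: g).
  by rewrite L2ipDD L2ipZZ [L2ip f (t *: g)]L2ipC L2ipZl [L2ip g f]L2ipC [t * _]mulrC.
have a0 : 0 <= a by exact: L2ip_ge0.
have c0 : 0 <= c by exact: L2ip_ge0.
rewrite -sqrtrM// (le_trans (ler_norm _))// -sqrtr_sqr ler_wsqrtr// -/a -/c.
have [c00|cn0] := eqVneq c 0.
  rewrite c00 mulr0; have [->|bn0] := eqVneq b 0; first by rewrite expr0n.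
  have := D (- (a + 1) / b / 2); rewrite c00 mulr0 addr0.
  have -> : a + b * (- (a + 1) / b / 2) *+ 2 = -1 by field.
  lra.
have cp : 0 < c by rewrite lt_neqAle eq_sym cn0.
have := D (- b / c).
have -> : a + b * (- b / c) *+ 2 + (- b / c) ^+ 2 * c = (a * c - b ^+ 2) / c by field.
by rewrite pmulr_lge0 ?invr_gt0// subr_ge0.
Qed.

Lemma L2seminormD f g : L2seminorm (f + g) <= L2seminorm f + L2seminorm g.
Proof.
rewrite -ler_sqr ?nnegrE ?addr_ge0 ?sqrtr_ge0//.
rewrite sqr_sqrtr ?L2ip_ge0// L2ipDD sqrrD !sqr_sqrtr ?L2ip_ge0//.
by rewrite lerD2r lerD2l lerMn2r L2CS.
Qed.

Lemma L2null_submod_closed : submod_closed L2null.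
Proof.
split=> [|a f g /L2seminorm_eq0 f0 /L2seminorm_eq0 g0].
  by apply/L2seminorm_eq0; rewrite -(scale0r 0) L2seminormZ normr0 mul0r.
apply/L2seminorm_eq0/eqP; rewrite eq_le sqrtr_ge0 andbT.
by rewrite (le_trans (L2seminormD _ _))// L2seminormZ f0 g0 mulr0 addr0.
Qed.
HB.instance Definition _ :=
  GRing.isSubmodClosed.Build R L2fun L2null L2null_submod_closed.

(* L^2(mu)^I, with the norm sqrt (sum_i int |u_i|^2); repr picks a
   representative of a class. *)
Definition L2 := Quotient.quot L2null.
HB.instance Definition _ := GRing.Zmodule.on L2.
HB.instance Definition _ : EqQuotient L2fun (Quotient.equiv L2null) L2 := EqQuotient.on L2.

Lemma L2_piE (f g : L2fun) : (\pi_L2 f == \pi_L2 g) = (f - g \in L2null).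
Proof. by rewrite eqmodE. Qed.

Lemma L2_piD f g : \pi_L2 (f + g) = \pi_L2 f + \pi_L2 g.
Proof. by rewrite raddfD. Qed.

Definition L2scale (a : R) (u : L2) : L2 := \pi_L2 (a *: repr u).

Lemma L2_piZ a f : \pi_L2 (a *: f) = L2scale a (\pi_L2 f).
Proof.
apply/eqP; rewrite L2_piE -scalerBr rpredZ// -L2_piE.
by rewrite reprK.
Qed.

Let scaleA a b v : L2scale a (L2scale b v) = L2scale (a * b) v.
Proof.
by elim/quotW: v => f; rewrite -(L2_piZ b) -(L2_piZ a) -(L2_piZ (a * b)) scalerA.
Qed.
Let scale1 : left_id 1 L2scale.
Proof. by elim/quotW => f; rewrite -(L2_piZ 1) scale1r. Qed.
Let scaleDr : right_distributive L2scale +%R.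
Proof.
move=> a; elim/quotW => f; elim/quotW => g.
by rewrite -L2_piD -!(L2_piZ a) -L2_piD scalerDr.
Qed.
Let scaleDl v : {morph L2scale^~ v : a b / a + b}.
Proof.
elim/quotW: v => f a b; rewrite -(L2_piZ (a + b)) -(L2_piZ a) -(L2_piZ b).
by rewrite -L2_piD scalerDl.
Qed.

HB.instance Definition _ :=
  GRing.Zmodule_isLmodule.Build R L2 scaleA scale1 scaleDr scaleDl.

Definition L2norm (u : L2) : R := L2seminorm (repr u).

Lemma L2norm_pi f : L2norm (\pi_L2 f) = L2seminorm f.
Proof.
have null_le g h : g - h \in L2null -> L2seminorm g <= L2seminorm h.
  move=> /L2seminorm_eq0 gh; rewrite -[g](subrK h).
  by rewrite (le_trans (L2seminormD _ _))// gh add0r.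
have fN : repr (\pi_L2 f) - f \in L2null by rewrite -L2_piE reprK.
apply/eqP; rewrite eq_le /L2norm !null_le//.
by rewrite -opprB rpredN.
Qed.

Let normD u v : L2norm (u + v) <= L2norm u + L2norm v.
Proof.
elim/quotW: u => f; elim/quotW: v => g.
by rewrite -L2_piD !L2norm_pi L2seminormD.
Qed.
Let normZ a u : L2norm (a *: u) = `|a| * L2norm u.
Proof.
elim/quotW: u => f; rewrite -[_ *: _](L2_piZ a) !L2norm_pi.
exact: L2seminormZ.
Qed.
Let norm_eq0 u : L2norm u = 0 -> u = 0.
Proof.
elim/quotW: u => f; rewrite L2norm_pi => /L2seminorm_eq0 f0.
by apply/eqP; rewrite -(raddf0 \pi_L2) L2_piE subr0.
Qed.

HB.instance Definition _ := Lmodule_isNormed.Build R L2 normD normZ norm_eq0.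

End L2fun.

(* measurableTypeR R is R with the sigma-algebra on which lebesgue_measure is
   defined. *)
Definition R3 (R : realType) : Type :=
  (measurableTypeR R * measurableTypeR R * measurableTypeR R)%type.

Section R3.
Variable R : realType.
Notation R3 := (R3 R).
HB.instance Definition _ := NormedModule.on R3.
HB.instance Definition _ := Measurable.on R3.

Definition leb3 : set R3 -> \bar R :=
  ((@lebesgue_measure R \x @lebesgue_measure R) \x @lebesgue_measure R)%E.
HB.instance Definition _ := Measure.on leb3.

Lemma open_measurable3 (A : set R3) : open A -> measurable A.
Proof.
pose box (t : rat * rat * rat * nat) : set R3 :=
  let: (a, b, c, n) := t in
  (ball (ratr a : R) n.+1%:R^-1 `*` ball (ratr b : R) n.+1%:R^-1) `*`
  ball (ratr c : R) n.+1%:R^-1.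
have mball (x r : R) : measurable (ball x r : set (measurableTypeR R)).
  exact: measurable_ball.
have mbox t : measurable (box t).
  by case: t => [[[a b] c] n]; do 2! [apply: measurableX => //]; exact: mball.
move=> oA.
have -> : A = \bigcup_k (if unpickle k is Some t then
    if `[< box t `<=` A >] then box t else set0 else set0).
  apply/seteqP; split=> [x Ax|x [k _]]; last first.
    by case: unpickle => // t; case: asboolP => // tA /tA.
  have : nbhs x A by exact: open_nbhs_nbhs.
  case/nbhs_ballP => r /= r0 xrA.
  have [n nr] : exists n : nat, 2 * n.+1%:R^-1 < r.
    have r2 : 0 < r / 2 by rewrite divr_gt0.
    have [n _ /(_ n (leqnn n)) /= nr] := near_infty_natSinv_lt (PosNum r2).
    exists n.
    by rewrite mulrC -ltr_pdivlMr.
  have n0 : 0 < n.+1%:R^-1 :> R by rewrite invr_gt0.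
  have dense (y : R) : exists q : rat, `|ratr q - y| < n.+1%:R^-1.
    have yn : y - n.+1%:R^-1 < y + n.+1%:R^-1.
      by rewrite ltrBlDr -addrA ltrDl addr_gt0.
    have [q] := rat_in_itvoo yn.
    rewrite in_itv /= => /andP[q1 q2]; exists q.
    by rewrite ltr_distl q1 q2.
  case: x Ax xrA => [[x1 x2] x3] Ax xrA.
  have [a ha] := dense x1; have [b hb] := dense x2; have [c hc] := dense x3.
  exists (pickle (a, b, c, n)); first exact: Logic.I.
  rewrite pickleK.
  case: asboolP => [_|[]].
    by split; [split; [exact: ha|exact: hb]|exact: hc].
  move=> [[y1 y2] y3] [[/= y1h y2h] y3h].
  have D (p q s : R) : `|p - q| < n.+1%:R^-1 -> `|p - s| < n.+1%:R^-1 ->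
      `|q - s| < r.
    move=> pq ps; rewrite -(subrKA p) (le_lt_trans (ler_normD _ _))//.
    rewrite (distrC q p); apply: lt_trans nr.
    by rewrite mulr_natl mulr2n ltrD.
  have h1 := D _ _ _ ha y1h; have h2 := D _ _ _ hb y2h.
  have h3 := D _ _ _ hc y3h.
  by apply: xrA; split; [split; [exact h1|exact h2]|exact h3].
apply: bigcupT_measurable => k; case: unpickle => [t|]; last exact: measurable0.
by case: ifPn => _; [exact: mbox|exact: measurable0].
Qed.

Definition e3 (i : 'I_3) : R3 := ((i == 0)%:R, (i == 1)%:R, (i == 2)%:R).

Definition pderiv (i : 'I_3) (phi : R3 -> R) : R3 -> R := 'D_(e3 i) phi.

(* Iterated partial derivatives along the multi-index s. *)
Definition pderivs (s : seq 'I_3) (phi : R3 -> R) : R3 -> R :=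
  foldr pderiv phi s.

Definition smooth (phi : R3 -> R) : Prop :=
  forall s, continuous (pderivs s phi) /\
    forall i x, derivable (pderivs s phi) x (e3 i).
End R3.

Record bounded_domain (R : realType) := BoundedDomain {
  dom :> set (R3 R);
  dom_open : open dom;
  dom_connected : connected dom;
  dom_nonempty : dom !=set0;
  dom_bounded : bounded_set dom }.
Arguments dom {R} _.
Arguments dom_open {R} _.

Section spaces.
Variables (R : realType) (Omega : bounded_domain R).
Local Notation R3 := (R3 R).

(* L2 (lebO Omega) I is L^2(Omega)^I: values outside Omega are irrelevant. *)
Definition lebO : {measure set R3 -> \bar R} :=
  mrestr (@leb3 R) (open_measurable3 (dom_open Omega)).

(* C_c^infty(Omega), its elements being extended by 0 to R^3. *)
Definition test_function (phi : R3 -> R) : Prop :=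
  [/\ smooth phi, compact (closure [set x | phi x != 0]) &
      closure [set x | phi x != 0] `<=` Omega].

Definition represents (I : finType) (u : L2 lebO I) (phi : I -> R3 -> R) :=
  forall i, {ae lebO, forall x, repr u i x = phi i x}.

Definition Ccinfty : set (L2 lebO 'I_3) := [set u | exists phi,
  (forall i, test_function (phi i)) /\ represents u phi].

Definition Ccinfty_div0 : set (L2 lebO 'I_3) := [set u | exists phi,
  [/\ forall i, test_function (phi i),
      forall x, \sum_i pderiv i (phi i) x = 0 & represents u phi]].

Definition H_pred : {pred L2 lebO 'I_3} := mem (closure Ccinfty_div0).

Lemma pderivs_lin (s : seq 'I_3) a (phi psi : R3 -> R) :
  smooth phi -> smooth psi ->
  pderivs s (a \*: phi + psi) = a \*: pderivs s phi + pderivs s psi.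
Proof.
move=> sphi spsi; elim: s => //= i s ->; apply/funext => x; rewrite /pderiv.
have dphi : derivable (a \*: pderivs s phi) x (e3 R i).
  by apply: derivableZ; exact: (sphi s).2.
rewrite deriveD//; last exact: (spsi s).2.
by rewrite deriveZ//; exact: (sphi s).2.
Qed.

Lemma smooth_lin a (phi psi : R3 -> R) :
  smooth phi -> smooth psi -> smooth (a \*: phi + psi).
Proof.
move=> sphi spsi s; rewrite pderivs_lin//.
have [cphi dphi] := sphi s; have [cpsi dpsi] := spsi s; split => [x|i x].
  by apply: cvgD; [apply: cvgZr; exact: cphi|exact: cpsi].
by apply: derivableD => //; exact: derivableZ.
Qed.

Lemma test_function_lin a (phi psi : R3 -> R) :
  test_function phi -> test_function psi -> test_function (a \*: phi + psi).
Proof.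
move=> [sphi cphi ophi] [spsi cpsi opsi].
have sub : closure [set x | (a \*: phi + psi) x != 0] `<=`
    closure [set x | phi x != 0] `|` closure [set x | psi x != 0].
  rewrite -closureU; apply: closureS => x /=.
  apply: contraPP => /not_orP[/negP/negPn/eqP p0 /negP/negPn/eqP q0].
  have -> : (a \*: phi + psi) x = a * phi x + psi x by [].
  by rewrite p0 q0 mulr0 addr0 eqxx.
split; first exact: smooth_lin.
  apply: subclosed_compact sub; first exact: closed_closure.
  exact: compactU.
by move=> x /sub[/ophi|/opsi].
Qed.

Lemma represents_lin (I : finType) a (u v : L2 lebO I) phi psi :
  represents u phi -> represents v psi ->
  represents (a *: u + v) (fun i => a \*: phi i + psi i).
Proof.
move=> up vp i.
have E : a *: u + v = \pi_(L2 lebO I) (a *: repr u + repr v).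
  by rewrite L2_piD L2_piZ !reprK.
have : repr (a *: u + v) - (a *: repr u + repr v) \in @L2null _ _ _ lebO I.
  by rewrite -L2_piE reprK E.
move=> /asboolP/(_ i) N; near=> x.
have Nx : (repr (a *: u + v) - (a *: repr u + repr v)) i x = 0 by near: x.
have ux : repr u i x = phi i x by near: x; exact: up.
have vx : repr v i x = psi i x by near: x; exact: vp.
transitivity (a * repr u i x + repr v i x); last by rewrite ux vx.
by apply/eqP; rewrite -subr_eq0; apply/eqP; move: Nx; rewrite !ffunE.
Unshelve. all: by end_near.
Qed.

Lemma Ccinfty_div0_submod : Ccinfty_div0 0 /\
  forall a u v, Ccinfty_div0 u -> Ccinfty_div0 v -> Ccinfty_div0 (a *: u + v).
Proof.
have pd0 s : pderivs s (cst 0 : R3 -> R) = cst 0.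
  by elim: s => //= i s ->; apply/funext => x; rewrite /pderiv derive_cst.
split.
  exists (fun=> cst 0); split=> [i|x|i].
  - split=> [s||].
    + rewrite pd0; split=> [x|i' x]; first exact: cvg_cst.
      exact: derivable_cst.
    + rewrite (_ : [set _ | _] = set0); last first.
        by apply/seteqP; split=> // x /=; rewrite eqxx.
      by rewrite closure0; exact: compact0.
    + rewrite (_ : [set _ | _] = set0); last first.
        by apply/seteqP; split=> // x /=; rewrite eqxx.
      by rewrite closure0.
  - by rewrite big1// => i _; rewrite /pderiv derive_cst.
  - have : repr (0 : L2 lebO 'I_3) - 0 \in @L2null _ _ _ lebO 'I_3.
      by rewrite -L2_piE reprK raddf0.
    move=> /asboolP/(_ i); apply: filterS => x.
    by rewrite subr0.
move=> a u v [phi [tphi phi0 uphi]] [psi [tpsi psi0 vpsi]].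
exists (fun i => a \*: phi i + psi i); split=> [i|x|].
- exact: test_function_lin.
- have E i : pderiv i (a \*: phi i + psi i) x =
      a * pderiv i (phi i) x + pderiv i (psi i) x.
    have [sphi _ _] := tphi i; have [spsi _ _] := tpsi i.
    by have := pderivs_lin [:: i] a sphi spsi; move/(congr1 (@^~ x)).
  under eq_bigr do rewrite E.
  by rewrite big_split /= -mulr_sumr phi0 psi0 mulr0 addr0.
- exact: represents_lin.
Qed.

Lemma closure_lin (E : normedModType R) (A : set E) a (u v : E) :
  (forall u v, A u -> A v -> A (a *: u + v)) ->
  closure A u -> closure A v -> closure A (a *: u + v).
Proof.
move=> Alin uA vA B /nbhs_ballP[e /= e0 eB].
have a0 : 0 < `|a| + 1 by rewrite ltr_wpDl.
have e2 : 0 < e / 2 by rewrite divr_gt0.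
have [y [Ay uy]] := uA _ (nbhsx_ballx u _ (divr_gt0 e2 a0)).
have [z [Az vz]] := vA _ (nbhsx_ballx v _ e2).
exists (a *: y + z); split; first exact: Alin.
apply: eB; move: uy vz; rewrite -!ball_normE /= => uy vz.
rewrite opprD addrACA -scalerBr (le_lt_trans (ler_normD _ _))// normrZ.
rewrite [e]splitr ler_ltD//; move: uy; rewrite ltr_pdivlMr// => /ltW.
by apply: le_trans; rewrite mulrC ler_wpM2l// lerDl.
Qed.

Lemma H_submod_closed : submod_closed H_pred.
Proof.
have [V0 Vlin] := Ccinfty_div0_submod.
split=> [|a u v /[!inE] uH vH].
  by rewrite inE; exact: subset_closure.
by apply: closure_lin => // ? ?; exact: Vlin.
Qed.
HB.instance Definition _ :=
  GRing.isSubmodClosed.Build R (L2 lebO 'I_3) H_pred H_submod_closed.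

Record Hspace := MkHspace { Hval :> L2 lebO 'I_3; _ : Hval \in H_pred }.
HB.instance Definition _ := [isSub for Hval].
HB.instance Definition _ := [Choice of Hspace by <:].
HB.instance Definition _ := [SubChoice_isSubLmodule of Hspace by <:].

Let Hnorm (u : Hspace) : R := `|Hval u|.
Let HnormD u v : Hnorm (u + v) <= Hnorm u + Hnorm v.
Proof. exact: ler_normD. Qed.
Let HnormZ a u : Hnorm (a *: u) = `|a| * Hnorm u.
Proof. exact: normrZ. Qed.
Let Hnorm_eq0 u : Hnorm u = 0 -> u = 0.
Proof. by move=> /normr0_eq0 u0; apply: val_inj. Qed.
HB.instance Definition _ := Lmodule_isNormed.Build R Hspace HnormD HnormZ Hnorm_eq0.

End spaces.

Section weak_topology.
Variables (R : realType) (E : normedModType R).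

Definition dual := {f : {linear E -> R^o} | continuous f}.

Definition weak :=
  initial_topology (fun u : E => (fun f => sval f u) : {ptws dual -> R^o}).
HB.instance Definition _ := Topological.on weak.

Definition weakly_compact (B : set E) : Prop := @compact weak B.

End weak_topology.

Section sobolev.
Variables (R : realType) (Omega : bounded_domain R).
Local Notation L2v := (L2 (lebO Omega) 'I_3).
Local Notation L2m := (L2 (lebO Omega) ('I_3 * 'I_3)%type).
Local Notation Hspace := (Hspace Omega).

(* G is the weak gradient of u, with G (i, j) the j-th derivative of u_i. *)
Definition weak_gradient (u : L2v) (G : L2m) : Prop :=
  forall i j phi, test_function Omega phi ->
    \int[lebO Omega]_x (repr u i x * pderiv j phi x) =
    - \int[lebO Omega]_x (repr G (i, j) x * phi x).

Definition H1 : set L2v := [set u | exists G, weak_gradient u G].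

(* Meaningful on H1 only, where the weak gradient is unique. *)
Definition grad (u : L2v) : L2m := xget 0 [set G | weak_gradient u G].

Definition H1norm (u : L2v) : R := Num.sqrt (`|u| ^+ 2 + `|grad u| ^+ 2).

Definition H1closure (A : set L2v) : set L2v :=
  [set u | H1 u /\ forall e : R, 0 < e ->
    exists v, [/\ A v, H1 v & H1norm (u - v) < e]].

Definition H10 : set L2v := H1closure (@Ccinfty R Omega).

Definition Vspace : set Hspace :=
  [set u | (H10 `&` H1closure (@Ccinfty_div0 R Omega)) u].

Definition Vnorm (u : Hspace) : R := `|grad u|.

(* An element of V' is represented by a function on H of which only the values
   on V matter. *)
Definition Vdual : set (Hspace -> R) := [set f |
  (forall (a : R) u v, Vspace u -> Vspace v ->
    f (a *: u + v) = a * f u + f v) /\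
  exists C : R, forall u, Vspace u -> `|f u| <= C * Vnorm u].

Definition ell (nu : R) (f : Hspace -> R) (u : Hspace) : R :=
  nu * Vnorm u ^+ 2 - f u.

Definition enstrophy (u : Hspace) : \bar R :=
  if `[< Vspace u >] then (Vnorm u ^+ 2)%:E else +oo%E.

End sobolev.

Definition borel (T : ptopologicalType) := g_sigma_algebraType (@open T).
HB.instance Definition _ (T : ptopologicalType) := Measurable.on (borel T).

Arguments Vspace {R Omega}.
Arguments Vdual {R Omega}.

Section extreme.
Context d (T : measurableType d) (R : realType).

Definition mixture (mu : set T -> \bar R) (a b : R) (y z : set T -> \bar R) :=
  forall A, measurable A -> mu A = (a%:E * y A + b%:E * z A)%E.

(* The library's measures are functions on all sets, so equality of measures
   has to be tested on measurable sets. *)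
Definition extreme_points (C : set (probability T R)) :
    set (probability T R) :=
  [set mu | C mu /\ ~ exists y z theta,
    [/\ C y, C z, exists2 A, measurable A & y A <> z A, 0 < theta < 1 &
        mixture mu (1 - theta) theta y z]].

End extreme.

(* psi is C^1 on [0, +oo[ (one-sided derivative at 0) with derivative dpsi; the
   values of psi and dpsi on ]-oo, 0[ are irrelevant. *)
Definition C1_with_derivative (R : realType) (psi dpsi : R -> R) : Prop :=
  (forall t : R, 0 <= t ->
    (psi s - psi t) / (s - t) @[s --> within [set s | 0 <= s] t^'] --> dpsi t)
  /\ {within `[0, +oo[, continuous dpsi}.

Section stationary.
Variables (R : realType) (Omega : bounded_domain R).
Variables (nu : R) (f : Hspace Omega -> R) (B : set (Hspace Omega)).

Definition carried : set (probability (borel (Hspace Omega)) R) :=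
  [set mu | mu B = 1%E].

(* The finiteness of the first integral forces mu V = 1, so the second integral,
   taken over V where ell makes sense, is the integral over H. *)
Definition Pfp : set (probability (borel (Hspace Omega)) R) :=
  [set mu | [/\ carried mu, (\int[mu]_u enstrophy u < +oo)%E &
    forall psi dpsi : R -> R, C1_with_derivative psi dpsi ->
      (forall t : R, 0 <= t -> 0 <= psi t) ->
      (forall s t : R, 0 <= s -> s <= t -> psi s <= psi t) ->
      (exists M : R, forall t : R, 0 <= t -> `|dpsi t| <= M) ->
      (\int[mu]_(u in Vspace)
         (dpsi (`|u : Hspace Omega| ^+ 2) * ell nu f u)%:E <= 0)%E]].

Definition Bf1 : set (R * R * Hspace Omega * Hspace Omega) :=
  [set (1, 0, u, u) | u in [set u | [/\ B u, Vspace u & ell nu f u <= 0]]].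

Definition Bf2 : set (R * R * Hspace Omega * Hspace Omega) :=
  [set p | let: (theta1, theta2, u1, u2) := p in
    [/\ 0 < theta1 < 1, theta2 = 1 - theta1,
        [/\ B u1, Vspace u1, B u2 & Vspace u2], `|u1| = `|u2| &
        ell nu f u1 < 0 < ell nu f u2 /\
        theta1 * ell nu f u1 + theta2 * ell nu f u2 = 0]].

Definition Bf := Bf1 `|` Bf2.

End stationary.

(* Main.v *)
(* Testing the constraint with derivatives psi' that approximate the indicators
   of [0, t] and of its complement shows that a measure satisfying it can be
   reweighted independently on {|u|^2 <= t} and on {|u|^2 > t}; an extreme
   measure mu therefore lives on a sphere |u| = r, where the constraint is the
   single inequality (integral of ell) <= 0.  If A_1, A_2, A_3 was a partition
   into sets of positive measure, some nonzero h = sum_i e_i 1_{A_i} would solve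
   the two linear equations saying that the integrals of h and of h ell vanish,
   and mu would be the midpoint of (1 + h) mu and (1 - h) mu.  So mu has at most
   two atoms, which are points because countably many continuous functionals
   separate the points of H.

   This requires V, the gradient norm and f to be Borel.  The sets
   {u in V : |grad u| <= C, f u <= c} are closed in H: if u is a limit of such a
   set, then near-minimizers of |grad v| among its elements v at distance <= 1/n
   of u have Cauchy gradients by the parallelogram identity (the set is convex),
   hence they converge to u in V.  Norms of gradients make sense because weak
   gradients are unique, the bumps exp (-1 / (n (t - a) (b - t))) converging to
   the indicator of ]a, b[. *)

(* The reweighting argument only needs $|u|^2$, ell and the enstrophy to be measurable, so it is
   carried out on an abstract measurable space; the functions psi' become nonnegative bounded
   continuous functions on the whole line.

   For a measure with two atoms the constraint must be an equality: if the integral of ell were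
   negative, a small transfer of mass between the atoms, in either direction, would keep it
   nonpositive. The transfer must also change that integral, for otherwise it would be allowed as
   well; hence ell has strict and opposite signs at the atoms.

   Conversely, if such a two-point measure is a convex combination of y and z, both charge only
   $u_1$ and $u_2$. The constraint with psi' = 1 forces each to give $u_1$ at least the mass
   $\theta_1$; their average gives it exactly $\theta_1$, so y = z.

   Weak compactness makes B norm closed, hence Borel, so that the atoms of a measure carried by B
   lie in B. *)
Require Import Defs.
From HB Require Import structures.
From mathcomp Require Import all_boot all_order all_algebra.
From mathcomp Require Import all_classical all_reals all_analysis.
From mathcomp Require Import measurable_realfun ring lra.
Set Implicit Arguments.
Unset Strict Implicit.
Unset Printing Implicit Defensive.
Import Order.TTheory GRing.Theory Num.Theory.
Import numFieldNormedType.Exports.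
Local Open Scope classical_set_scope.
Local Open Scope ring_scope.
Local Open Scope quotient_scope.

(** * The Hilbert space structure of L2 *)

Section L2theory.
Context d (T : measurableType d) (R : realType).
Variables (mu : {measure set T -> \bar R}) (I : finType).
Implicit Types (u v w : L2 mu I) (f g : L2fun mu I).

Definition ip u v : R := L2ip (repr u) (repr v).

(** Cauchy-Schwarz for f and for -f bounds the product by 0 from both sides. *)
Lemma L2ip_nulll f g : f \in @L2null _ _ _ mu I -> L2ip f g = 0.
Proof.
move=> f0; have nf : L2seminorm f = 0 by apply/L2seminorm_eq0.
have h (a : R) : L2ip (a *: f) g <= 0.
  by rewrite (le_trans (L2CS _ _))// L2seminormZ nf mulr0 mul0r.
have h1 := h 1; have h2 := h (-1).
rewrite !L2ipZl in h1 h2.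
by apply/eqP; rewrite eq_le; lra.
Qed.

Lemma ip_pi f g : ip (\pi_(L2 mu I) f) (\pi_(L2 mu I) g) = L2ip f g.
Proof.
have h k (l : L2fun mu I) : L2ip (repr (\pi_(L2 mu I) k)) l = L2ip k l.
  rewrite -[repr _](subrK k) L2ipDl L2ip_nulll ?add0r//.
  by rewrite -L2_piE reprK.
by rewrite /ip h L2ipC h L2ipC.
Qed.

Lemma ipC u v : ip u v = ip v u. Proof. exact: L2ipC. Qed.

Lemma ip_linl a u v w : ip (a *: u + v) w = a * ip u w + ip v w.
Proof.
elim/quotW: u => u; elim/quotW: v => v; elim/quotW: w => w.
by rewrite -[a *: _](L2_piZ a) -L2_piD !ip_pi L2ipDl L2ipZl.
Qed.

Lemma ipDl u v w : ip (u + v) w = ip u w + ip v w.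
Proof. by rewrite -[u]scale1r ip_linl mul1r scale1r. Qed.
Lemma ipZl a u v : ip (a *: u) v = a * ip u v.
Proof.
have := ip_linl 0 0 0 v; rewrite scale0r add0r mul0r add0r => _.
have z : ip 0 v = 0 by have := ip_linl 1 0 0 v; rewrite scaler0 addr0; lra.
by rewrite -[a *: u]addr0 ip_linl z addr0.
Qed.
Lemma ipDr w u v : ip w (u + v) = ip w u + ip w v.
Proof. by rewrite ipC ipDl !(ipC w). Qed.
Lemma ipZr a u v : ip v (a *: u) = a * ip v u.
Proof. by rewrite ipC ipZl ipC. Qed.

Lemma ipNl u v : ip (- u) v = - ip u v.
Proof. by rewrite -scaleN1r ipZl mulN1r. Qed.

Lemma ip_norm u : ip u u = `|u| ^+ 2.
Proof. by rewrite sqr_sqrtr// L2ip_ge0. Qed.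

Lemma ip_le u v : `|ip u v| <= `|u| * `|v|.
Proof.
rewrite ler_norml; apply/andP; split; last exact: L2CS.
by rewrite lerNl -[`|u|]normrN -ipNl; exact: L2CS.
Qed.

(** The sum appears as a midpoint because midpoints are what [mazur] keeps inside a convex set. *)
Lemma parallelogram u v :
  `|u - v| ^+ 2 = 2 * `|u| ^+ 2 + 2 * `|v| ^+ 2 - 4 * `|2^-1 *: u + 2^-1 *: v| ^+ 2.
Proof.
rewrite -!ip_norm !(ipDl, ipDr, ipZl, ipZr, ipNl, ipC _ (- v)) (ipC v u).
by field.
Qed.

End L2theory.

(** The telescoping series of the increments converges absolutely, being dominated by a geometric
    series. *)
Lemma cvg_geometric_increments (R : realType) (u : R^nat) (C : R) :
  (forall n, `|u n - u n.+1| <= C * 2^-1 ^+ n) -> cvgn u.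
Proof.
move=> uC; have C0 : 0 <= C.
  by have := uC 0%N; rewrite expr0 mulr1; exact: le_trans.
have : cvgn [normed series (telescope u)].
  apply: (@series_le_cvg _ _ (geometric C 2^-1)) => [n|n|n|] //=.
  - by rewrite mulr_ge0// exprn_ge0// invr_ge0.
  - by rewrite /telescope /= distrC.
  - by apply: is_cvg_geometric_series; rewrite ger0_norm ?invf_lt1 ?ltr1n.
move=> /normed_cvg; rewrite telescopeK => cu.
have -> : u = (fun n => u 0%N + (u n - u 0%N)).
  by apply/funext => n; rewrite addrC subrK.
by apply: is_cvgD => //; exact: is_cvg_cst.
Qed.

Lemma cvgn_EFin (R : realType) (u : R^nat) (l : R) :
  u @ \oo --> l -> (u n)%:E @[n --> \oo] --> l%:E.
Proof. by move=> ul; apply: cvg_EFin => //; exact: nearW. Qed.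

(** * Completeness of L2 (Riesz-Fischer) *)

Section riesz_fischer.
Context d (T : measurableType d) (R : realType).
Variables (mu : {measure set T -> \bar R}).
Notation Lf := (LfunType mu (le1_2E R)).

Lemma Lfun2_sqr_integral (f : T -> R) : measurable_fun setT f ->
  (\int[mu]_x (f x ^+ 2)%:E < +oo)%E -> f \in Lfun mu 2%:E.
Proof.
move=> mf foo; rewrite inE; apply/andP; split; first by rewrite inE.
rewrite inE /finite_norm /= unlock /=.
apply: poweR_lty; apply: le_lt_trans foo.
rewrite le_eqVlt; apply/orP; left; apply/eqP; apply: eq_integral => x _.
by rewrite /= powR_mulrn// real_normK// num_real.
Qed.

(** The rate 8^-n leaves room for the weights 4^n, since 4^n 8^-n = 2^-n is still summable; this
    gives pointwise convergence without extracting a subsequence. Fatou's lemma then transfers the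
    bound to the limit. *)
Lemma Lfun_complete (f : nat -> Lf) :
  (forall n m, (n <= m)%N ->
     (\int[mu]_x ((f n x - f m x) ^+ 2)%:E <= (8^-1 ^+ n)%:E)%E) ->
  exists F : Lf, forall n,
     (\int[mu]_x ((f n x - F x) ^+ 2)%:E <= (8^-1 ^+ n)%:E)%E.
Proof.
move=> fC.
have mf n : measurable_fun setT (f n) by exact: measurable_funPT.
have mD n m : measurable_fun setT (fun x => ((f n x - f m x) ^+ 2)%:E).
  by apply/measurable_EFinP/measurable_funX/measurable_funB.
(* With the weights 4^n, finiteness of S x bounds the increments of f n x by a
   geometric sequence. *)
pose S x := (\sum_(n <oo) (4 ^+ n)%:E * ((f n x - f n.+1 x) ^+ 2)%:E)%E.
have S_ge0 n x : (0 <= (4 ^+ n)%:E * ((f n x - f n.+1 x) ^+ 2)%:E)%E.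
  by rewrite -EFinM lee_fin mulr_ge0 ?sqr_ge0// exprn_ge0.
have mS n : measurable_fun setT
    (fun x => (4 ^+ n)%:E * ((f n x - f n.+1 x) ^+ 2)%:E)%E.
  exact: measurable_funeM.
have iS : mu.-integrable setT S.
  apply/integrableP; split; first by apply: ge0_emeasurable_sum => *.
  under eq_integral do rewrite gee0_abs ?nneseries_ge0//.
  rewrite integral_nneseries//.
  apply: (@le_lt_trans _ _ 2%:E); last by rewrite ltry.
  (* With total 2, the n-th term of the trick is 2 / 2^(n+1) = 2^-n. *)
  apply: le_trans (epsilon_trick0 predT _); last by [].
  apply: lee_nneseries => [n _ _|n _]; first exact: integral_ge0.
  rewrite ge0_integralZl_EFin ?exprn_ge0//; last first.
    by move=> x _; rewrite lee_fin sqr_ge0.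
  apply: (@le_trans _ _ ((4 ^+ n)%:E * (8^-1 ^+ n)%:E)%E).
    by apply: lee_wpmul2l; rewrite ?lee_fin ?exprn_ge0//; apply: fC.
  rewrite -EFinM lee_fin natrX exprS -exprMn.
  have -> : 4 * 8^-1 = 2^-1 :> R by field.
  by rewrite exprVn invfM mulrA divff ?mul1r// pnatr_eq0.
have cvf : {ae mu, forall x, cvgn (fun n => f n x)}.
  have := integrable_ae measurableT iS.
  apply: filterS => x /(_ Logic.I) Sfin.
  apply: (@cvg_geometric_increments _ _ (Num.sqrt (fine (S x)))) => n.
  have : ((4 ^+ n)%:E * ((f n x - f n.+1 x) ^+ 2)%:E <= S x)%E.
    have := @nneseries_lim_ge R
      (fun n => (4 ^+ n)%:E * ((f n x - f n.+1 x) ^+ 2)%:E)%E xpredT 0%N n.+1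
      (fun k _ _ => S_ge0 k x).
    apply: le_trans; rewrite big_nat_recr//=.
    by rewrite leeDr// sume_ge0.
  have S0 : 0 <= fine (S x) by apply: fine_ge0; apply: nneseries_ge0 => k _ _; exact: S_ge0.
  rewrite -(fineK Sfin) -EFinM lee_fin => le4.
  rewrite -sqrtr_sqr -[_ ^+ n]ger0_norm ?exprn_ge0 ?invr_ge0//.
  rewrite -sqrtr_sqr -sqrtrM//.
  rewrite ler_wsqrtr// exprAC.
  rewrite (_ : 2^-1 ^+ 2 = 4^-1 :> R); last by field.
  by rewrite exprVn ler_pdivlMr ?exprn_gt0// mulrC.
(* The upper limit is defined and measurable everywhere, and equals the limit wherever [f n x]
   converges. *)
pose F x := fine (limn_esup (fun n => (f n x)%:E)).
have mF : measurable_fun setT F.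
  apply: (measurableT_comp (fine_measurable measurableT)).
  apply: (@measurable_fun_limn_esup _ _ _ _ (fun k x => (f k x)%:E)).
  by move=> k; apply/measurable_EFinP.
have fF : {ae mu, forall x, f n x @[n --> \oo] --> F x}.
  apply: filterS cvf => x /cvg_ex[l fl].
  suff -> : F x = l by [].
  rewrite /F; have /cvg_limn_einf_sup[_ ->]// : (f n x)%:E @[n --> \oo] --> l%:E.
  by apply: cvg_EFin => //; exact: nearW.
have mDF n : measurable_fun setT (fun x => ((f n x - F x) ^+ 2)%:E).
  by apply/measurable_EFinP/measurable_funX/measurable_funB.
have bound n : (\int[mu]_x ((f n x - F x) ^+ 2)%:E <= (8^-1 ^+ n)%:E)%E.
  have -> : (\int[mu]_x ((f n x - F x) ^+ 2)%:E =
    \int[mu]_x (limn_einf (fun m => ((f n x - f m x) ^+ 2)%:E)))%E.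
    apply: ge0_ae_eq_integral => //.
    - rewrite /limn_einf; apply: measurableT_comp => //.
      apply: (@measurable_fun_limn_esup _ _ _ _
        (fun m x => (- ((f n x - f m x) ^+ 2)%:E)%E)) => m.
      exact: measurableT_comp.
    - by move=> x _; rewrite lee_fin sqr_ge0.
    - move=> x _; rewrite limn_einf_lim; apply: lime_ge.
        exact: is_cvg_einfs.
      by apply: nearW => k; apply: le_ereal_inf_tmp => _ [m _ <-]; rewrite lee_fin sqr_ge0.
    apply: filterS fF => x fx _.
    have h : (f n x - f m x) ^+ 2 @[m --> \oo] --> (f n x - F x) ^+ 2.
      by apply: cvgM; apply: cvgB => //; exact: cvg_cst.
    by have [-> _] := cvg_limn_einf_sup (cvgn_EFin h).
  have D0 m x : setT x -> (0 <= ((f n x - f m x) ^+ 2)%:E)%E.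
    by rewrite lee_fin sqr_ge0.
  apply: (le_trans (fatou mu measurableT (mD n) D0)).
  rewrite limn_einf_lim; apply: lime_le; first exact: is_cvg_einfs.
  apply: nearW => k.
  (* The index [maxn n k] belongs to the tail from k and satisfies the condition n <= m of the
     hypothesis. *)
  apply: le_trans (fC n (maxn n k) (leq_maxl _ _)).
  by apply: ereal_inf_lbound; exists (maxn n k) => //=; exact: leq_maxr.
have hL : (fun x => f 0%N x - F x) \in Lfun mu 2%:E.
  apply: Lfun2_sqr_integral; first exact: measurable_funB.
  by apply: le_lt_trans (bound 0%N) _; rewrite ltry.
have FL : F \in Lfun mu 2%:E.
  have -> : F = (f 0%N : T -> R) - (fun x => f 0%N x - F x).
    by apply/funext => x; rewrite !fctE /= subKr.
  apply: rpredB => //; [exact: le1_2E|move=> h; exact: LfunP].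
exists (Lfun_Sub (le1_2E R) FL) => n.
by rewrite (Lfun_valP (le1_2E R) FL).
Qed.

(** Each component inherits the Cauchy bound of the whole vector; adding up the limits' bounds costs
    the factor [#|I|]. *)
Lemma L2_complete (I : finType) (u : nat -> L2 mu I) :
  (forall n m, (n <= m)%N -> `|u n - u m| ^+ 2 <= 8^-1 ^+ n) ->
  exists l, forall n, `|u n - l| ^+ 2 <= #|I|%:R * 8^-1 ^+ n.
Proof.
have nE (g h : L2fun mu I) :
    `|\pi_(L2 mu I) g - \pi_(L2 mu I) h| ^+ 2 = \sum_i \int[mu]_x ((g i x - h i x) ^+ 2).
  rewrite -ip_norm -raddfB ip_pi; apply: eq_bigr => i _.
  by apply: eq_Rintegral => x _; rewrite !ffunE expr2.
have fE (g h : Lf) : (\int[mu]_x ((g x - h x) ^+ 2)%:E =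
    (\int[mu]_x ((g x - h x) ^+ 2))%:E)%E.
  rewrite /Rintegral fineK//; apply: integrable_fin_num => //.
  exact: (L2_integrable (g - h) (g - h)).
move=> uC.
have /choice[F FP] : forall i, exists F : Lf, forall n,
     (\int[mu]_x ((repr (u n) i x - F x) ^+ 2)%:E <= (8^-1 ^+ n)%:E)%E.
  move=> i; apply: Lfun_complete => n m nm; rewrite fE lee_fin.
  apply: le_trans (uC n m nm).
  rewrite -[in leRHS](reprK (u n)) -[in leRHS](reprK (u m)) nE (bigD1 i)//=.
  rewrite lerDl; apply: sumr_ge0 => j _; apply: Rintegral_ge0 => x _.
  exact: sqr_ge0.
exists (\pi_(L2 mu I) [ffun i => F i]) => n.
rewrite -[u n]reprK nE (_ : #|I|%:R * _ = \sum_(i : I) 8^-1 ^+ n); last first.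
  by rewrite sumr_const mulr_natl.
apply: ler_sum => i _; rewrite -lee_fin -fE; have := FP i n.
by under [X in _ -> (X <= _)%E]eq_integral do rewrite ffunE.
Qed.

End riesz_fischer.

(** * Bump functions *)

Section flat_functions.
Variable R : realType.

(** The powers of 1/s are those produced by differentiating exp (-1/s) repeatedly. *)
Definition flat_exp k (s : R) : R :=
  if 0 < s then s^-1 ^+ k * expR (- s^-1) else 0.

(** This is y^(k+2) / (k+2)! <= exp y at y = 1/s. Being quadratic in s, the bound makes the
    derivative at 0 vanish. *)
Lemma flat_exp_le k s : `|flat_exp k s| <= (k.+2)`!%:R * s ^+ 2.
Proof.
rewrite /flat_exp; case: ltP => s0; last first.
  by rewrite normr0 mulr_ge0 ?sqr_ge0.
have i0 : 0 < s^-1 by rewrite invr_gt0.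
rewrite ger0_norm; last by rewrite mulr_ge0 ?exprn_ge0 ?expR_ge0// ltW.
rewrite expRN ler_pdivrMr ?expR_gt0//.
have := expR_ge1Dxn k.+1 (ltW i0) => h.
have h2 : s^-1 ^+ k.+2 / (k.+2)`!%:R <= expR s^-1.
  by apply: le_trans h; rewrite lerDr.
rewrite ler_pdivrMr ?ltr0n ?fact_gt0// in h2.
have -> : s^-1 ^+ k = s ^+ 2 * s^-1 ^+ k.+2.
  by rewrite -[k.+2](addn2 k) [s^-1 ^+ (k + 2)]exprD mulrCA -exprMn divff ?gt_eqF// expr1n mulr1.
by rewrite -[leRHS]mulrA [leRHS]mulrCA ler_wpM2l ?sqr_ge0// mulrC.
Qed.

Lemma is_derive_of_cvg (f : R -> R) x l :
  h^-1 *: (f (h *: 1 + x) - f x) @[h --> 0^'] --> l -> is_derive x 1 f l.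
Proof.
by move=> h; apply: DeriveDef; [exact: cvgP h|exact: cvg_lim].
Qed.

Lemma is_derive_flat_exp k (s : R) :
  is_derive s 1 (flat_exp k) (flat_exp k.+2 s - k%:R * flat_exp k.+1 s).
Proof.
have [s0|s0|->] := ltgtP s 0.
- rewrite /flat_exp ltNge (ltW s0) /= mulr0 subr0.
  apply: (@near_eq_is_derive R R R (cst 0)) => //.
  by near=> t; rewrite ltNge (_ : t <= 0)//=; near: t; exact: lt_le_nbhsl.
- rewrite /flat_exp s0.
  apply: (@near_eq_is_derive R R R (fun s => s^-1 ^+ k * expR (- s^-1))) => //.
    by near=> t; rewrite (_ : 0 < t)//; near: t; exact: lt_nbhsr.
  have sn0 : s != 0 by rewrite gt_eqF.
  have di : is_derive s 1 (fun s => s^-1) (- s ^- 2).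
    apply: (is_derive_eq (@is_deriveV R id s 1 1 sn0 (is_derive_id s 1))).
    exact: mulr1.
  have de : is_derive s^-1 1 (fun y => expR (- y)) (- expR (- s^-1)).
    apply: (is_derive_eq (@is_derive1_comp R expR -%R s^-1 _ (-1) _ _)).
    by rewrite mulrN1.
  have dX : is_derive s^-1 1 (horner 'X^k) (k%:R * s^-1 ^+ k.-1).
    by apply: is_derive_eq; rewrite derivXn hornerMn hornerXn mulr_natl.
  have hX : horner 'X^k = (fun y : R => y ^+ k).
    by apply/funext => y; exact: hornerXn.
  rewrite hX in dX.
  apply: (is_derive_eq (is_derive1_comp (is_deriveM dX de) di)).
  rewrite /GRing.scale /= -exprVn.
  by case: k {dX hX} => [|k]; rewrite ?exprS /=; ring.
(* At 0 the quadratic bound forces the difference quotient to tend to 0. *)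
- have f0 j : flat_exp j 0 = 0 by rewrite /flat_exp ltxx.
  rewrite !f0 mulr0 subr0; apply: is_derive_of_cvg.
  apply/cvgr0Pnorm_le => e e0; near=> h.
  have hn0 : h != 0 by near: h; exact: nbhs_dnbhs_neq.
  have h0 : 0 < `|h| by rewrite normr_gt0.
  have := flat_exp_le k h.
  rewrite f0 addr0 subr0 [h *: 1]mulr1 normrZ normfV => fh.
  rewrite ler_pdivrMl// (le_trans fh)// -[h ^+ 2]real_normK ?num_real//.
  rewrite expr2 mulrCA ler_pM2l//.
  rewrite -ler_pdivlMl ?ltr0n ?fact_gt0//.
  near: h; apply: dnbhs0_le; rewrite mulr_gt0 ?invr_gt0 ?ltr0n ?fact_gt0//.
Unshelve. all: by end_near. Qed.

(* A class that contains [flat_exp k \o p] and is stable under derivation. *)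
Inductive flat (p : {poly R}) : (R -> R) -> Prop :=
| flat_base k q : flat p (fun t => flat_exp k p.[t] * q.[t])
| flat_add f g : flat p f -> flat p g -> flat p (fun t => f t + g t).

Lemma flat_derive p f : flat p f ->
  exists g, flat p g /\ forall t : R, is_derive t (1:R) f (g t).
Proof.
elim=> [k q|f1 f2 _ [g1 [fg1 dg1]] _ [g2 [fg2 dg2]]]; last first.
  exists (fun t => g1 t + g2 t); split; first exact: flat_add.
  by move=> t; exact: is_deriveD.
exists (fun t => flat_exp k.+2 p.[t] * (p^`() * q).[t] +
  (flat_exp k.+1 p.[t] * (- k%:R *: (p^`() * q)).[t] +
   flat_exp k p.[t] * q^`().[t])); split.
  by do 2! [apply: flat_add; first exact: flat_base]; exact: flat_base.
move=> t.
have d1 := is_derive1_comp (is_derive_flat_exp k p.[t]) (is_derive_poly p t).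
apply: (is_derive_eq (is_deriveM d1 (is_derive_poly q t))).
rewrite /GRing.scale /= hornerZ hornerM; ring.
Qed.

Lemma flat_continuous p f : flat p f -> continuous f.
Proof.
move=> /flat_derive[g [_ dg]] x; apply: differentiable_continuous.
by apply/derivable1_diffP; have [] := dg x.
Qed.

End flat_functions.

Section boxes.
Variable R : realType.
Implicit Types (f g h : R -> R) (x : R3 R).

Definition tensor f g h x : R := f x.1.1 * g x.1.2 * h x.2.

(** Meant for tensor products: along a coordinate axis two of the three factors are constant, and c
    is their product. *)
Lemma is_derive_along (F : R3 R -> R) x v (phi : R -> R) (t l c : R) :
  is_derive t (1:R) phi l -> (forall s, F (s *: v + x) = phi (s *: (1:R) + t) * c) ->
  is_derive x v F (l * c).
Proof.
move=> [dphi <-] FE.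
have E : (fun s : R => s^-1 *: (F (s *: v + x) - F x)) =
    (fun s => s^-1 *: (phi (s *: (1:R) + t) - phi t) * c).
  apply/funext => s; rewrite FE.
  have -> : F x = phi t * c by have := FE 0; rewrite !scale0r !add0r.
  by rewrite -mulrBl -scalerAl.
have C : s^-1 *: (F (s *: v + x) - F x) @[s --> 0^'] --> 'D_1 phi t * c.
  by rewrite E; apply: cvgM; [exact: dphi|exact: cvg_cst].
by apply: DeriveDef; [exact: cvgP C|exact: cvg_lim].
Qed.

Lemma tensor_derive (i : 'I_3) f g h (df dg dh : R -> R) x :
  (forall t : R, is_derive t (1:R) f (df t)) ->
  (forall t : R, is_derive t (1:R) g (dg t)) ->
  (forall t : R, is_derive t (1:R) h (dh t)) ->
  is_derive x (e3 R i) (tensor f g h)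
    (tensor (if i == 0 then df else f) (if i == 1 then dg else g)
            (if i == 2 then dh else h) x).
Proof.
move=> Df Dg Dh; case: x => [[x1 x2] x3].
have sE s : s *: e3 R i + ((x1, x2), x3) =
    ((s * (i == 0)%:R + x1, s * (i == 1)%:R + x2), s * (i == 2)%:R + x3) by [].
case: i sE => [[|[|[|//]]] ilt] sE; rewrite /tensor /=.
- apply: (is_derive_eq (is_derive_along (c := g x2 * h x3) (Df x1) _)).
    by move=> s; rewrite sE /= !mulr0 !add0r mulrA.
  by rewrite mulrA.
- apply: (is_derive_eq (is_derive_along (c := f x1 * h x3) (Dg x2) _)).
    by move=> s; rewrite sE /= !mulr0 !add0r mulrCA mulrA.
  by rewrite mulrCA mulrA.
- apply: (is_derive_eq (is_derive_along (c := f x1 * g x2) (Dh x3) _)).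
    by move=> s; rewrite sE /= !mulr0 !add0r mulrC.
  by rewrite mulrC.
Qed.

Lemma tensor_continuous f g h : continuous f -> continuous g -> continuous h ->
  continuous (tensor f g h).
Proof.
move=> cf cg ch x.
have c1 : (fun y : R3 R => y.1.1) y @[y --> x] --> x.1.1.
  by apply: (@cvg_comp _ _ _ fst fst _ (nbhs x.1)); exact: cvg_fst.
have c2 : (fun y : R3 R => y.1.2) y @[y --> x] --> x.1.2.
  by apply: (@cvg_comp _ _ _ fst snd _ (nbhs x.1)); [exact: cvg_fst|exact: cvg_snd].
have c3 : (fun y : R3 R => y.2) y @[y --> x] --> x.2 by exact: cvg_snd.
apply: cvgM; [apply: cvgM|].
- exact: (continuous_cvg _ (cf _) c1).
- exact: (continuous_cvg _ (cg _) c2).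
- exact: (continuous_cvg _ (ch _) c3).
Qed.

(** A partial derivative differentiates one factor and leaves it flat, so all iterated derivatives
    are again tensor products of flat functions. *)
Lemma tensor_smooth (p q r : {poly R}) f g h :
  flat p f -> flat q g -> flat r h -> smooth (tensor f g h).
Proof.
move=> ff fg fh.
have step f0 g0 h0 (i : 'I_3) : flat p f0 -> flat q g0 -> flat r h0 ->
    exists f1 g1 h1, [/\ flat p f1, flat q g1, flat r h1 &
      forall x, is_derive x (e3 R i) (tensor f0 g0 h0) (tensor f1 g1 h1 x)].
  move=> ff0 fg0 fh0.
  have [df [fdf Df]] := flat_derive ff0.
  have [dg [fdg Dg]] := flat_derive fg0.
  have [dh [fdh Dh]] := flat_derive fh0.
  exists (if i == 0 then df else f0), (if i == 1 then dg else g0),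
    (if i == 2 then dh else h0); split; try by case: ifP.
  by move=> x; exact: tensor_derive.
have iter s : exists f0 g0 h0, [/\ flat p f0, flat q g0, flat r h0 &
    pderivs s (tensor f g h) = tensor f0 g0 h0].
  elim: s => [|i s [f0 [g0 [h0 [ff0 fg0 fh0 E]]]]]; first by exists f, g, h.
  have [f1 [g1 [h1 [ff1 fg1 fh1 D]]]] := step f0 g0 h0 i ff0 fg0 fh0.
  exists f1, g1, h1; split => //=; rewrite E; apply/funext => x.
  by rewrite /pderiv; have [_ ->] := D x.
move=> s; have [f0 [g0 [h0 [ff0 fg0 fh0 ->]]]] := iter s; split.
  exact: (tensor_continuous (flat_continuous ff0) (flat_continuous fg0) (flat_continuous fh0)).
move=> i x; have [f1 [g1 [h1 [_ _ _ D]]]] := step f0 g0 h0 i ff0 fg0 fh0.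
by have [] := D x.
Qed.

Definition bump_poly (a b : R) n : {poly R} :=
  n.+1%:R *: (('X - a%:P) * (b%:P - 'X)).

Definition bump (a b : R) n (t : R) := flat_exp 0 (bump_poly a b n).[t].

Lemma bump_polyE a b n t : (bump_poly a b n).[t] = n.+1%:R * ((t - a) * (b - t)).
Proof. by rewrite /bump_poly !hornerE. Qed.

Lemma flat_bump a b n : flat (bump_poly a b n) (bump a b n).
Proof.
have := flat_base (bump_poly a b n) 0 1.
by congr flat; apply/funext => t; rewrite hornerC mulr1.
Qed.

Lemma bump_ge0 a b n t : 0 <= bump a b n t.
Proof. by rewrite /bump /flat_exp; case: ifP => // _; rewrite expr0 mul1r expR_ge0. Qed.

Lemma bump_le1 a b n t : bump a b n t <= 1.
Proof.
rewrite /bump /flat_exp; case: ifP => // t0.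
by rewrite expr0 mul1r -expR0 ler_expR oppr_le0 invr_ge0 ltW.
Qed.

Lemma bump_out a b n t : a < b -> ~~ (a < t < b) -> bump a b n t = 0.
Proof.
move=> ab; rewrite /bump /flat_exp bump_polyE pmulr_rgt0 ?ltr0n//.
rewrite negb_and -!leNgt; case: ifP => // h.
case/orP => h2; exfalso; move: h; apply/negP; rewrite -leNgt; nra.
Qed.

Lemma bump_cvg a b t : a < t < b -> bump a b n t @[n --> \oo] --> (1:R).
Proof.
move=> /andP[at_ tb]; set w := (t - a) * (b - t).
have w0 : 0 < w by rewrite mulr_gt0 ?subr_gt0.
have -> : (fun n => bump a b n t) = (fun n => expR (- (w^-1 * n.+1%:R^-1))).
  apply/funext => n; rewrite /bump /flat_exp bump_polyE -/w mulr_gt0 ?ltr0n//.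
  by rewrite expr0 mul1r invfM mulrC.
rewrite -[X in _ --> X]expR0; apply: continuous_cvg; first exact: continuous_expR.
rewrite -oppr0; apply: cvgN; rewrite -(mulr0 w^-1); apply: cvgM; first exact: cvg_cst.
exact: cvg_harmonic.
Qed.

Definition box (a b : R3 R) : set (R3 R) :=
  [set x | [/\ a.1.1 < x.1.1 < b.1.1, a.1.2 < x.1.2 < b.1.2 & a.2 < x.2 < b.2]].

Definition cbox (a b : R3 R) : set (R3 R) :=
  [set x | [/\ a.1.1 <= x.1.1 <= b.1.1, a.1.2 <= x.1.2 <= b.1.2 & a.2 <= x.2 <= b.2]].

Lemma compact_cbox a b : compact (cbox a b).
Proof.
have -> : cbox a b = (`[a.1.1, b.1.1]%classic `*` `[a.1.2, b.1.2]%classic) `*`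
    `[a.2, b.2]%classic.
  apply/seteqP; split=> [[[x1 x2] x3] [h1 h2 h3]|[[x1 x2] x3] [[h1 h2] h3]].
    by do ! split; rewrite /= in_itv.
  by split; [move: h1|move: h2|move: h3]; rewrite /= in_itv.
apply: compact_setX; last exact: segment_compact.
by apply: compact_setX; exact: segment_compact.
Qed.

Lemma box_cbox a b : box a b `<=` cbox a b.
Proof.
by move=> x [/andP[? ?] /andP[? ?] /andP[? ?]]; split; apply/andP; split; apply: ltW.
Qed.

Definition box_bump (a b : R3 R) n : R3 R -> R :=
  tensor (bump a.1.1 b.1.1 n) (bump a.1.2 b.1.2 n) (bump a.2 b.2 n).

Lemma box_bump_ge0 a b n x : 0 <= box_bump a b n x.
Proof. by rewrite /box_bump /tensor !mulr_ge0 ?bump_ge0. Qed.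

Lemma box_bump_le1 a b n x : box_bump a b n x <= 1.
Proof.
by rewrite /box_bump /tensor !mulr_ile1 ?mulr_ge0 ?bump_ge0 ?bump_le1.
Qed.

Lemma box_bump_cvg (a b x : R3 R) : a.1.1 < b.1.1 -> a.1.2 < b.1.2 -> a.2 < b.2 ->
  box_bump a b n x @[n --> \oo] --> (\1_(box a b) x : R).
Proof.
move=> ab1 ab2 ab3; rewrite indicE.
have [xab|xab] := pselect (box a b x).
  rewrite mem_set//=; case: xab => h1 h2 h3.
  rewrite (_ : true%:R = 1 * 1 * 1 :> R); last by rewrite !mulr1.
  by apply: cvgM; [apply: cvgM|]; exact: bump_cvg.
rewrite memNset//=; apply: cvg_near_cst; apply: nearW => n.
rewrite /box_bump /tensor.
have [h1|h1] := boolP (a.1.1 < x.1.1 < b.1.1); last by rewrite (bump_out n ab1 h1) !mul0r.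
have [h2|h2] := boolP (a.1.2 < x.1.2 < b.1.2); last by rewrite (bump_out n ab2 h2) mulr0 mul0r.
have [h3|h3] := boolP (a.2 < x.2 < b.2); last by rewrite (bump_out n ab3 h3) mulr0.
by exfalso; apply: xab.
Qed.

Lemma box_bump_test (Omega : bounded_domain R) (a b : R3 R) n :
  a.1.1 < b.1.1 -> a.1.2 < b.1.2 -> a.2 < b.2 -> cbox a b `<=` Omega ->
  test_function Omega (box_bump a b n).
Proof.
move=> ab1 ab2 ab3 abO.
have sub : closure [set x | box_bump a b n x != 0] `<=` cbox a b.
  have cl : closed (cbox a b).
    by apply: compact_closed; [exact: norm_hausdorff|exact: compact_cbox].
  have -> : cbox a b = closure (cbox a b) by exact/closure_id.
  apply: closureS => x /= h.
  apply: box_cbox; apply: contrapT => xab; move/negP: h; apply.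
  rewrite /box_bump /tensor.
  have [h1|h1] := boolP (a.1.1 < x.1.1 < b.1.1); last by rewrite (bump_out n ab1 h1) !mul0r.
  have [h2|h2] := boolP (a.1.2 < x.1.2 < b.1.2); last by rewrite (bump_out n ab2 h2) mulr0 mul0r.
  have [h3|h3] := boolP (a.2 < x.2 < b.2); last by rewrite (bump_out n ab3 h3) mulr0.
  by exfalso; apply: xab.
split; last exact: subset_trans sub abO.
  by apply: (tensor_smooth (p := bump_poly a.1.1 b.1.1 n)
    (q := bump_poly a.1.2 b.1.2 n) (r := bump_poly a.2 b.2 n)); exact: flat_bump.
by apply: subclosed_compact sub; [exact: closed_closure|exact: compact_cbox].
Qed.

End boxes.

(** * Integrable functions with vanishing integrals over boxes *)

(** The sets over which g has integral 0 form a Dynkin system, so all measurable sets are among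
    them. Applied to the set where g >= 0 and to its complement, this makes the integral of |g|
    vanish. *)
Lemma integral_pi_system_ae0 d (T : measurableType d) (R : realType)
    (mu : {measure set T -> \bar R}) (G : set (set T)) (g : T -> R) :
  mu.-integrable setT (EFin \o g) ->
  setI_closed G -> G `<=` measurable -> measurable `<=` <<s G >> -> G setT ->
  (forall A, G A -> (\int[mu]_(x in A) (g x)%:E = 0)%E) ->
  {ae mu, forall x, g x = 0}.
Proof.
move=> ig GI Gm mG GT G0.
have mg : measurable_fun setT (EFin \o g) by case/integrableP : ig.
have mgA A : measurable A -> measurable_fun A (EFin \o g).
  by move=> mA; exact: measurable_funTS.
pose H : set (set T) := [set A | measurable A /\ (\int[mu]_(x in A) (g x)%:E = 0)%E].
have dH : dynkin H.
  split.
  - by split => //; exact: G0.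
  - move=> A [mA A0]; split; first exact: measurableC.
    have := G0 _ GT; rewrite -(setUv A) integral_setU//.
    + by rewrite A0 add0e.
    + exact: measurableC.
    + by rewrite setUv; exact: mgA.
    + by rewrite disj_set2E setICr.
  - move=> F tF HF; split; first by apply: bigcupT_measurable => n; have [] := HF n.
    rewrite integral_bigcup//; last 2 first.
      by move=> n; have [] := HF n.
      by apply: integrableS ig => //; apply: bigcupT_measurable => n; have [] := HF n.
    by rewrite eseries0// => n _ _; have [] := HF n.
have H0 A : measurable A -> (\int[mu]_(x in A) (g x)%:E = 0)%E.
  move=> /mG mA; suff [] : H A by [].
  apply: (@lambda_system_subset _ G GI setT H) mA => //.
  - exact/dynkin_lambda_system.
  - by move=> B GB; split; [exact: Gm|exact: G0].
pose P := [set x | 0 <= g x].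
have mP : measurable P.
  have := (iffLR (measurable_EFinP _ _) mg) measurableT _ (measurable_itv `[0, +oo[).
  by rewrite setTI set_itvcy.
suff : (\int[mu]_x `|(g x)%:E| = 0)%E.
  move=> /(ae_eq_integral_abs mu measurableT mg).
  by apply: filterS => x /(_ Logic.I)[].
rewrite -(setUv P) ge0_integral_setU//; last 3 first.
- exact: measurableC.
- by rewrite setUv; exact: measurableT_comp.
- by rewrite disj_set2E setICr.
rewrite (_ : (\int[mu]_(x in P) _ = 0)%E); last first.
  rewrite -[RHS](H0 _ mP); apply: eq_integral => x; rewrite inE /P /= => gx.
  by rewrite ger0_norm.
rewrite add0e (_ : (\int[mu]_(x in _) _ = \int[mu]_(x in ~` P) - (g x)%:E)%E).
  have mP' := measurableC mP.
  rewrite integralN ?H0 ?oppe0//; apply: integrable_add_def => //.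
  exact: integrableS ig.
apply: eq_integral => x; rewrite inE /P /= => /negP; rewrite -ltNge => gx.
by rewrite ltr0_norm.
Qed.

Section rational_boxes.
Variable R : realType.

Definition rat3 (q : rat * rat * rat) : R3 R := (ratr q.1.1, ratr q.1.2, ratr q.2).

(* [None] stands for the whole space, which makes the family stable under
   intersection and exhausting. *)
Definition rbox (t : option ((rat * rat * rat) * (rat * rat * rat))) : set (R3 R) :=
  if t is Some (a, b) then box (rat3 a) (rat3 b) else setT.

Lemma ratr_max (a b : rat) : ratr (Num.max a b) = Num.max (ratr a) (ratr b) :> R.
Proof.
by case: (leP a b) => ab; [rewrite max_r ?ler_rat|rewrite max_l ?ler_rat// ltW].
Qed.
Lemma ratr_min (a b : rat) : ratr (Num.min a b) = Num.min (ratr a) (ratr b) :> R.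
Proof.
by case: (leP a b) => ab; [rewrite min_l ?ler_rat|rewrite min_r ?ler_rat// ltW].
Qed.

Definition max3 (a b : R3 R) : R3 R :=
  (Num.max a.1.1 b.1.1, Num.max a.1.2 b.1.2, Num.max a.2 b.2).
Definition min3 (a b : R3 R) : R3 R :=
  (Num.min a.1.1 b.1.1, Num.min a.1.2 b.1.2, Num.min a.2 b.2).

Lemma box_setI a b c e : box a b `&` box c e = box (max3 a c) (min3 b e).
Proof.
apply/seteqP; rewrite /box /=; split=> x /=; rewrite !gt_max !lt_min.
  by move=> [[/andP[-> ->] /andP[-> ->] /andP[-> ->]] [/andP[-> ->] /andP[-> ->] /andP[-> ->]]].
by move=> [/andP[/andP[-> ->] /andP[-> ->]] /andP[/andP[-> ->] /andP[-> ->]]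
    /andP[/andP[-> ->] /andP[-> ->]]].
Qed.

Lemma rbox_setI : setI_closed (range rbox).
Proof.
move=> _ _ [s _ <-] [t _ <-].
case: s => [[a b]|]; last by rewrite setTI; exists t.
case: t => [[c e]|]; last by rewrite setIT; exists (Some (a, b)).
exists (Some ((Num.max a.1.1 c.1.1, Num.max a.1.2 c.1.2, Num.max a.2 c.2),
  (Num.min b.1.1 e.1.1, Num.min b.1.2 e.1.2, Num.min b.2 e.2))) => //.
by rewrite /= box_setI /rat3 /= !ratr_max !ratr_min.
Qed.

Lemma measurable_box (a b : R3 R) : measurable (box a b).
Proof.
have -> : box a b = (`]a.1.1, b.1.1[%classic `*` `]a.1.2, b.1.2[%classic) `*`
    `]a.2, b.2[%classic.
  apply/seteqP; split=> [[[x1 x2] x3] [h1 h2 h3]|[[x1 x2] x3] [[h1 h2] h3]].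
    by do ! split; rewrite /= in_itv.
  by split; [move: h1|move: h2|move: h3]; rewrite /= in_itv.
by do 2! [apply: measurableX => //]; exact: measurable_itv.
Qed.

Lemma measurable_rbox t : measurable (rbox t).
Proof. by case: t => [[a b]|] //=; exact: measurable_box. Qed.

(** The closed box has to stay in U because it contains the closed supports of the bumps. *)
Lemma open_rbox (U : set (R3 R)) (x : R3 R) : open U -> U x ->
  exists a b, box (rat3 a) (rat3 b) x /\ cbox (rat3 a) (rat3 b) `<=` U.
Proof.
move=> oU Ux; have /nbhs_ballP[r /= r0 xrU] : nbhs x U by exact: open_nbhs_nbhs.
have near_rat (y : R) : exists p q : rat, y - r < ratr p < y /\ y < ratr q < y + r.
  have yr : y - r < y by rewrite ltrBlDr ltrDl.
  have yr' : y < y + r by rewrite ltrDl.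
  have [p hp] := rat_in_itvoo yr; have [q hq] := rat_in_itvoo yr'.
  by exists p, q; move: hp hq; rewrite !in_itv.
case: x Ux xrU => [[x1 x2] x3] Ux xrU.
have [a1 [b1 [/andP[h1 h2] /andP[h3 h4]]]] := near_rat x1.
have [a2 [b2 [/andP[h5 h6] /andP[h7 h8]]]] := near_rat x2.
have [a3 [b3 [/andP[h9 h10] /andP[h11 h12]]]] := near_rat x3.
exists (a1, a2, a3), (b1, b2, b3); split.
  by rewrite /box /=; split; apply/andP; split.
move=> [[y1 y2] y3]; rewrite /cbox /= => -[/andP[g1 g2] /andP[g3 g4] /andP[g5 g6]].
have D (x y p q : R) : x - r < p -> q < x + r -> p <= y -> y <= q -> `|x - y| < r.
  by move=> *; rewrite ltr_distl; apply/andP; split; lra.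
by apply: xrU; split; [split|]; [exact: (D _ _ _ _ h1 h4)|exact: (D _ _ _ _ h5 h8)|
  exact: (D _ _ _ _ h9 h12)].
Qed.

Lemma sigma_rbox_open (U : set (R3 R)) : open U -> <<s range rbox >> U.
Proof.
move=> oU.
have -> : U = \bigcup_t (if `[< rbox t `<=` U >] then rbox t else set0).
  apply/seteqP; split=> [x Ux|x [t _]]; last by case: asboolP => // tU /tU.
  have [a [b [abx abU]]] := open_rbox oU Ux.
  exists (Some (a, b)) => //; case: asboolP => // -[].
  exact: subset_trans (@box_cbox _ _ _) abU.
apply: (@countable_bigcupT_measurable _ (g_sigma_algebraType (range rbox))) => //.
move=> t; case: asboolP => _; last exact: measurable0.
by apply: sub_sigma_algebra; exists t.
Qed.

(** The coordinates are continuous, hence measurable for the sigma-algebra generated by the boxes;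
    so is the identity, into the product sigma-algebra. *)
Lemma measurable_sigma_rbox (A : set (R3 R)) : measurable A -> <<s range rbox >> A.
Proof.
move=> mA.
pose S := g_sigma_algebraType (range rbox).
have key (f : R3 R -> R) : continuous f -> measurable_fun setT (f : S -> R).
  move=> cf; apply: (measurability _ (RGenOInfty.measurableE R)) => // _ [_ [a ->] <-].
  rewrite setTI; apply: sigma_rbox_open; apply: open_comp; first by move=> x _; exact: cf.
  exact: interval_open.
have c1 : continuous (fun y : R3 R => y.1.1).
  by move=> x; apply: (@cvg_comp _ _ _ fst fst _ (nbhs x.1)); exact: cvg_fst.
have c2 : continuous (fun y : R3 R => y.1.2).
  move=> x; apply: (@cvg_comp _ _ _ fst snd _ (nbhs x.1)); [exact: cvg_fst|exact: cvg_snd].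
have c3 : continuous (fun y : R3 R => y.2) by move=> x; exact: cvg_snd.
have mid : measurable_fun setT (fun x : S => ((x.1.1, x.1.2), x.2) : R3 R).
  apply: measurable_fun_pair; last exact: key.
  by apply: measurable_fun_pair; exact: key.
have := mid measurableT A mA; rewrite setTI.
by congr (<<s _ >> _); apply/funext => -[[x1 x2] x3].
Qed.

Lemma rbox_ae0 (mu : {measure set (R3 R) -> \bar R}) (g : R3 R -> R) :
  mu.-integrable setT (EFin \o g) ->
  (forall t, (\int[mu]_(x in rbox t) (g x)%:E = 0)%E) ->
  {ae mu, forall x, g x = 0}.
Proof.
move=> ig g0; apply: (integral_pi_system_ae0 ig rbox_setI).
- by move=> _ [t _ <-]; exact: measurable_rbox.
- exact: measurable_sigma_rbox.
- by exists None.
- by move=> _ [t _ <-].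
Qed.

End rational_boxes.

(** * The fundamental lemma of the calculus of variations *)

Section domain.
Variables (R : realType) (Omega : bounded_domain R).
Local Notation mu := (lebO Omega).

Lemma lebO_finite : (mu setT < +oo)%E.
Proof.
have [M MO] : exists M, forall x : R3 R, dom Omega x -> `|x| <= M.
  have := dom_bounded Omega => -[M [_ /(_ (M + 1))]].
  by rewrite ltrDl ltr01 => /(_ erefl) h; exists (M + 1).
have mI : measurable (`[- M, M]%classic : set (measurableTypeR R)) by exact: measurable_itv.
pose Q : set (R3 R) := (`[- M, M]%classic `*` `[- M, M]%classic) `*` `[- M, M]%classic.
have mQ : measurable Q by do 2! [apply: measurableX => //].
have OQ : Omega `<=` Q.
  move=> x /MO; case: x => [[x1 x2] x3]; rewrite /Q /=.
  rewrite /Num.norm /= !ge_max => /andP[/andP[h1 h2] h3].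
  by do ! split; rewrite /= in_itv /= -ler_norml.
rewrite /lebO /= /mrestr setTI.
apply: (@le_lt_trans _ _ (leb3 Q)).
  by apply: le_measure => //; rewrite inE//; exact: open_measurable3 (dom_open Omega).
pose I : set (measurableTypeR R) := `[- M, M]%classic.
have I2 : ((@lebesgue_measure R \x @lebesgue_measure R) (I `*` I) =
    lebesgue_measure I * lebesgue_measure I)%E by exact: product_measure1E.
have -> : leb3 Q = ((@lebesgue_measure R \x @lebesgue_measure R) (I `*` I) *
    lebesgue_measure I)%E.
  by apply: product_measure1E => //; exact: measurableX.
rewrite I2 /I /= lebesgue_measure_itv.
by case: ifP => _; rewrite ?mule0 ?mul0e// -?EFinB -?EFinM ltry.
Qed.

Lemma lebO_ae_dom : {ae mu, forall x, dom Omega x}.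
Proof.
have mO := open_measurable3 (dom_open Omega).
exists (~` (Omega : set (R3 R))); split => //; first exact: measurableC.
by rewrite /lebO /= /mrestr setICl measure0.
Qed.

Lemma continuous_measurable3 (f : R3 R -> R) : continuous f -> measurable_fun setT f.
Proof.
move=> cf; apply: (measurability _ (RGenOInfty.measurableE R)) => // _ [_ [a ->] <-].
rewrite setTI; apply: open_measurable3; apply: open_comp; first by move=> x _; exact: cf.
exact: interval_open.
Qed.

Lemma bounded_Lfun2 (f : R3 R -> R) (M : R) : measurable_fun setT f ->
  (forall x, `|f x| <= M) -> f \in Lfun mu 2%:E.
Proof.
move=> mf fM; apply: Lfun2_sqr_integral => //.
apply: (@le_lt_trans _ _ (\int[mu]_x (cst (M ^+ 2)%:E x))%E).
  apply: ge0_le_integral => //.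
  - by move=> x _; rewrite lee_fin sqr_ge0.
  - by apply/measurable_EFinP/measurable_funX.
  - move=> x _; rewrite lee_fin -[f x ^+ 2]real_normK ?num_real//.
    by rewrite lerXn2r// nnegrE ?(le_trans _ (fM x)).
rewrite integral_cst// lte_mul_pinfty//; first by rewrite lee_fin sqr_ge0.
exact: lebO_finite.
Qed.

Lemma compactly_supported_Lfun2 (f : R3 R -> R) (K : set (R3 R)) :
  continuous f -> compact K -> (forall x, f x != 0 -> K x) ->
  f \in Lfun mu 2%:E.
Proof.
move=> cf cK fK.
have /compact_bounded[M [_ /(_ (`|M| + 1))]] : compact (f @` K).
  by apply: continuous_compact => //; exact: continuous_subspaceT.
rewrite (le_lt_trans (ler_norm M)) ?ltrDl// => /(_ erefl) h.
apply: (@bounded_Lfun2 _ (`|M| + 1)); first exact: continuous_measurable3.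
move=> x; have [->|/fK Kx] := eqVneq (f x) 0; first by rewrite normr0 addr_ge0.
by apply: h; exists x.
Qed.

Lemma test_Lfun2 phi : test_function Omega phi -> phi \in Lfun mu 2%:E.
Proof.
move=> [sphi cphi _]; apply: (compactly_supported_Lfun2 _ cphi).
  exact: (sphi [::]).1.
by move=> x h; exact: subset_closure.
Qed.

(** Off the closed support, phi is locally 0 and so is its derivative, which is therefore also
    compactly supported. *)
Lemma pderiv_test_Lfun2 j phi : test_function Omega phi -> pderiv j phi \in Lfun mu 2%:E.
Proof.
move=> [sphi cphi _]; apply: (compactly_supported_Lfun2 _ cphi).
  exact: (sphi [:: j]).1.
move=> x; apply: contraPP => xK; apply/negP/negPn/eqP.
have d0 : 'D_(e3 R j) (cst (0:R) : R3 R -> R) x = 0 by exact: derive_cst.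
rewrite /pderiv -[RHS]d0.
apply: near_eq_derive.
have /open_nbhs_nbhs : open_nbhs x (~` closure [set x | phi x != 0]).
  by split => //; apply: closed_openC; exact: closed_closure.
apply: filterS => y /(contra_not (@subset_closure _ _ y)) /negP.
by rewrite negbK => /eqP.
Qed.

(** By dominated convergence along the bumps, g has integral 0 over every box whose closure lies in
    Omega. Other boxes are out of reach, so g is first multiplied by the indicator of one such box
    Q: the integral over any rational box is then that of g over a smaller box in Q. Countably many
    boxes Q cover Omega. *)
Lemma fundamental_lemma (g : R3 R -> R) : mu.-integrable setT (EFin \o g) ->
  (forall phi, test_function Omega phi -> \int[mu]_x (g x * phi x) = 0) ->
  {ae mu, forall x, g x = 0}.
Proof.
move=> ig gphi.
have mg : measurable_fun setT g by case/integrableP : ig => /measurable_EFinP.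
have gbox a b : cbox a b `<=` Omega -> (\int[mu]_x (g x * \1_(box a b) x)%:E = 0)%E.
  move=> abO.
  have triv : box a b = set0 -> (\int[mu]_x (g x * \1_(box a b) x)%:E = 0)%E.
    move=> ->; apply: integral0_eq => x _; by rewrite indic0 mulr0.
  have [h1|h1] := ltP a.1.1 b.1.1; last first.
    by apply: triv; apply/seteqP; split=> // x [/andP[? ?] _ _]; lra.
  have [h2|h2] := ltP a.1.2 b.1.2; last first.
    by apply: triv; apply/seteqP; split=> // x [_ /andP[? ?] _]; lra.
  have [h3|h3] := ltP a.2 b.2; last first.
    by apply: triv; apply/seteqP; split=> // x [_ _ /andP[? ?]]; lra.
  have tb n := box_bump_test n h1 h2 h3 abO.
  have mb n : measurable_fun setT (box_bump a b n).
    by have [sb _ _] := tb n; apply: continuous_measurable3; exact: (sb [::]).1.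
  have dom n x : (`|(g x * box_bump a b n x)%:E| <= `|(g x)%:E|)%E.
    rewrite lee_fin normrM [`|box_bump _ _ _ _|]ger0_norm ?box_bump_ge0//.
    by rewrite ler_piMr// box_bump_le1.
  have mgb n : measurable_fun setT (fun x => (g x * box_bump a b n x)%:E).
    by apply/measurable_EFinP; exact: measurable_funM.
  have igb n : mu.-integrable setT (fun x => (g x * box_bump a b n x)%:E).
    by apply: le_integrable ig => // x _; exact: dom.
  have z n : (\int[mu]_x (g x * box_bump a b n x)%:E = 0)%E.
    have := gphi _ (tb n); rewrite /Rintegral => /eqP.
    by rewrite fine_eq0 ?integrable_fin_num// => /eqP.
  have mgi : measurable_fun setT (fun x => (g x * \1_(box a b) x)%:E).
    apply/measurable_EFinP; apply: measurable_funM => //.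
    exact: measurable_indic (measurable_box a b).
  have cvb : {ae mu, forall x, setT x ->
      (g x * box_bump a b n x)%:E @[n --> \oo] --> (g x * \1_(box a b) x)%:E}.
    apply/aeW => x _; apply: cvgn_EFin; apply: cvgM; first exact: cvg_cst.
    exact: box_bump_cvg.
  have db : {ae mu, forall x n, setT x ->
      (`|(g x * box_bump a b n x)%:E| <= `|(g x)%:E|)%E}.
    by apply/aeW => x n _; exact: dom.
  have [_ _] := dominated_convergence measurableT mgb mgi cvb (integrable_abse ig) db.
  rewrite (_ : [sequence _]_n = cst 0%E); last by apply/funext => n /=; exact: z.
  by move=> h; apply/esym/(cvg_unique _ (cvg_cst _) h).
have gab (a b : rat * rat * rat) : cbox (rat3 R a) (rat3 R b) `<=` Omega ->
    {ae mu, forall x, g x * \1_(box (rat3 R a) (rat3 R b)) x = 0}.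
  move=> abO; apply: rbox_ae0.
    apply: le_integrable ig => //.
      apply/measurable_EFinP; apply: measurable_funM => //.
      exact: measurable_indic (measurable_box _ _).
    move=> x _; rewrite lee_fin normrM ler_piMr//.
    by rewrite ger0_norm// indicE lern1 leq_b1.
  move=> t; rewrite integral_mkcond.
  case: t => [[c e]|] /=; last by rewrite patch_setT; exact: gbox.
  rewrite -[RHS](gbox (max3 (rat3 R a) (rat3 R c)) (min3 (rat3 R b) (rat3 R e))).
    apply: eq_integral => x _; rewrite -box_setI patchE indicI /=.
    by rewrite [\1_(box (rat3 R c) _) x]indicE; case: ifP => _; rewrite !(mulr1, mulr0).
  move=> x; rewrite /cbox /= !ge_max !le_min.
  move=> [/andP[/andP[h1 _] /andP[h2 _]] /andP[/andP[h3 _] /andP[h4 _]]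
    /andP[/andP[h5 _] /andP[h6 _]]].
  by apply: abO; split; apply/andP; split.
(* Enumerating the pairs of rational corners merges the exceptional sets into a single null set. *)
have all_ab : {ae mu, forall x, forall n : nat,
    if unpickle n is Some (a, b) then
      cbox (rat3 R a) (rat3 R b) `<=` Omega -> g x * \1_(box (rat3 R a) (rat3 R b)) x = 0
    else True}.
  apply: ae_foralln => n; case: (unpickle n) => [[a b]|]; last exact/aeW.
  have [abO|abO] := pselect (cbox (rat3 R a) (rat3 R b) `<=` Omega).
    by apply: filterS (gab a b abO).
  by apply/aeW => x.
have := lebO_ae_dom; move: all_ab; apply: filterS2 => x xab Ox.
have [a [b [abx abO]]] := open_rbox (dom_open Omega) Ox.
have := xab (pickle (a, b)); rewrite pickleK => /(_ abO).
by rewrite indicE mem_set// mulr1.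
Qed.

End domain.

(** * Weak gradients *)

Section component.
Context d (T : measurableType d) (R : realType).
Variables (mu : {measure set T -> \bar R}) (I : finType).
Notation Lf := (LfunType mu (le1_2E R)).

(** Turns the integrals of [weak_gradient] into inner products, which are continuous in u and G. *)
Definition component (i : I) (psi : Lf) : L2 mu I :=
  \pi_(L2 mu I) [ffun k => if k == i then psi else 0].

Lemma ip_component (u : L2 mu I) i (psi : Lf) :
  ip u (component i psi) = \int[mu]_x (repr u i x * psi x).
Proof.
rewrite -[u in LHS]reprK ip_pi /L2ip (bigD1 i)//= big1 ?addr0; last first.
  move=> k ki; rewrite ffunE (negbTE ki).
  rewrite -[RHS](Rintegral_set0 mu (fun=> 0)) /Rintegral; congr fine.
  rewrite integral_set0; apply: integral0_eq => x _; rewrite /=.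
  by rewrite mulr0.
by rewrite ffunE eqxx.
Qed.

End component.

Section weak_gradients.
Variables (R : realType) (Omega : bounded_domain R).
Local Notation mu := (lebO Omega).
Local Notation L2v := (L2 mu 'I_3).
Local Notation L2m := (L2 mu ('I_3 * 'I_3)%type).
Notation Lf := (LfunType mu (le1_2E R)).
Implicit Types (u v : L2v) (G K : L2m).

Lemma weak_gradientP u G : weak_gradient u G <->
  forall i j phi (tphi : test_function Omega phi),
    ip u (component i (Lfun_Sub (le1_2E R) (pderiv_test_Lfun2 j tphi))) =
    - ip G (component (i, j) (Lfun_Sub (le1_2E R) (test_Lfun2 tphi))).
Proof.
have vE f (hf : f \in Lfun mu 2%:E) x : Lfun_Sub (le1_2E R) hf x = f x.
  by rewrite (Lfun_valP (le1_2E R) hf).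
split=> wG i j phi tphi; have := wG i j phi tphi; rewrite !ip_component.
  move=> E; transitivity (\int[mu]_x (repr u i x * pderiv j phi x)).
    by apply: eq_Rintegral => x _; rewrite vE.
  by rewrite E; congr (- _); apply: eq_Rintegral => x _; rewrite vE.
move=> E; transitivity (\int[mu]_x (repr u i x * Lfun_Sub (le1_2E R) (pderiv_test_Lfun2 j tphi) x)).
  by apply: eq_Rintegral => x _; rewrite vE.
by rewrite E; congr (- _); apply: eq_Rintegral => x _; rewrite vE.
Qed.

Lemma weak_gradient_lin a u v G K : weak_gradient u G -> weak_gradient v K ->
  weak_gradient (a *: u + v) (a *: G + K).
Proof.
move=> /weak_gradientP uG /weak_gradientP vK; apply/weak_gradientP => i j phi tphi.
by rewrite !ip_linl uG vK; ring.
Qed.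

(** For each test function the defining identity is a continuous linear condition on the pair (u,
    G). *)
Lemma weak_gradient_closed u G :
  (forall e : R, 0 < e -> exists v K,
     [/\ weak_gradient v K, `|u - v| <= e & `|G - K| <= e]) ->
  weak_gradient u G.
Proof.
move=> lim; apply/weak_gradientP => i j phi tphi.
set p := component _ _; set q := component _ _.
apply/eqP; rewrite -addr_eq0 -normr_le0; apply/ler_addgt0Pl => e e0.
rewrite addr0.
have c0 : 0 < `|p| + `|q| + 1 by rewrite ltr_wpDl ?addr_ge0.
have [v [K [/weak_gradientP vK uv GK]]] := lim _ (divr_gt0 e0 c0).
have E : ip u p + ip G q = ip (u - v) p + ip (G - K) q.
  by rewrite !ipDl !ipNl (vK i j phi tphi); ring.
rewrite E (le_trans (ler_normD _ _))//.
rewrite (le_trans (lerD (ip_le _ _) (ip_le _ _)))//.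
apply: (@le_trans _ _ (e / (`|p| + `|q| + 1) * (`|p| + `|q|))).
  by rewrite mulrDr lerD// ler_wpM2r.
rewrite mulrAC ler_pdivrMr// ler_wpM2l// ?lerDl//; exact: ltW.
Qed.

Lemma weak_gradient_unique u G K : weak_gradient u G -> weak_gradient u K -> G = K.
Proof.
move=> uG uK.
apply/eqP; rewrite -[G]reprK -[K]reprK L2_piE.
apply/asboolP => -[i j].
have E : {ae mu, forall x, repr G (i, j) x - repr K (i, j) x = 0}.
  have iGK : mu.-integrable setT (EFin \o (fun x => repr G (i, j) x - repr K (i, j) x)).
    (* Omega has finite measure, so square-integrable functions are integrable. *)
    have fm : mu setT \is a fin_num by rewrite ge0_fin_numE// lebO_finite.
    apply/Lfun1_integrable/(Lfun_subset12 fm).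
    exact: (LfunP (repr G (i, j) - repr K (i, j))).
  apply: (fundamental_lemma iGK) => phi tphi.
  have tL := test_Lfun2 tphi.
  have iM (f : Lf) : mu.-integrable setT (EFin \o (fun x => f x * phi x)).
    exact/Lfun1_integrable/Lfun2_mul_Lfun1/tL/LfunP.
  under eq_Rintegral do rewrite mulrBl.
  rewrite RintegralB//; apply/eqP; rewrite subr_eq0 -eqr_opp; apply/eqP.
  by rewrite -uG// -uK.
by apply: filterS E => x E; rewrite !ffunE.
Qed.

Lemma gradE u G : weak_gradient u G -> grad u = G.
Proof.
by move=> uG; rewrite /grad; case: xgetP => [K _ uK|/(_ G)//]; exact: weak_gradient_unique uG.
Qed.

Lemma grad_weak u : H1 u -> weak_gradient u (grad u).
Proof. by move=> [G uG]; rewrite (gradE uG). Qed.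

Lemma H1_lin a u v : H1 u -> H1 v -> H1 (a *: u + v).
Proof. by move=> [G uG] [K vK]; exists (a *: G + K); exact: weak_gradient_lin. Qed.

Lemma grad_lin a u v : H1 u -> H1 v -> grad (a *: u + v) = a *: grad u + grad v.
Proof. by move=> /grad_weak u1 /grad_weak v1; exact/gradE/weak_gradient_lin. Qed.

Lemma gradB u v : H1 u -> H1 v -> grad (u - v) = grad u - grad v.
Proof.
move=> Hu Hv; rewrite addrC -scaleN1r grad_lin//.
by rewrite scaleN1r addrC.
Qed.

Lemma H1B u v : H1 u -> H1 v -> H1 (u - v).
Proof. by move=> Hu Hv; rewrite addrC -scaleN1r; exact: H1_lin. Qed.

Lemma H1norm_le u e : 0 <= e -> H1norm u <= e -> `|u| <= e /\ `|grad u| <= e.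
Proof.
move=> e0; rewrite /H1norm => h.
have h2 : `|u| ^+ 2 + `|grad u| ^+ 2 <= e ^+ 2.
  rewrite -(sqr_sqrtr (_ : 0 <= `|u| ^+ 2 + `|grad u| ^+ 2)) ?addr_ge0 ?sqr_ge0//.
  by rewrite lerXn2r// nnegrE sqrtr_ge0.
have g2 := sqr_ge0 `|u|; have g3 := sqr_ge0 `|grad u|.
by split; rewrite -ler_sqr ?nnegrE//; lra.
Qed.

Lemma H1norm_lt u e : 0 < e -> `|u| <= e / 2 -> `|grad u| <= e / 2 -> H1norm u < e.
Proof.
move=> e0 h1 h2; rewrite /H1norm -[ltRHS]ger0_norm ?ltW// -sqrtr_sqr.
rewrite ltr_sqrt ?exprn_gt0//.
have g0 : 0 <= e / 2 by rewrite divr_ge0// ltW.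
have h3 : `|u| ^+ 2 <= (e / 2) ^+ 2 by rewrite lerXn2r ?nnegrE.
have h4 : `|grad u| ^+ 2 <= (e / 2) ^+ 2 by rewrite lerXn2r ?nnegrE.
have : 0 < e ^+ 2 by rewrite exprn_gt0.
nra.
Qed.

(** The graph of the weak gradient is closed, so u has the gradient G. An approximation in A of a
    nearby v then approximates u, with two errors of e/4. *)
Lemma H1closure_closed (A : set L2v) u G :
  (forall e : R, 0 < e -> exists v,
     [/\ H1closure A v, `|u - v| <= e & `|G - grad v| <= e]) ->
  H1closure A u /\ grad u = G.
Proof.
move=> lim.
have uG : weak_gradient u G.
  apply: weak_gradient_closed => e /lim[v [[Hv _] uv Gv]].
  by exists v, (grad v); split=> //; exact: grad_weak.
have Hu : H1 u by exists G.
have gu := gradE uG; split=> //; split=> // e e0.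
have e4 : 0 < e / 4 by rewrite divr_gt0.
have e42 : e / 4 + e / 4 = e / 2 by field.
have [v [[Hv vA] uv Gv]] := lim _ e4.
have [w [Aw Hw]] := vA _ e4.
move=> /ltW/(H1norm_le (ltW e4))[vw gvw].
exists w; split=> //; apply: H1norm_lt => //.
  rewrite -(subrKA v); apply: le_trans (ler_normD _ _) _; rewrite -e42.
  exact: (lerD uv vw).
rewrite (gradB Hu Hw) gu -(subrKA (grad v)); apply: le_trans (ler_normD _ _) _.
rewrite (gradB Hv Hw) in gvw.
by rewrite -e42; exact: (lerD Gv gvw).
Qed.

Lemma H1closure_lin (A : set L2v) a u v :
  (forall b w w', A w -> A w' -> A (b *: w + w')) ->
  H1closure A u -> H1closure A v -> H1closure A (a *: u + v).
Proof.
move=> Alin [Hu uA] [Hv vA]; split; first exact: H1_lin.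
move=> e e0.
have c0 : 0 < `|a| + 1 by rewrite ltr_wpDl.
have e4 : 0 < e / 4 by rewrite divr_gt0.
have ec : 0 < e / 4 / (`|a| + 1) by rewrite divr_gt0.
have [u' [Au' Hu']] := uA _ ec; move=> /ltW/(H1norm_le (ltW ec))[uu guu].
have [v' [Av' Hv']] := vA _ e4; move=> /ltW/(H1norm_le (ltW e4))[vv gvv].
exists (a *: u' + v'); split; [exact: Alin|exact: H1_lin|].
have bound (E : normedModType R) (x y : E) : `|x| <= e / 4 / (`|a| + 1) ->
    `|y| <= e / 4 -> `|a *: x + y| <= e / 2.
  move=> hx hy; rewrite (le_trans (ler_normD _ _))// normrZ.
  have : `|a| * `|x| <= e / 4.
    rewrite (le_trans (ler_wpM2l (normr_ge0 a) hx))//.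
    by rewrite mulrA ler_pdivrMr// mulrC ler_wpM2l ?lerDl// ltW.
  move=> h; have -> : e / 2 = e / 4 + e / 4 by field.
  exact: (lerD h hy).
rewrite opprD addrACA -scalerBr.
apply: H1norm_lt => //; first exact: bound.
rewrite (grad_lin _ (H1B Hu Hu') (H1B Hv Hv')).
exact: bound.
Qed.

Lemma Ccinfty_lin a u v : @Ccinfty R Omega u -> @Ccinfty R Omega v -> @Ccinfty R Omega (a *: u + v).
Proof.
move=> [phi [tphi uphi]] [psi [tpsi vpsi]].
exists (fun i => a \*: phi i + psi i); split=> [i|].
  exact: test_function_lin.
exact: represents_lin.
Qed.

End weak_gradients.

Section V.
Variables (R : realType) (Omega : bounded_domain R).
Local Notation Hs := (Hspace Omega).
Implicit Types u v : Hs.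

Lemma Vspace_H1 u : Vspace u -> H1 (Hval u).
Proof. by move=> [[]]. Qed.

Lemma Hval_lin a u v : Hval (a *: u + v) = a *: Hval u + Hval v.
Proof. by []. Qed.

Lemma Vspace_lin a u v : Vspace u -> Vspace v -> Vspace (a *: u + v).
Proof.
have [_ Vlin] := Ccinfty_div0_submod Omega.
move=> [u1 u2] [v1 v2]; rewrite /Vspace /mkset Hval_lin; split.
  exact: (H1closure_lin (A := @Ccinfty R Omega) a (@Ccinfty_lin _ _) u1 v1).
exact: (H1closure_lin (A := @Ccinfty_div0 R Omega) a Vlin u2 v2).
Qed.

Lemma Vspace_closed u (G : L2 (lebO Omega) ('I_3 * 'I_3)%type) :
  (forall e : R, 0 < e -> exists v : Hs,
     [/\ Vspace v, `|u - v| <= e & `|G - grad (Hval v)| <= e]) ->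
  Vspace u /\ grad (Hval u) = G.
Proof.
move=> lim.
have [h1 h2] : H10 (Hval u) /\ grad (Hval u) = G.
  apply: H1closure_closed => e /lim[v [[v1 v2] uv Gv]]; by exists (Hval v).
have [h3 _] : H1closure (@Ccinfty_div0 R Omega) (Hval u) /\ grad (Hval u) = G.
  apply: H1closure_closed => e /lim[v [[v1 v2] uv Gv]]; by exists (Hval v).
by [].
Qed.

End V.

(** * Closed convex sets of V-bounded vector fields *)

(** The infima of the decreasing sets [S n] increase to d; [M k] is a rank from which they are
    within [eps k] of d. *)
Lemma minimizing_choice (R : realType) (S : nat -> set R) (eps : nat -> R) (C : R) :
  (forall n, S n !=set0) -> (forall m n, (m <= n)%N -> S n `<=` S m) ->
  (forall n x, S n x -> 0 <= x <= C) -> (forall k, 0 < eps k) ->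
  exists (d : R) (M : nat -> nat), [/\ forall k l, (k <= l)%N -> (M k <= M l)%N,
    forall k, (k <= M k)%N,
    forall k, exists2 x, S (M k) x & x <= d + eps k &
    forall k x, S (M k) x -> d - eps k <= x].
Proof.
move=> S0 Sm SC eps0.
have lbS n : has_lbound (S n) by exists 0 => x /SC /andP[].
have iS n : has_inf (S n) by split.
pose D := [set inf (S n) | n in setT].
have supD : has_sup D.
  split; first by exists (inf (S 0%N)); exists 0%N.
  exists C => _ [n _ <-]; have [x Sx] := S0 n.
  by apply: le_trans (ge_inf (lbS n) Sx) _; have /andP[] := SC _ _ Sx.
have /choice[N NP] : forall k, exists N, sup D - eps k <= inf (S N).
  move=> k; have [_ [N _ <-] h] := sup_adherent (eps0 k) supD.
  by exists N; exact: ltW.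
(* Summing the ranks makes M monotone and at least [N k]; the term k makes it at least k. *)
pose M k := (k + \sum_(j < k.+1) N j)%N.
have NM k : (N k <= M k)%N by rewrite /M big_ord_recr /= addnA leq_addl.
exists (sup D), M; split.
- move=> k l kl; rewrite /M leq_add//.
  rewrite -(subnKC kl) -addSn big_split_ord /= leq_addr//.
- by move=> k; rewrite leq_addr.
- move=> k; have [x Sx hx] := inf_adherent (eps0 k) (iS (M k)).
  exists x => //; apply: le_trans (ltW hx) _; rewrite lerD2r.
  by apply: ub_le_sup; [case: supD|exists (M k)].
- move=> k x Sx; apply: le_trans (NP k) _; apply: ge_inf => //.
  exact: Sm (NM k) _ Sx.
Qed.

(* Near-minimizers of [`|g v|] among the elements v of A close to u have Cauchy
   images, by the parallelogram identity; only midpoints are needed instead of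
   the convex combinations of Mazur's lemma. *)
Lemma mazur (R : realType) d (T : measurableType d) (mu : {measure set T -> \bar R})
    (I : finType) (E : normedModType R) (g : E -> L2 mu I) (A : set E) (C : R) (u : E) :
  (forall v w, A v -> A w -> A (2^-1 *: v + 2^-1 *: w)) ->
  (forall v w, A v -> A w ->
     g (2^-1 *: v + 2^-1 *: w) = 2^-1 *: g v + 2^-1 *: g w) ->
  (forall v, A v -> `|g v| <= C) -> closure A u ->
  exists G, forall e : R, 0 < e -> exists w, [/\ A w, `|u - w| <= e & `|G - g w| <= e].
Proof.
move=> Amid gmid AC uA.
pose K n := [set v | A v /\ `|u - v| <= n.+1%:R^-1].
have K0 n : K n !=set0.
  have n0 : 0 < n.+1%:R^-1 :> R by rewrite invr_gt0.
  have [v [Av uv]] := uA _ (nbhsx_ballx u _ n0).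
  by exists v; split => //; move: uv; rewrite -ball_normE /= => /ltW.
have Km m n : (m <= n)%N -> K n `<=` K m.
  move=> mn v [Av uv]; split => //; apply: le_trans uv _.
  by rewrite lef_pV2 ?posrE ?ltr0n// ler_nat.
have Kmid n v w : K n v -> K n w -> K n (2^-1 *: v + 2^-1 *: w).
  move=> [Av uv] [Aw uw]; split; first exact: Amid.
  rewrite (_ : u - _ = 2^-1 *: (u - v) + 2^-1 *: (u - w)); last first.
    by rewrite !scalerBr addrACA -scalerDl -opprD (_ : 2^-1 + 2^-1 = 1) ?scale1r//; field.
  apply: le_trans (ler_normD _ _) _; rewrite !normrZ ger0_norm ?invr_ge0//.
  by rewrite -mulrDr ler_pdivrMl// mulr_natl mulr2n; exact: (lerD uv uw).
pose S n : set R := [set `|g v| ^+ 2 | v in K n].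
(* If all errors are at most eps, the parallelogram identity gives 2 (d0 + eps) + 2 (d0 + eps) - 4
   (d0 - eps) = 8 eps. The choice eps = 8^-(k+1) yields the rate 8^-k required by [L2_complete]. *)
have [||||d0 [M [Mle kM Mex Mlb]]] := @minimizing_choice R S (fun k => 8^-1 ^+ k.+1) (C ^+ 2).
- by move=> n; have [v Kv] := K0 n; exists (`|g v| ^+ 2); exists v.
- by move=> m n mn _ [v Kv <-]; exists v => //; exact: Km mn _ Kv.
- move=> n _ [v [Av _] <-]; rewrite sqr_ge0 /=.
  by rewrite lerXn2r ?nnegrE ?(le_trans _ (AC _ Av)) ?normr_ge0 ?AC.
- by move=> k; rewrite exprn_gt0// invr_gt0.
have /choice[v vP] : forall k, exists v, K (M k) v /\ `|g v| ^+ 2 <= d0 + 8^-1 ^+ k.+1.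
  by move=> k; have [_ [v Kv <-] h] := Mex k; exists v.
have Cau n m : (n <= m)%N -> `|g (v n) - g (v m)| ^+ 2 <= 8^-1 ^+ n.
  move=> nm; rewrite parallelogram.
  have [Kn gn] := vP n; have [Km' gm] := vP m.
  have Kmn : K (M n) (v m) := Km _ _ (Mle _ _ nm) _ Km'.
  have mid : S (M n) (`|g (2^-1 *: v n + 2^-1 *: v m)| ^+ 2).
    by exists (2^-1 *: v n + 2^-1 *: v m) => //; exact: Kmid.
  move: (Mlb n _ mid); rewrite gmid; [|by case: Kn|by case: Kmn].
  have : 8^-1 ^+ m.+1 <= 8^-1 ^+ n.+1 :> R.
    by apply: ler_wiXn2l => //; rewrite ?invr_ge0// invf_le1// ler1n.
  rewrite [in 8^-1 ^+ n.+1]exprS in gn *.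
  lra.
have [G GP] := L2_complete Cau.
exists G => e e0.
have [k [hk1 hk2]] : exists k : nat, k.+1%:R^-1 <= e /\ #|I|%:R * 8^-1 ^+ k <= e ^+ 2.
  near \oo => k; exists k; split; near: k.
    have := near_infty_natSinv_lt (PosNum e0).
    by apply: filterS => k /ltW.
  have e2 : 0 < e ^+ 2 by rewrite exprn_gt0.
  have : geometric (#|I|%:R : R) 8^-1 k @[k --> \oo] --> 0.
    by apply: cvg_geometric; rewrite ger0_norm ?invf_lt1 ?ltr1n.
  move=> /cvgr0Pnorm_le /(_ _ e2); apply: filterS => k /=.
  by apply: le_trans; exact: ler_norm.
exists (v k); have [[Av uv] _] := vP k; split => //.
  apply: le_trans uv (le_trans _ hk1).
  by rewrite lef_pV2 ?posrE ?ltr0n// ler_nat ltnS kM.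
rewrite distrC -ler_sqr ?nnegrE ?(ltW e0)//.
by apply: le_trans (GP k) _; rewrite (le_trans _ hk2).
Unshelve. all: by end_near. Qed.

(** * Borel measurability of V, of the gradient norm and of ell *)

Section measurability.
Variables (R : realType) (Omega : bounded_domain R).
Local Notation Hs := (Hspace Omega).
Implicit Types u v w : Hs.

Definition Vgrad u := grad (Hval u).

Lemma VnormE u : Vnorm u = `|Vgrad u|. Proof. by []. Qed.

Lemma Vgrad_lin a u v : Vspace u -> Vspace v ->
  Vgrad (a *: u + v) = a *: Vgrad u + Vgrad v.
Proof. by move=> Vu Vv; exact: (grad_lin a (Vspace_H1 Vu) (Vspace_H1 Vv)). Qed.

Lemma VgradB u v : Vspace u -> Vspace v -> Vgrad (u - v) = Vgrad u - Vgrad v.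
Proof. by move=> Vu Vv; exact: (gradB (Vspace_H1 Vu) (Vspace_H1 Vv)). Qed.

Lemma VspaceB u v : Vspace u -> Vspace v -> Vspace (u - v).
Proof. by move=> Vu Vv; rewrite addrC -scaleN1r; exact: Vspace_lin. Qed.

Lemma midE (E : lmodType R) (x y : E) : 2^-1 *: x + 2^-1 *: y = 2^-1 *: (x - y) + y.
Proof.
rewrite scalerBr -addrA; congr (_ + _).
rewrite -[X in _ + X]scale1r -scaleNr -scalerDl; congr (_ *: _); by field.
Qed.

Lemma Vspace_mid u v : Vspace u -> Vspace v -> Vspace (2^-1 *: u + 2^-1 *: v).
Proof.
by move=> Vu Vv; rewrite midE; exact: (Vspace_lin _ (VspaceB Vu Vv) Vv).
Qed.

Lemma Vgrad_mid u v : Vspace u -> Vspace v ->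
  Vgrad (2^-1 *: u + 2^-1 *: v) = 2^-1 *: Vgrad u + 2^-1 *: Vgrad v.
Proof.
move=> Vu Vv; rewrite !midE (Vgrad_lin _ (VspaceB Vu Vv) Vv).
by rewrite (VgradB Vu Vv).
Qed.

(** [mazur] upgrades an approximation of u in H to an approximation in V, where the last hypothesis
    says that A is closed. *)
Lemma closed_in_H (A : set Hs) (C : R) :
  (forall u v, A u -> A v -> A (2^-1 *: u + 2^-1 *: v)) ->
  A `<=` Vspace -> (forall u, A u -> `|Vgrad u| <= C) ->
  (forall u, Vspace u -> (forall e : R, 0 < e -> exists v,
     A v /\ `|Vgrad u - Vgrad v| <= e) -> A u) ->
  closed A.
Proof.
move=> Amid AV AC Acl u uA.
have gmid v w : A v -> A w -> Vgrad (2^-1 *: v + 2^-1 *: w) = 2^-1 *: Vgrad v + 2^-1 *: Vgrad w.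
  by move=> /AV Vv /AV Vw; exact: Vgrad_mid.
have [G GP] := mazur Amid gmid AC uA.
have [Vu gu] : Vspace u /\ Vgrad u = G.
  apply: Vspace_closed => e /GP[w [Aw uw Gw]]; exists w.
  by split; [exact: AV|exact: uw|exact: Gw].
apply: (Acl u Vu) => e /GP[w [Aw uw Gw]]; exists w.
by rewrite gu; split; [exact: Aw|exact: Gw].
Qed.

Lemma closed_borel (A : set Hs) : closed A -> measurable (A : set (borel Hs)).
Proof.
move=> cA; rewrite -[A]setCK; apply: measurableC; apply: sub_sigma_algebra.
exact: closed_openC.
Qed.

Section dual.
Variables (f : Hs -> R).
Hypothesis Vf : Vdual f.

Lemma VdualB u v : Vspace u -> Vspace v -> f (u - v) = f u - f v.
Proof.
by move=> Vu Vv; rewrite addrC -scaleN1r (Vf.1 _ _ _ Vv Vu) mulN1r addrC.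
Qed.

Lemma Vdual_mid u v : Vspace u -> Vspace v ->
  f (2^-1 *: u + 2^-1 *: v) = 2^-1 * (f u + f v).
Proof.
move=> Vu Vv; rewrite midE (Vf.1 _ _ _ (VspaceB Vu Vv) Vv) (VdualB Vu Vv); by field.
Qed.

Lemma Vdual_bound : exists K, 0 <= K /\ forall u, Vspace u -> `|f u| <= K * `|Vgrad u|.
Proof.
have [_ [K fK]] := Vf; exists `|K|; split => // u Vu.
by apply: le_trans (fK u Vu) _; apply: ler_wpM2r; [exact: normr_ge0|exact: ler_norm].
Qed.

Lemma closed_Vball_sublevel (C c : R) :
  closed [set u : Hs | [/\ Vspace u, `|Vgrad u| <= C & f u <= c]].
Proof.
have [K [K0 fK]] := Vdual_bound.
apply: (closed_in_H (C := C)).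
- move=> u v [Vu uC uc] [Vv vC vc]; split; first exact: Vspace_mid.
    rewrite (Vgrad_mid Vu Vv) -scalerDr normrZ ger0_norm ?invr_ge0//.
    rewrite ler_pdivrMl// mulr_natl mulr2n; apply: le_trans (ler_normD _ _) _.
    exact: (lerD uC vC).
  by rewrite (Vdual_mid Vu Vv) ler_pdivrMl// mulr_natl mulr2n; exact: (lerD uc vc).
- by move=> u [].
- by move=> u [].
- move=> u Vu lim; split; first exact: Vu.
    apply/ler_addgt0Pr => e e0; have [v [[Vv vC _] guv]] := lim e e0.
    rewrite -(subrK (Vgrad v) (Vgrad u)) addrC.
    by apply: le_trans (ler_normD _ _) _; exact: (lerD vC guv).
  apply/ler_addgt0Pr => e e0.
  have c0 : 0 < K + 1 by rewrite ltr_wpDl.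
  have [v [[Vv _ vc] guv]] := lim _ (divr_gt0 e0 c0).
  have le_e : f u - f v <= e.
    rewrite -(VdualB Vu Vv); apply: le_trans (ler_norm _) _.
    apply: le_trans (fK _ (VspaceB Vu Vv)) _; rewrite (VgradB Vu Vv).
    apply: (@le_trans _ _ (K * (e / (K + 1)))); first exact: ler_wpM2l.
    by rewrite mulrA ler_pdivrMr// mulrC ler_wpM2l ?lerDl// ltW.
  by move: vc le_e; move: (f u) (f v) => a b vc le_e; lra.
Qed.

End dual.

Lemma Vdual0 : Vdual (cst 0 : Hs -> R).
Proof.
split=> [a u v _ _|]; first by rewrite /= mulr0 addr0.
by exists 0 => u _; rewrite /= normr0 mul0r.
Qed.

(** For the functional 0 and the level 0, the condition f u <= c always holds and only the ball
    remains. *)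
Lemma measurable_Vball (C : R) :
  measurable ([set u | Vspace u /\ `|Vgrad u| <= C] : set (borel Hs)).
Proof.
have := closed_borel (@closed_Vball_sublevel _ Vdual0 C 0).
by congr (measurable _); apply/seteqP; split=> u /= [].
Qed.

Lemma measurable_Vspace : measurable (Vspace : set (borel Hs)).
Proof.
rewrite (_ : Vspace = \bigcup_n [set u | Vspace u /\ `|Vgrad u| <= n%:R]).
  by apply: bigcupT_measurable => n; exact: measurable_Vball.
apply/seteqP; split=> [u Vu|u [n _ []]//].
exists (Num.truncn `|Vgrad u|).+1 => //; split => //=.
by apply: ltW; exact: truncnS_gt.
Qed.

Lemma measurable_fun_sublevel (D : set (borel Hs)) (h : borel Hs -> R) :
  measurable D -> (forall c, measurable (D `&` [set u | h u <= c])) ->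
  measurable_fun D h.
Proof.
move=> mD hc; apply: (measurability _ (RGenOInfty.measurableE R)) => // _ [_ [a ->] <-].
rewrite (_ : _ `&` _ = D `\` (D `&` [set u | h u <= a])); first exact: measurableD.
apply/seteqP; split=> u /=; rewrite in_itv /= andbT.
  by move=> [Du au]; split => // -[_]; rewrite leNgt au.
move=> [Du nu]; split => //; rewrite ltNge; apply/negP => h1; exact: nu.
Qed.

Lemma measurable_Vnorm : measurable_fun (Vspace : set (borel Hs)) (@Vnorm R Omega).
Proof.
apply: measurable_fun_sublevel => [|c]; first exact: measurable_Vspace.
exact: measurable_Vball.
Qed.

(** A sublevel set of f is the countable union of its parts in balls of V, each of which is closed
    in H. *)
Lemma measurable_Vdual f : Vdual f -> measurable_fun (Vspace : set (borel Hs)) f.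
Proof.
move=> Vf; apply: measurable_fun_sublevel => [|c]; first exact: measurable_Vspace.
rewrite (_ : _ `&` _ = \bigcup_n [set u | [/\ Vspace u, `|Vgrad u| <= n%:R & f u <= c]]).
  by apply: bigcupT_measurable => n; exact: closed_borel (@closed_Vball_sublevel _ Vf _ _).
apply/seteqP; split=> [u [Vu fu]|u [n _ []]//].
exists (Num.truncn `|Vgrad u|).+1 => //; split => //=.
by apply: ltW; exact: truncnS_gt.
Qed.

Lemma measurable_ell nu f : Vdual f ->
  measurable_fun (Vspace : set (borel Hs)) (ell nu f).
Proof.
move=> Vf; apply: measurable_funB; last exact: measurable_Vdual.
apply: measurable_funM; first exact: measurable_cst.
by apply: measurable_funX; exact: measurable_Vnorm.
Qed.

Lemma measurable_enstrophy :
  measurable_fun setT (@enstrophy R Omega : borel Hs -> \bar R).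
Proof.
have mV := measurable_Vspace.
rewrite -(setUv Vspace); apply/measurable_funU => //; first exact: measurableC.
split.
  apply: (eq_measurable_fun (fun u : borel Hs => (Vnorm (u : Hs) ^+ 2)%:E)).
    by move=> u; rewrite inE => Vu; rewrite /enstrophy; case: asboolP.
  by apply/measurable_EFinP; apply: measurable_funX; exact: measurable_Vnorm.
apply: (eq_measurable_fun (cst +oo%E : borel Hs -> \bar R)); last exact: measurable_cst.
by move=> u; rewrite inE => Vu; rewrite /enstrophy; case: asboolP.
Qed.

(** Makes ell integrable for every probability measure of finite mean enstrophy. *)
Lemma ell_bound nu f : Vdual f -> exists c : R, 0 <= c /\
  forall u, Vspace u -> `|ell nu f u| <= c * (Vnorm u ^+ 2 + 1).
Proof.
move=> Vf; have [K [K0 fK]] := Vdual_bound Vf.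
exists (`|nu| + K); split; first by rewrite addr_ge0.
move=> u Vu; have := fK u Vu; rewrite -VnormE /ell => fu.
have N0 : 0 <= Vnorm u by rewrite VnormE.
apply: le_trans (ler_normB _ _) _; rewrite normrM [`|_ ^+ 2|]ger0_norm ?sqr_ge0//.
move: fu N0 (normr_ge0 nu); move: (Vnorm u) (`|f u|) (`|nu|) => a b c h1 h2 h3.
have : K * a <= K * (a ^+ 2 + 1) by rewrite ler_wpM2l//; nra.
nra.
Qed.

End measurability.

(** * Continuous functionals on H *)

Section weak.
Variables (R : realType) (E : normedModType R).

Lemma lipschitz_functional_continuous (phi : E -> R) (K : R) :
  (forall u v, `|phi u - phi v| <= K * `|u - v|) -> continuous phi.
Proof.
move=> phiK u; apply/cvgrPdist_le => e e0.
have c0 : 0 < `|K| + 1 by rewrite ltr_wpDl.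
apply: filterS (nbhsx_ballx u _ (divr_gt0 e0 c0)) => v.
rewrite -ball_normE /= => /ltW uv; apply: le_trans (phiK u v) _.
apply: (@le_trans _ _ ((`|K| + 1) * (e / (`|K| + 1)))); last first.
  by rewrite mulrCA divff ?mulr1// gt_eqF.
apply: le_trans (ler_wpM2r (normr_ge0 _) (ler_norm K)) _.
by apply: ler_pM => //; rewrite lerDl.
Qed.

Lemma dual_weak_continuous (phi : dual E) :
  continuous (fun u : weak E => sval phi u : R^o).
Proof.
move=> u.
apply: (@continuous_comp (weak E) {ptws (dual E) -> R^o} R^o
  (fun u : E => (fun f => sval f u) : {ptws (dual E) -> R^o}) (fun h => h phi)).
  exact: initial_continuous.
exact: (@proj_continuous {classic (dual E)} (fun=> R^o) phi).
Qed.

Lemma weakly_compact_closed (B : set E) :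
  (forall u v : E, (forall phi : dual E, sval phi u = sval phi v) -> u = v) ->
  weakly_compact B -> closed B.
Proof.
move=> dsep cB u uB.
pose F : set_system E := within B (nbhs u).
have PF : ProperFilter F by exact: within_nbhs_proper.
have FB : F B by rewrite /F /within /=; apply: nearW.
have [p [Bp Fp]] := cB F PF FB.
suff -> : u = p by [].
apply: dsep => phi; apply/eqP/negPn/negP => neq.
  pose e := `|sval phi u - sval phi p| / 2.
  have e0 : 0 < e by rewrite divr_gt0// normr_gt0 subr_eq0.
  have Fu : F (B `&` [set v | `|sval phi u - sval phi v| < e]).
    rewrite /F /within /=.
    have /cvgrPdist_lt/(_ _ e0) := svalP phi u.
    by apply: filterS => v h Bv.
  have Np : nbhs (p : weak E) [set v | `|sval phi p - sval phi v| < e].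
    exact: (cvgrPdist_lt _ _).1 (@dual_weak_continuous phi p) e e0.
  have [v [[_ uv] pv]] := Fp _ _ Fu Np.
  have : `|sval phi u - sval phi p| < e + e.
    rewrite -(subrKA (sval phi v)); apply: le_lt_trans (ler_normD _ _) _.
    by rewrite [X in _ + X]distrC; exact: ltrD.
  by rewrite /e -splitr ltxx.
Qed.

End weak.

Section functionals.
Variables (R : realType) (Omega : bounded_domain R).
Local Notation mu := (lebO Omega).
Local Notation Hs := (Hspace Omega).
Local Notation L2v := (L2 mu 'I_3).
Implicit Types u v w : Hs.

Definition ip_fun (q : L2v) (w : Hs) : R^o := ip (Hval w) q.

Lemma ip_fun_lin q : linear (ip_fun q).
Proof. by move=> a u v; rewrite /ip_fun Hval_lin ip_linl. Qed.
HB.instance Definition _ q := GRing.isLinear.Build R Hs R^o *:%R (ip_fun q) (ip_fun_lin q).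

Lemma ip_funB q u v : ip_fun q u - ip_fun q v = ip (Hval u - Hval v) q.
Proof. by rewrite ipDl ipNl. Qed.

Lemma ip_fun_continuous q : continuous (ip_fun q).
Proof.
apply: (@lipschitz_functional_continuous R Hs _ `|q|) => u v.
by rewrite ip_funB mulrC; exact: (ip_le (Hval u - Hval v) q).
Qed.

Definition ip_dual (q : L2v) : dual Hs :=
  exist _ (ip_fun q : {linear Hs -> R^o}) (@ip_fun_continuous q).

Lemma weakly_compact_closed_H (B : set Hs) : weakly_compact B -> closed B.
Proof.
apply: weakly_compact_closed.
move=> u v h.
(* The functional represented by the difference u - v separates u from v. *)
have : ip_fun (Hval u - Hval v) u = ip_fun (Hval u - Hval v) v by exact: h (ip_dual _).
move=> {h} /eqP; rewrite -subr_eq0 ip_funB ip_norm expf_eq0 /= normr_eq0.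
by rewrite subr_eq0 => /eqP h; exact: val_inj.
Qed.

(** The functionals are the integrals of the components over rational boxes: they are countably
    many, and [rbox_ae0] says that they determine the field. Integers that code no pair receive the
    functional 0. *)
Lemma separating_family : exists h : nat -> Hs -> R,
  (forall n, continuous (h n)) /\ forall u v, (forall n, h n u = h n v) -> u = v.
Proof.
have iL t : (\1_(@rbox R t) : R3 R -> R) \in Lfun mu 2%:E.
  apply: (@bounded_Lfun2 _ _ _ 1); first exact: measurable_indic (measurable_rbox _).
  by move=> x; rewrite ger0_norm// indicE lern1 leq_b1.
pose h n : Hs -> R :=
  if unpickle n is Some (t, i) then
    ip_fun (component i (Lfun_Sub (le1_2E R) (iL t)))
  else cst 0.
exists h; split=> [n|u v huv].
  rewrite /h; case: (unpickle n) => [[t i]|]; last exact: cst_continuous.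
  exact: ip_fun_continuous.
have z t i : \int[mu]_x (repr ((Hval u - Hval v)) i x * \1_(@rbox R t) x) = 0.
  have := huv (pickle (t, i)); rewrite /h pickleK => /eqP.
  rewrite -subr_eq0 ip_funB ip_component => /eqP E.
  rewrite -[RHS]E; apply: eq_Rintegral => x _.
  by rewrite (Lfun_valP (le1_2E R) (iL t)).
suff E0 : Hval u - Hval v = 0 by apply/val_inj/eqP; rewrite -subr_eq0; exact/eqP.
suff nz : repr ((Hval u - Hval v)) \in @L2null _ _ _ mu 'I_3.
  rewrite -[LHS]reprK; apply/eqP; rewrite -(raddf0 \pi_(L2 mu 'I_3)) L2_piE subr0.
  exact: nz.
apply/asboolP => i; apply: rbox_ae0.
  have fm : mu setT \is a fin_num by rewrite ge0_fin_numE// lebO_finite.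
  exact/Lfun1_integrable/(Lfun_subset12 fm)/LfunP.
move=> t; have := z t i; rewrite /Rintegral.
have -> : (\int[mu]_x (repr ((Hval u - Hval v)) i x * \1_(@rbox R t) x)%:E =
    \int[mu]_(x in rbox t) (repr ((Hval u - Hval v)) i x)%:E)%E.
  rewrite [RHS]integral_mkcond; apply: eq_integral => x _.
  by rewrite patchE indicE; case: ifP => _; rewrite !(mulr1, mulr0).
move/eqP; rewrite fine_eq0; first by move/eqP.
apply: integrable_fin_num; first exact: measurable_rbox.
apply: (integrableS measurableT); [exact: measurable_rbox|by []|].
have fm : mu setT \is a fin_num by rewrite ge0_fin_numE// lebO_finite.
exact/Lfun1_integrable/(Lfun_subset12 fm)/LfunP.
Qed.

Lemma continuous_borel (h : Hs -> R) : continuous h ->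
  measurable_fun setT (h : borel Hs -> R).
Proof.
move=> ch; apply: (measurability _ (RGenOInfty.measurableE R)) => // _ [_ [a ->] <-].
rewrite setTI; apply: sub_sigma_algebra; apply: open_comp; first by move=> x _; exact: ch.
exact: interval_open.
Qed.

End functionals.

(** * Reweighted probability measures and atoms *)

Section probability_lemmas.
Context d (T : measurableType d) (R : realType).
Implicit Types (mu : probability T R) (A X : set T).

Lemma integral_mrestr mu A (mA : measurable A) (f : T -> \bar R) :
  measurable_fun setT f -> (forall x, 0 <= f x)%E ->
  (\int[mrestr mu mA]_x f x = \int[mu]_(x in A) f x)%E.
Proof.
move=> mf f0; have mAC := measurableC mA.
rewrite -(setUv A) ge0_integral_setU//; last 2 first.
- by rewrite setUv.
- by rewrite disj_set2E setICr.
rewrite [X in (_ + X)%E](_ : _ = 0%E); last first.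
  have z : mrestr mu mA (~` A) = 0%E by rewrite /mrestr setICl measure0.
  apply: null_set_integral => //; exact: measurable_funTS.
rewrite adde0; apply: eq_measure_integral => X mX XA.
by rewrite /= /mrestr setIidl.
Qed.

Lemma reweigh mu n (A : nat -> set T) (c : nat -> R) :
  (forall i, measurable (A i)) -> (forall i, 0 <= c i) ->
  (\sum_(i < n) (c i)%:E * mu (A i) = 1)%E ->
  exists mu' : probability T R,
    (forall X, measurable X -> mu' X = (\sum_(i < n) (c i)%:E * mu (X `&` A i))%E) /\
    (forall f : T -> \bar R, measurable_fun setT f -> (forall x, 0 <= f x)%E ->
      (\int[mu']_x f x = \sum_(i < n) (c i)%:E * \int[mu]_(x in A i) f x)%E).
Proof.
move=> mA c0 c1.
pose m (i : nat) : {measure set T -> \bar R} :=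
  mscale (NngNum (c0 i)) (mrestr mu (mA i)).
pose M : {measure set T -> \bar R} := msum m n.
have ME X : M X = (\sum_(i < n) (c i)%:E * mu (X `&` A i))%E by [].
have M1 : M setT = 1%E.
  by rewrite ME -[RHS]c1; apply: eq_bigr => i _; rewrite setTI.
(* M already has mass 1; normalizing it only provides the structure of a probability. *)
have nE X : mnormalize M mu X = M X.
  by rewrite /mnormalize M1 /= onee_eq0 /= invr1 mule1.
exists (mnormalize M mu); split => [X mX|f mf f0]; first exact: (etrans (nE X)).
transitivity (\int[M]_x f x)%E.
  by apply: eq_measure_integral => X mX _; exact: nE.
rewrite /M ge0_integral_measure_sum//; apply: eq_bigr => i _.
by rewrite ge0_integral_mscale// integral_mrestr.
Qed.

Lemma null_bigcup mu (A : nat -> set T) : (forall n, measurable (A n)) ->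
  (forall n, mu (A n) = 0%E) -> mu (\bigcup_n A n) = 0%E.
Proof.
move=> mA A0; apply/eqP; rewrite eq_le measure_ge0 andbT.
apply: le_trans (le_mu_bigcup mu mA _) _.
  exact: bigcupT_measurable.
by rewrite eseries0// => n _ _; exact: A0.
Qed.

Lemma probC mu A : measurable A -> mu (~` A) = 0%E <-> mu A = 1%E.
Proof.
move=> mA; have := probability_setC mu mA => ->; split => [h|->]; last by rewrite subee.
have := probability_le1 mu mA; have := measure_ge0 mu A; move: h.
by case: (mu A) => [r|//|//]; rewrite -EFinB => -[] h _ _; congr (_%:E); lra.
Qed.

(** The part of X outside A lies in the null complement of A. *)
Lemma prob_setI1 mu A X : measurable A -> measurable X -> mu A = 1%E ->
  mu (A `&` X) = mu X.
Proof.
move=> mA mX A1; rewrite setIC [RHS](measureDI mu mX mA).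
rewrite [X in (X + _)%E](_ : _ = 0%E) ?add0e//.
apply/eqP; rewrite eq_le measure_ge0 andbT -[leRHS](iffRL (probC mu mA) A1).
apply: le_measure; rewrite ?inE; [exact: measurableD|exact: measurableC|].
by move=> x [].
Qed.

(** The distribution function of f only takes the values 0 and 1. Its jump r is the infimum of the
    points where it is 1; this infimum is finite because the sublevel sets exhaust T and their
    complements do too. *)
Lemma zero_one_const mu (f : T -> R) : measurable_fun setT f ->
  (forall t, mu [set x | f x <= t] = 0%E \/ mu [set x | f x <= t] = 1%E) ->
  exists r, mu [set x | f x = r] = 1%E.
Proof.
move=> mf f01.
have mle t : measurable [set x | f x <= t].
  have := mf measurableT _ (measurable_itv `]-oo, t]); rewrite setTI.
  by congr measurable; apply/seteqP; split => x /=; rewrite in_itv.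
pose S := [set t | mu [set x | f x <= t] = 1%E].
have S0 : S !=set0.
  apply: contrapT => /set0P/negP/negPn/eqP Se.
  have z n : mu [set x | f x <= n%:R] = 0%E.
    by have [//|h] := f01 n%:R; have : S n%:R by []; rewrite Se.
  have := @null_bigcup mu (fun n => [set x | f x <= n%:R]) (fun n => mle n%:R) z.
  rewrite (_ : \bigcup_n _ = setT); first by rewrite probability_setT => /eqP; rewrite onee_eq0.
  apply/seteqP; split=> // x _; exists (Num.truncn `|f x|).+1 => //=.
  by apply: le_trans (ler_norm _) _; apply: ltW; exact: truncnS_gt.
have [t0 t00] : exists t0, mu [set x | f x <= t0] = 0%E.
  apply: contrapT => /forallNP h.
  have z n : mu (~` [set x | f x <= - n%:R]) = 0%E.
    by apply/probC; [exact: mle|]; have [/h//|] := f01 (- n%:R).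
  have := @null_bigcup mu (fun n => ~` [set x | f x <= - n%:R])
    (fun n => measurableC (mle _)) z.
  rewrite (_ : \bigcup_n _ = setT); first by rewrite probability_setT => /eqP; rewrite onee_eq0.
  apply/seteqP; split=> // x _; exists (Num.truncn `|f x|).+1 => //=.
  apply/negP; rewrite -ltNge ltrNl; apply: le_lt_trans (truncnS_gt _).
  by rewrite -normrN ler_norm.
have mono s t : s <= t -> S s -> S t.
  move=> st Ss; have [h|//] := f01 t.
  have : (mu [set x | (f x <= s)%R] <= mu [set x | (f x <= t)%R])%E.
    apply: le_measure; rewrite ?inE; [exact: mle|exact: mle|].
    by move=> x /= /le_trans; exact.
  by rewrite h Ss lee_fin ler10.
have lbS : lbound S t0.
  move=> t St; rewrite leNgt; apply/negP => /ltW/mono/(_ St).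
  by rewrite /S /= t00 => /eqP; rewrite eq_sym onee_eq0.
have iS : has_inf S by split => //; exists t0.
pose r := inf S; exists r.
have mr : measurable [set x | f x = r].
  have := mf measurableT _ (measurable_set1 r); rewrite setTI.
  by congr measurable.
apply/(probC _ mr).
pose D n := [set x | f x <= r - n.+1%:R^-1] `|` ~` [set x | f x <= r + n.+1%:R^-1].
have n0 n : 0 < n.+1%:R^-1 :> R by rewrite invr_gt0.
have mD n : measurable (D n) by apply: measurableU; [|apply: measurableC]; exact: mle.
have D0 n : mu (D n) = 0%E.
  have d1 : mu [set x | f x <= r - n.+1%:R^-1] = 0%E.
    have [//|h] := f01 (r - n.+1%:R^-1).
    have Sr : S (r - n.+1%:R^-1) by exact: h.
    by have := ge_inf iS.2 Sr; rewrite -/r leNgt ltrBlDr ltrDl n0.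
  have d2 : mu (~` [set x | f x <= r + n.+1%:R^-1]) = 0%E.
    apply/probC; first exact: mle.
    have [t St rt] := inf_adherent (n0 n) iS.
    by apply: mono St; exact: ltW.
  by rewrite /D measureU0//; apply: measurableC; exact: mle.
rewrite (_ : ~` _ = \bigcup_n D n); first exact: null_bigcup.
apply/seteqP; split=> [x /eqP fr|x [n _] []] /=.
- have e0 : 0 < `|f x - r| by rewrite normr_gt0 subr_eq0.
  have [n _ /(_ n (leqnn n)) /= nr] := near_infty_natSinv_lt (PosNum e0).
  exists n => //; have [xr|rx] := leP (f x) r.
    left; rewrite /=; move: nr; rewrite ler0_norm ?subr_le0//; move: (_^-1) => y; lra.
  right; rewrite /=; apply/negP; rewrite -ltNge; move: nr.
  rewrite gtr0_norm ?subr_gt0//; move: (_^-1) => y; lra.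
- move=> h E; move: h; rewrite E; have := n0 n; move: (_^-1) => y; lra.
- move=> h E; apply: h; rewrite E; have := n0 n; move: (_^-1) => y; lra.
Qed.

(** Each [h n] is almost surely a constant [r n]. The common level set has measure 1, so it is
    nonempty, and separation leaves room for one point only. *)
Lemma zero_one_dirac mu (h : nat -> T -> R) :
  (forall n, measurable_fun setT (h n)) ->
  (forall u v, (forall n, h n u = h n v) -> u = v) ->
  (forall A, measurable A -> mu A = 0%E \/ mu A = 1%E) ->
  exists u, mu [set u] = 1%E.
Proof.
move=> mh hsep mu01.
have mle n t : measurable [set x | h n x <= t].
  have := mh n measurableT _ (measurable_itv `]-oo, t]); rewrite setTI.
  by congr measurable; apply/seteqP; split => x /=; rewrite in_itv.
have /choice[r rP] : forall n, exists r, mu [set x | h n x = r] = 1%E.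
  by move=> n; apply: zero_one_const => // t; exact: mu01.
have mr n : measurable [set x | h n x = r n].
  by have := mh n measurableT _ (measurable_set1 (r n)); rewrite setTI.
pose D := \bigcup_n ~` [set x | h n x = r n].
have D0 : mu D = 0%E.
  by apply: null_bigcup => n; [exact: measurableC|exact/probC].
have mD : measurable D by apply: bigcupT_measurable => n; exact: measurableC.
have DC : mu (~` D) = 1%E by apply/probC; [exact: measurableC|rewrite setCK].
have [u uD] : ~` D !=set0.
  apply: contrapT => /set0P/negP/negPn/eqP De.
  by move: DC; rewrite De measure0 => /eqP; rewrite eq_sym onee_eq0.
exists u; rewrite -DC; congr (mu _); apply/seteqP; split=> [_ ->//|v vD].
have hD w n : (~` D) w -> h n w = r n.
  by move=> wD; apply: contrapT => hw; apply: wD; exists n.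
by apply: hsep => n; rewrite !hD.
Qed.

End probability_lemmas.

(** * Extreme points under a family of linear constraints *)

(** The cross product of the two coefficient vectors is a solution; if its last coordinate is 0,
    then (m2, -m1, 0) is one. Scaling makes the coordinates at most 1 in absolute value, so that 1 +
    e_i and 1 - e_i can serve as weights. *)
Lemma two_equations (R : realFieldType) (m1 m2 m3 i1 i2 i3 : R) :
  0 < m1 -> 0 < m2 -> exists e1 e2 e3,
  [/\ `|e1| <= 1, `|e2| <= 1 & `|e3| <= 1] /\
  [/\ e1 * m1 + e2 * m2 + e3 * m3 = 0, e1 * i1 + e2 * i2 + e3 * i3 = 0 &
     e1 != 0 \/ e2 != 0 \/ e3 != 0].
Proof.
move=> m10 m20.
have [a1 [a2 [a3 [h1 h2 h3]]]] : exists a1 a2 a3,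
  [/\ a1 * m1 + a2 * m2 + a3 * m3 = 0, a1 * i1 + a2 * i2 + a3 * i3 = 0 &
     a1 != 0 \/ a2 != 0 \/ a3 != 0].
  have [z3|z3] := eqVneq (m1 * i2 - m2 * i1) 0.
    exists m2, (- m1), 0; split; [by ring| |by left; rewrite gt_eqF].
    by rewrite mul0r addr0 -[RHS]oppr0 -[in RHS]z3; ring.
  exists (m2 * i3 - m3 * i2), (m3 * i1 - m1 * i3), (m1 * i2 - m2 * i1).
  by split; [ring|ring|right; right].
pose S := 1 + `|a1| + `|a2| + `|a3|.
have g1 := normr_ge0 a1; have g2 := normr_ge0 a2; have g3 := normr_ge0 a3.
have S0 : 0 < S by rewrite /S; lra.
have Sle a : `|a| <= S -> `|a / S| <= 1.
  by move=> aS; rewrite normrM normfV (gtr0_norm S0) ler_pdivrMr// mul1r.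
have Sn : S^-1 != 0 by rewrite invr_eq0 gt_eqF.
exists (a1 / S), (a2 / S), (a3 / S); split.
  by split; apply: Sle; rewrite /S; lra.
split.
- by rewrite !(mulrAC _ S^-1) -!mulrDl h1 mul0r.
- by rewrite !(mulrAC _ S^-1) -!mulrDl h2 mul0r.
- by rewrite !mulf_eq0 !(negbTE Sn) !orbF.
Qed.

Section reweighing.
Context d (T : measurableType d) (R : realType).
Variables (mu mu' : probability T R) (n : nat) (A : nat -> set T) (c : nat -> R).
Hypothesis mA : forall i, measurable (A i).
Hypothesis c0 : forall i, 0 <= c i.
Hypothesis mu'E : forall f : T -> \bar R, measurable_fun setT f -> (forall x, 0 <= f x)%E ->
  (\int[mu']_x f x = \sum_(i < n) (c i)%:E * \int[mu]_(x in A i) f x)%E.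

Lemma reweigh_Rintegral (f : T -> R) : mu.-integrable setT (EFin \o f) ->
  \int[mu']_x f x = \sum_(i < n) c i * \int[mu]_(x in A i) f x.
Proof.
move=> /[dup] fi /integrableP[mf _].
pose g := EFin \o f.
have ip i : mu.-integrable (A i) g by apply: integrableS fi.
pose a i := fine (\int[mu]_(x in A i) g^\+ x)%E.
pose b i := fine (\int[mu]_(x in A i) g^\- x)%E.
have aE i : (\int[mu]_(x in A i) g^\+ x = (a i)%:E)%E.
  by rewrite /a fineK//; apply: integrable_pos_fin_num.
have bE i : (\int[mu]_(x in A i) g^\- x = (b i)%:E)%E.
  by rewrite /b fineK//; apply: integrable_neg_fin_num.
have fE i : \int[mu]_(x in A i) f x = a i - b i.
  by rewrite /Rintegral integralE aE bE.
rewrite {1}/Rintegral integralE !mu'E//; last 2 first.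
- exact: measurable_funeneg.
- exact: measurable_funepos.
under eq_bigr do rewrite aE -EFinM.
under [X in (_ - X)%E]eq_bigr do rewrite bE -EFinM.
rewrite !sumEFin -EFinB /= -sumrB; apply: eq_bigr => i _.
by rewrite fE mulrBr.
Qed.

End reweighing.

(** * Abstract setting: N, L and E stand for the squared norm, ell and the enstrophy *)

Section extremal.
Context d (T : measurableType d) (R : realType).
Variables (V B : set T) (N L : T -> R) (E : T -> \bar R) (c : R) (phi : nat -> T -> R).
Hypotheses (mV : measurable V) (mB : measurable B) (mN : measurable_fun setT N)
  (mL : measurable_fun V L) (mE : measurable_fun setT E)
  (E0 : forall u, (0 <= E u)%E) (EV : forall u, (E u < +oo)%E <-> V u)
  (LE : forall u, V u -> (`|L u|%:E <= c%:E * (E u + 1))%E)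
  (mphi : forall n, measurable_fun setT (phi n))
  (phi_sep : forall u v, (forall n, phi n u = phi n v) -> u = v).

Implicit Types (mu : probability T R) (g : R -> R) (A X : set T).

(* The functions psi' of the stationarity condition, extended to the whole line. *)
Definition weight (g : R -> R) :=
  [/\ continuous g, forall t, 0 <= g t & exists M, forall t, g t <= M].

Definition admissible : set (probability T R) :=
  [set mu | [/\ mu B = 1%E, (\int[mu]_u E u < +oo)%E &
    forall g, weight g -> (\int[mu]_(u in V) (g (N u) * L u)%:E <= 0)%E]].

(** L is meaningful on V only; extended by 0, it can be integrated over all of T. *)
Definition LV : T -> R := L \_ V.

Definition J (mu : probability T R) A g := \int[mu]_(u in A) (g (N u) * LV u).

Lemma measurable_LV : measurable_fun setT LV.
Proof. by apply/(measurable_restrictT _ mV). Qed.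

Lemma measurable_gN (g : R -> R) : continuous g -> measurable_fun setT (g \o N).
Proof. by move=> cg; apply: measurableT_comp => //; exact: continuous_measurable_fun. Qed.

Lemma measurable_gLV (g : R -> R) : measurable_fun setT (g \o N) ->
  measurable_fun setT (fun u => g (N u) * LV u).
Proof. by move=> mg; apply: measurable_funM => //; exact: measurable_LV. Qed.

Lemma integrable_LV (mu : probability T R) : (\int[mu]_u E u < +oo)%E ->
  mu.-integrable setT (EFin \o LV).
Proof.
move=> Eoo.
have iE : mu.-integrable setT E.
  by apply/integrableP; split => //; under eq_integral do rewrite gee0_abs//.
have i1 : mu.-integrable setT (fun u => c%:E * (E u + cst 1 u))%E.
  apply: integrableZl => //; apply: integrableD => //.
  by apply: finite_measure_integrable_cst.
apply: le_integrable i1 => //; first by apply/measurable_EFinP; exact: measurable_LV.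
move=> u _; rewrite /= /LV patchE; case: ifPn => [/[!inE] Vu|_].
  by apply: le_trans (LE Vu) _; exact: lee_abs.
by rewrite normr0; exact: abse_ge0.
Qed.

Lemma integrable_gLV (mu : probability T R) (g : R -> R) (M : R) : (\int[mu]_u E u < +oo)%E ->
  measurable_fun setT (g \o N) -> (forall t, `|g t| <= M) ->
  mu.-integrable setT (EFin \o (fun u => g (N u) * LV u)).
Proof.
move=> Eoo mg gM.
have M0 : 0 <= M by apply: le_trans (gM 0).
have i1 : mu.-integrable setT (fun u => M%:E * (EFin \o LV) u)%E.
  by apply: integrableZl => //; exact: integrable_LV.
apply: le_integrable i1 => //; first by apply/measurable_EFinP; exact: measurable_gLV.
by move=> u _; rewrite /= lee_fin !normrM [`|M|]ger0_norm// ler_wpM2r.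
Qed.

Lemma weight_bound g : weight g -> exists M, forall t, `|g t| <= M.
Proof. by move=> [_ g0 [M gM]]; exists M => t; rewrite ger0_norm. Qed.

Lemma integrable_weight (mu : probability T R) g : (\int[mu]_u E u < +oo)%E -> weight g ->
  mu.-integrable setT (EFin \o (fun u => g (N u) * LV u)).
Proof.
move=> Eoo wg; have [M gM] := weight_bound wg; have [cg _ _] := wg.
exact: (integrable_gLV Eoo (measurable_gN cg) gM).
Qed.

Lemma JE (mu : probability T R) g : (\int[mu]_u E u < +oo)%E -> weight g ->
  (\int[mu]_(u in V) (g (N u) * L u)%:E)%E = (J mu setT g)%:E.
Proof.
move=> Eoo wg; rewrite /J /Rintegral fineK; last first.
  exact: integrable_fin_num (integrable_weight Eoo wg).
rewrite [LHS]integral_mkcond; apply: eq_integral => u _.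
by rewrite /LV !patchE; case: ifP => // _; rewrite mulr0.
Qed.

Lemma admissible_J mu g : admissible mu -> weight g -> J mu setT g <= 0.
Proof. by move=> [_ Eoo h0] wg; rewrite -lee_fin -JE//; exact: h0. Qed.

Lemma reweigh_admissible mu n (A : nat -> set T) (e : nat -> R) :
  admissible mu -> (forall i, measurable (A i)) -> (forall i, 0 <= e i) ->
  (\sum_(i < n) (e i)%:E * mu (A i) = 1)%E ->
  (forall g, weight g -> \sum_(i < n) e i * J mu (A i) g <= 0) ->
  exists mu', admissible mu' /\
    forall X, measurable X -> mu' X = (\sum_(i < n) (e i)%:E * mu (X `&` A i))%E.
Proof.
move=> [muB Eoo muJ] mA e0 e1 eJ.
have [mu' [mu'X mu'I]] := reweigh mA e0 e1.
have Eoo' : (\int[mu']_u E u < +oo)%E.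
  rewrite mu'I//; apply: lte_sum_pinfty => i _.
  apply: lte_mul_pinfty; rewrite ?lee_fin//.
  apply: le_lt_trans Eoo; apply: ge0_subset_integral => //.
exists mu'; split=> //; split=> //.
  rewrite mu'X// -[RHS]e1; apply: eq_bigr => i _.
  by rewrite (prob_setI1 mB (mA i) muB).
move=> g wg; rewrite JE// lee_fin /J (reweigh_Rintegral mA mu'I).
  exact: eJ.
exact: integrable_weight.
Qed.

Definition mass (mu : probability T R) A : R := fine (mu A).

Lemma massE mu A : measurable A -> mu A = (mass mu A)%:E.
Proof. by move=> mA; rewrite /mass fineK// fin_num_measure. Qed.

Lemma mass_ge0 mu A : 0 <= mass mu A.
Proof. exact: fine_ge0. Qed.

Lemma mass0 mu : mass mu set0 = 0.
Proof. by rewrite /mass measure0. Qed.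

Section three_sets.
Variables (mu : probability T R) (X1 X2 X3 : set T).
Hypotheses (m1 : measurable X1) (m2 : measurable X2) (m3 : measurable X3)
  (d12 : X1 `&` X2 = set0) (d13 : X1 `&` X3 = set0) (d23 : X2 `&` X3 = set0)
  (X123 : X1 `|` X2 `|` X3 = setT).

Lemma mass_partition A : measurable A ->
  mass mu A = mass mu (A `&` X1) + mass mu (A `&` X2) + mass mu (A `&` X3).
Proof.
move=> mA; have mI X : measurable X -> measurable (A `&` X) by exact: measurableI.
apply: EFin_inj; rewrite !EFinD -!massE//; try exact: mI.
rewrite -measureU//; try exact: mI; last by rewrite setIACA setIid d12 setI0.
rewrite -measureU//; try exact: mI; last 2 first.
- by apply: measurableU; exact: mI.
- by rewrite -setIUr setIACA setIid setIUl d13 d23 setU0 setI0.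
by rewrite -!setIUr X123 setIT.
Qed.

Lemma J_partition g : mu.-integrable setT (EFin \o (fun u => g (N u) * LV u)) ->
  J mu setT g = J mu X1 g + J mu X2 g + J mu X3 g.
Proof.
move=> ig; have m12 := measurableU _ _ m1 m2.
rewrite /J -X123 Rintegral_setU//; last 2 first.
- by rewrite X123.
- by rewrite disj_set2E setIUl d13 d23 setU0.
rewrite Rintegral_setU//; last by rewrite disj_set2E d12.
by apply: integrableS ig.
Qed.

(* mu is the midpoint of (1 + h) mu and (1 - h) mu, for h = sum_i e_i 1_{Xi}. *)
Lemma perturbation (e1 e2 e3 : R) : extreme_points admissible mu ->
  `|e1| <= 1 -> `|e2| <= 1 -> `|e3| <= 1 ->
  e1 * mass mu X1 + e2 * mass mu X2 + e3 * mass mu X3 = 0 ->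
  (forall g (s : R), weight g -> s = 1 \/ s = -1 ->
     (1 + s * e1) * J mu X1 g + (1 + s * e2) * J mu X2 g + (1 + s * e3) * J mu X3 g <= 0) ->
  [/\ e1 * mass mu X1 = 0, e2 * mass mu X2 = 0 & e3 * mass mu X3 = 0].
Proof.
move=> [muC ext] h1 h2 h3 e0 eJ.
have nn (s e : R) : s = 1 \/ s = -1 -> `|e| <= 1 -> 0 <= 1 + s * e.
  by move=> [] ->; rewrite ler_norml => /andP[? ?]; lra.
pose A i := nth set0 [:: X1; X2; X3] i.
have mA i : measurable (A i) by case: i => [|[|[|[|i]]]] //=; exact: measurable0.
have rew (s : R) : s = 1 \/ s = -1 -> exists mu', admissible mu' /\ forall X, measurable X ->
    mass mu' X = (1 + s * e1) * mass mu (X `&` X1) + (1 + s * e2) * mass mu (X `&` X2)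
      + (1 + s * e3) * mass mu (X `&` X3).
  move=> s1; pose e i := nth 0 [:: 1 + s * e1; 1 + s * e2; 1 + s * e3] i.
  have en i : 0 <= e i by case: i => [|[|[|[|i]]]] //=; exact: nn.
  have sumE (X : set T) : measurable X -> (\sum_(i < 3) (e i)%:E * mu (X `&` A i) =
      ((1 + s * e1) * mass mu (X `&` X1) + (1 + s * e2) * mass mu (X `&` X2)
      + (1 + s * e3) * mass mu (X `&` X3))%:E)%E.
    move=> mX; rewrite !big_ord_recl big_ord0 /= /e /A /= adde0.
    by rewrite !massE ?addeA -?EFinM -?EFinD//; exact: measurableI.
  have [|g wg|mu' [mu'C mu'X]] := reweigh_admissible muC mA en (n := 3).
  - have := sumE setT measurableT.
    under eq_bigr do rewrite setTI.
    move=> ->; rewrite !setTI; congr (_%:E).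
    have := mass_partition measurableT; rewrite !setTI {1}/mass probability_setT /=.
    move=> pE; transitivity (mass mu X1 + mass mu X2 + mass mu X3 +
      s * (e1 * mass mu X1 + e2 * mass mu X2 + e3 * mass mu X3)); first by ring.
    by rewrite e0 mulr0 addr0 -pE.
  - rewrite !big_ord_recl big_ord0 /= /e /A /= addr0 addrA; exact: eJ.
  - exists mu'; split => // X mX; apply: EFin_inj.
    by rewrite -massE// mu'X// sumE.
have [y [yC yX]] := rew 1 (or_introl erefl).
have [z [zC zX]] := rew (-1) (or_intror erefl).
(* The midpoint of y and z is mu, so extremality forces them to agree on measurable sets. *)
have yz X : measurable X -> y X = z X.
  move=> mX; apply: contrapT => yzX; apply: ext.
  exists y, z, 2^-1; split => //; first by exists X.
    by rewrite invr_gt0 ltr0n invf_lt1 ?ltr1n.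
  move=> S mS; rewrite !massE// -!EFinM -EFinD; congr (_%:E).
  rewrite (mass_partition mS) yX// zX//; by field.
have yzm X : measurable X -> mass y X = mass z X by move=> mX; rewrite /mass yz.
(* The sets are disjoint, so y gives [Xi] the mass (1 + ei) mu(Xi) and z gives it (1 - ei)
   mu(Xi). *)
split.
- have := yzm _ m1; rewrite yX// zX// setIid d12 d13 mass0; lra.
- have := yzm _ m2; rewrite yX// zX// setIid (setIC X2 X1) d12 d23 mass0; lra.
- have := yzm _ m3; rewrite yX// zX// setIid (setIC X3 X1) (setIC X3 X2) d13 d23 mass0; lra.
Qed.

End three_sets.

Lemma weightM g k : weight g -> weight k -> weight (fun t => g t * k t).
Proof.
move=> [cg g0 [M gM]] [ck k0 [K kK]]; split.
- by move=> t; apply: cvgM; [exact: cg|exact: ck].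
- by move=> t; rewrite mulr_ge0.
- by exists (M * K) => t; apply: ler_pM.
Qed.

(** Each product g k_n is a weight, and dominated convergence carries its constraint over to g
    1_A. *)
Lemma J_limit mu g (k : nat -> R -> R) A : admissible mu -> weight g -> measurable A ->
  (forall n, weight (k n)) -> (forall n t, k n t <= 1) ->
  (forall u, k n (N u) @[n --> \oo] --> (\1_A u : R)) -> J mu A g <= 0.
Proof.
move=> muC wg mA wk k1 kA; have [_ Eoo _] := muC; have [cg g0 _] := wg.
have ig := integrable_weight Eoo wg.
have wgk n := weightM wg (wk n).
pose F n u := ((g (N u) * k n (N u)) * LV u)%:E.
have mF n : measurable_fun setT (F n).
  apply/measurable_EFinP; apply: (@measurable_gLV (fun t => g t * k n t)).
  by have [cgk _ _] := wgk n; exact: measurable_gN.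
have mF0 : measurable_fun setT (fun u => (g (N u) * LV u * \1_A u)%:E).
  apply/measurable_EFinP; apply: measurable_funM; last exact: measurable_indic.
  by apply: measurable_gLV; exact: measurable_gN.
have cF : {ae mu, forall u, setT u -> F n u @[n --> \oo] --> (g (N u) * LV u * \1_A u)%:E}.
  apply/aeW => u _; apply: cvg_EFin; first exact: nearW.
  rewrite (_ : fine \o _ = (fun n => (g (N u) * LV u) * k n (N u))); last first.
    by apply/funext => n; rewrite /F /=; ring.
  by apply: cvgM; [exact: cvg_cst|exact: kA].
have dF : {ae mu, forall u n, setT u -> (`|F n u| <= `|(g (N u) * LV u)%:E|)%E}.
  apply/aeW => u n _; rewrite /F lee_fin mulrAC normrM ler_piMr//.
  by have [_ k0 _] := wk n; rewrite ger0_norm.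
have [_ _ cv] := dominated_convergence measurableT mF mF0 cF (integrable_abse ig) dF.
have le0 : (\int[mu]_u (g (N u) * LV u * \1_A u)%:E <= 0)%E.
  rewrite -(cvg_lim _ cv)//; apply: lime_le; first exact: cvgP cv.
  apply: nearW => n /=; have := admissible_J muC (wgk n).
  rewrite /J /Rintegral -lee_fin fineK//.
  exact: integrable_fin_num (integrable_weight Eoo (wgk n)).
rewrite /J /Rintegral -lee_fin fineK; last first.
  by apply: integrable_fin_num => //; exact: integrableS ig.
apply: le_trans le0; rewrite le_eqVlt; apply/orP; left; apply/eqP.
rewrite [LHS]integral_mkcond; apply: eq_integral => u _.
by rewrite patchE indicE; case: ifP => _; rewrite ?mulr1 ?mulr0.
Qed.

(** This is exp (-2 n max (s - t, 0)): constantly 1 for s <= t and tending to 0 for s > t. *)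
Definition cutoff (t : R) n (s : R) := expR (- ((s - t) + `|s - t|)) ^+ n.

Lemma cutoff_le1 t n s : cutoff t n s <= 1.
Proof.
rewrite exprn_ile1 ?expR_ge0// -expR0 ler_expR oppr_le0.
have : - (s - t) <= `|s - t| by rewrite -normrN ler_norm.
lra.
Qed.

Lemma cutoff_ge0 t n s : 0 <= cutoff t n s.
Proof. by rewrite exprn_ge0// expR_ge0. Qed.

Lemma continuous_cutoff t n : continuous (cutoff t n).
Proof.
move=> s; apply: (@continuous_comp R R R
  (fun s => expR (- ((s - t) + `|s - t|))) (fun x => x ^+ n)); last exact: exprn_continuous.
apply: (@continuous_comp R R R (fun s => - ((s - t) + `|s - t|)) expR).
  have cst : (x - t) @[x --> s] --> s - t by apply: cvgB; [exact: cvg_id|exact: cvg_cst].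
  by apply: cvgN; apply: cvgD => //; exact: cvg_norm.
exact: continuous_expR.
Qed.

Lemma cvg_cutoff t s : cutoff t n s @[n --> \oo] --> (if s <= t then 1 else 0 : R).
Proof.
rewrite /cutoff; case: leP => st.
  rewrite ler0_norm ?subr_le0// subrr oppr0 expR0.
  by under eq_fun do rewrite expr1n; exact: cvg_cst.
apply: cvg_expr; rewrite ger0_norm ?expR_ge0// -expR0 ltr_expR oppr_lt0.
by rewrite gtr0_norm ?subr_gt0// addr_gt0 ?subr_gt0.
Qed.

Lemma measurable_N_le t : measurable [set u | N u <= t].
Proof.
have := mN measurableT (measurable_itv `]-oo, t]); rewrite setTI.
by congr measurable; apply/seteqP; split => u /=; rewrite in_itv.
Qed.

Lemma J_le_set mu g t : admissible mu -> weight g -> J mu [set u | N u <= t] g <= 0.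
Proof.
move=> muC wg; apply: (J_limit (k := cutoff t)) muC wg (measurable_N_le t) _ _ _.
- move=> n; split; [exact: continuous_cutoff|exact: cutoff_ge0|].
  by exists 1; exact: cutoff_le1.
- exact: cutoff_le1.
- move=> u; rewrite indicE.
  have := @cvg_cutoff t (N u); case: ifP => Nt; first by rewrite mem_set.
  by rewrite memNset//= Nt.
Qed.

Lemma J_gt_set mu g t : admissible mu -> weight g -> J mu (~` [set u | N u <= t]) g <= 0.
Proof.
move=> muC wg; apply: (J_limit (k := fun n s => 1 - cutoff t n s)) muC wg _ _ _ _.
- exact: measurableC (measurable_N_le t).
- move=> n; split.
  + by move=> s; apply: cvgB; [exact: cvg_cst|exact: continuous_cutoff].
  + by move=> s; rewrite subr_ge0 cutoff_le1.
  + by exists 1 => s; rewrite gerBl cutoff_ge0.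
- by move=> n s; rewrite gerBl cutoff_ge0.
- move=> u; rewrite indicE in_setC.
  rewrite (_ : (~~ _)%:R = 1 - (if N u <= t then 1 else 0)); last first.
    by case: ifP => Nt; [rewrite mem_set// subrr|rewrite memNset ?subr0//= Nt].
  by apply: cvgB; [exact: cvg_cst|exact: cvg_cutoff].
Qed.

(** The coefficients mu(~X1) on X1 and -mu(X1) on ~X1 preserve the total mass. Since the constraint
    holds on X1 and on ~X1 separately, it survives any nonnegative reweighting, and extremality
    gives mu(X1) mu(~X1) = 0. *)
Lemma extreme_N_const mu : extreme_points admissible mu ->
  exists r, mu [set u | N u = r] = 1%E.
Proof.
move=> mue; have muC := mue.1; apply: zero_one_const => // t.
have m1 := measurable_N_le t; have m2 := measurableC m1.
set X1 := [set u | N u <= t] in m1 m2 *.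
have d12 : X1 `&` ~` X1 = set0 by rewrite setICr.
have X12 : X1 `|` ~` X1 `|` set0 = setT by rewrite setUv setU0.
have mp := mass_partition mu m1 m2 measurable0 d12 (setI0 _) (setI0 _) X12 measurableT.
rewrite !setTI mass0 addr0 {1}/mass probability_setT /= in mp.
have q1 := mass_ge0 mu X1; have q2 := mass_ge0 mu (~` X1).
have [] := @perturbation mu X1 (~` X1) set0 m1 m2 measurable0 d12 (setI0 _) (setI0 _) X12
  (mass mu (~` X1)) (- mass mu X1) 0 mue.
- by rewrite ger0_norm//; lra.
- by rewrite normrN ger0_norm//; lra.
- by rewrite normr0.
- by rewrite mass0; ring.
- move=> g s wg s1.
  have j1 := @J_le_set mu g t muC wg; have j2 := @J_gt_set mu g t muC wg.
  rewrite /J Rintegral_set0 mulr0 addr0.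
  have p1 : 0 <= 1 + s * mass mu (~` X1) by case: s1 => ->; lra.
  have p2 : 0 <= 1 + s * (- mass mu X1) by case: s1 => ->; lra.
  rewrite -oppr_ge0 opprD addr_ge0// -mulrN mulr_ge0// oppr_ge0//.
move=> + _ _ => /eqP; rewrite mulf_eq0 => /orP[] /eqP z; [right|left].
  by rewrite massE//; congr (_%:E); lra.
by rewrite massE// z.
Qed.

Lemma weight1 : weight (cst 1).
Proof. by split; [exact: cst_continuous|move=> t; exact: ler01|exists 1]. Qed.

Lemma J_const mu r g A : admissible mu -> weight g -> measurable A ->
  mu [set u | N u = r] = 1%E -> J mu A g = g r * J mu A (cst 1).
Proof.
move=> muC wg mA Nr; have [_ Eoo _] := muC.
have ig A' g' : weight g' -> measurable A' ->
    mu.-integrable A' (EFin \o (fun u => g' (N u) * LV u)).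
  by move=> wg' mA'; apply: integrableS (integrable_weight Eoo wg').
have mNr : measurable [set u | N u = r].
  by have := mN measurableT (measurable_set1 r); rewrite setTI.
rewrite /J -RintegralZl//; last exact: ig weight1 mA.
congr fine; apply: ae_eq_integral => //.
- by have /integrableP[] := ig A g wg mA.
- have /integrableP[+ _] := ig A _ weight1 mA.
  by move=> /measurable_EFinP mf; apply/measurable_EFinP; exact: measurable_funM.
- exists (~` [set u | N u = r]); split; [exact: measurableC|exact/probC|].
  by move=> u /=; apply: contra_not => -> _; rewrite /= mul1r.
Qed.

Section extreme_point.
Variable mu : probability T R.
Hypothesis mue : extreme_points admissible mu.

Let muC : admissible mu := mue.1.

Lemma three_sets_null (X1 X2 X3 : set T) :
  measurable X1 -> measurable X2 -> measurable X3 ->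
  X1 `&` X2 = set0 -> X1 `&` X3 = set0 -> X2 `&` X3 = set0 ->
  X1 `|` X2 `|` X3 = setT ->
  [\/ mass mu X1 = 0, mass mu X2 = 0 | mass mu X3 = 0].
Proof.
move=> m1 m2 m3 d12 d13 d23 X123.
have [z1|z1] := eqVneq (mass mu X1) 0; first exact: Or31.
have [z2|z2] := eqVneq (mass mu X2) 0; first exact: Or32.
have [z3|z3] := eqVneq (mass mu X3) 0; first exact: Or33.
exfalso.
have p1 : 0 < mass mu X1 by rewrite lt_neqAle eq_sym z1 mass_ge0.
have p2 : 0 < mass mu X2 by rewrite lt_neqAle eq_sym z2 mass_ge0.
have [r Nr] := extreme_N_const mue.
have [e1 [e2 [e3 [[h1 h2 h3] [em ei en]]]]] := two_equations (mass mu X3)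
  (J mu X1 (cst 1)) (J mu X2 (cst 1)) (J mu X3 (cst 1)) p1 p2.
have [|q1 q2 q3] := perturbation m1 m2 m3 d12 d13 d23 X123 mue h1 h2 h3 em.
  move=> g s wg _.
  have [_ Eoo _] := muC.
  have JT := admissible_J muC weight1.
  rewrite (J_partition m1 m2 m3 d12 d13 d23 X123 (integrable_weight Eoo weight1)) in JT.
  rewrite !(J_const muC wg _ Nr)//.
  have g0 : 0 <= g r by case: wg.
  (* As N is almost surely r, every weight reduces to the factor g r; by [ei] the perturbation
     leaves the integral of L unchanged, for either sign s. *)
  rewrite (_ : _ + _ + _ = g r * (J mu X1 (cst 1) + J mu X2 (cst 1) + J mu X3 (cst 1)) +
    s * g r * (e1 * J mu X1 (cst 1) + e2 * J mu X2 (cst 1) + e3 * J mu X3 (cst 1))); last by ring.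
  by rewrite ei mulr0 addr0; exact: mulr_ge0_le0.
case: en => [|[]]; apply/negP/negPn.
- by move/eqP: q1; rewrite mulf_eq0 (negbTE z1) orbF.
- by move/eqP: q2; rewrite mulf_eq0 (negbTE z2) orbF.
- by move/eqP: q3; rewrite mulf_eq0 (negbTE z3) orbF.
Qed.

Lemma massT A : measurable A -> mass mu A + mass mu (~` A) = 1.
Proof.
move=> mA; have mAC := measurableC mA; apply: EFin_inj; rewrite EFinD -!massE//.
by rewrite -measureU ?setICr// setUv; exact: probability_setT.
Qed.

Lemma measurable_point (u : T) : measurable [set u].
Proof.
rewrite (_ : [set u] = \bigcap_n [set v | phi n v = phi n u]).
  apply: bigcapT_measurable => n.
  by have := mphi n measurableT (measurable_set1 (phi n u)); rewrite setTI.
apply/seteqP; split=> [_ -> //|v hv]; apply: phi_sep => n; exact: hv.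
Qed.

(** Conditioned on A, mu only takes the values 0 and 1: a set X splits T into three parts, inside A,
    in A outside X, and outside A. One of them is null, and it is not the complement of A. *)
Lemma atom_in A : measurable A -> 0 < mass mu A -> 0 < mass mu (~` A) ->
  exists2 u, A u & mass mu [set u] = mass mu A.
Proof.
move=> mA pA pAC.
have [|||mu' [mu'X _]] := @reweigh _ _ _ mu 1 (fun=> A) (fun=> (mass mu A)^-1).
- by [].
- by move=> _; rewrite invr_ge0 ltW.
- by rewrite big_ord_recl big_ord0 adde0 massE// -EFinM mulVf// gt_eqF.
have {}mu'X X : measurable X -> mu' X = ((mass mu A)^-1 * mass mu (X `&` A))%:E.
  move=> mX; rewrite mu'X// big_ord_recl big_ord0 adde0 massE//.
  exact: measurableI.
have z1 X : measurable X -> mu' X = 0%E \/ mu' X = 1%E.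
  move=> mX; have mAC := measurableC mA; have mXC := measurableC mX.
  have mXA := measurableI _ _ mX mA; have mXCA := measurableI _ _ mXC mA.
  have mAE : mass mu A = mass mu (X `&` A) + mass mu (~` X `&` A).
    apply: EFin_inj; rewrite EFinD -!massE// -measureU//.
      by rewrite -setIUl setUv setTI.
    by rewrite setIACA setICr set0I.
  have [||||z|z|z] := @three_sets_null (X `&` A) (~` X `&` A) (~` A) mXA mXCA mAC.
  - by rewrite setIACA setICr set0I.
  - by rewrite -setIA setICr setI0.
  - by rewrite -setIA setICr setI0.
  - by rewrite -setIUl setUv setTI setUv.
  - by left; rewrite mu'X// z mulr0.
  - by right; rewrite mu'X// mAE z addr0 mulVf//; rewrite z addr0 in mAE; rewrite -mAE gt_eqF.
  - by rewrite z ltxx in pAC.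
have [u mu'u] := zero_one_dirac mphi phi_sep z1.
have mu1 := measurable_point u.
exists u.
  apply: contrapT => Au; move: mu'u; rewrite mu'X//.
  rewrite (_ : _ `&` _ = set0) ?mass0 ?mulr0.
    by move/eqP; rewrite eq_sym onee_eq0.
  by apply/seteqP; split => // v [/= -> ].
have : mass mu ([set u] `&` A) = mass mu A.
  move: mu'u; rewrite mu'X// => -[] /(congr1 (fun x => mass mu A * x)).
  by rewrite mulVKf ?gt_eqF// mulr1.
move=> E1; apply/eqP; rewrite eq_le; apply/andP; split; last first.
  rewrite -E1 /mass fine_le ?fin_num_measure//; first exact: measurableI.
  by apply: le_measure; rewrite ?inE//; exact: measurableI.
have [Au|Au] := pselect (A u); last first.
  move: E1; rewrite (_ : _ `&` _ = set0) ?mass0; first by move=> E1; rewrite -E1 ltxx in pA.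
  by apply/seteqP; split => // v [/= -> ].
rewrite -E1 (_ : _ `&` _ = [set u])//.
by apply/seteqP; split => [v []//|v /= ->].
Qed.

Lemma two_atoms : (exists u, mass mu [set u] = 1) \/
  exists u1 u2, [/\ u1 <> u2, 0 < mass mu [set u1], 0 < mass mu [set u2] &
    mass mu [set u1] + mass mu [set u2] = 1].
Proof.
have [z1|] := pselect (forall A, measurable A -> mu A = 0%E \/ mu A = 1%E).
  by have [u u1] := zero_one_dirac mphi phi_sep z1; left; exists u; rewrite /mass u1.
move=> /existsNP[A /not_implyP[mA /not_orP[nA0 nA1]]]; right.
have mAC := measurableC mA.
have pA : 0 < mass mu A.
  rewrite lt_neqAle mass_ge0 andbT eq_sym; apply/eqP => z.
  by apply: nA0; rewrite massE// z.
have pAC : 0 < mass mu (~` A).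
  rewrite lt_neqAle mass_ge0 andbT eq_sym; apply/eqP => z.
  by apply: nA1; rewrite massE//; have := massT mA; rewrite z addr0 => ->.
have [u1 Au1 m1] := atom_in mA pA pAC.
have [|u2 Au2 m2] := atom_in mAC pAC; first by rewrite setCK.
exists u1, u2; split; rewrite ?m1 ?m2//; last exact: massT.
by move=> E12; apply: Au2; rewrite -E12.
Qed.

End extreme_point.

Lemma atom_ae mu u (P : T -> Prop) : 0 < mass mu [set u] ->
  {ae mu, forall x, P x} -> P u.
Proof.
move=> mu0 [S [mS S0 PS]]; apply: contrapT => Pu.
have uS : [set u] `<=` S by move=> _ ->; exact: PS.
have : (mu [set u] <= mu S)%E by apply: le_measure; rewrite ?inE//; exact: measurable_point.
by rewrite S0 massE ?lee_fin ?leNgt ?mu0//; exact: measurable_point.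
Qed.

Lemma atom_sub mu u A : measurable A -> mu A = 1%E -> 0 < mass mu [set u] -> A u.
Proof.
move=> mA A1 mu0; apply: (atom_ae mu0); exists (~` A); split => //.
  exact: measurableC.
exact/probC.
Qed.

Lemma atom_V mu u : (\int[mu]_u E u < +oo)%E -> 0 < mass mu [set u] -> V u.
Proof.
move=> Eoo mu0; apply/EV; apply: (atom_ae (P := fun x => (E x < +oo)%E) mu0).
have iE : mu.-integrable setT E.
  by apply/integrableP; split => //; under eq_integral do rewrite gee0_abs//.
have := integrable_ae measurableT iE.
by apply: filterS => x /(_ Logic.I); rewrite ge0_fin_numE.
Qed.

Lemma LVE u : V u -> LV u = L u.
Proof. by move=> Vu; rewrite /LV patchE mem_set. Qed.

Lemma J_point mu u g : V u -> J mu [set u] g = g (N u) * L u * mass mu [set u].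
Proof.
move=> Vu; rewrite /J -(Rintegral_cst mu (measurable_point u)).
by apply: eq_Rintegral => x; rewrite inE => ->; rewrite LVE.
Qed.

Lemma J_null mu A g : measurable A -> weight g -> mass mu A = 0 -> J mu A g = 0.
Proof.
move=> mA [cg _ _] A0; have mA0 : mu A = 0%E by rewrite massE// A0.
rewrite /J /Rintegral null_set_integral//.
by apply: measurable_funTS; apply/measurable_EFinP/measurable_gLV/measurable_gN.
Qed.

Lemma mass_point mu u A : mass mu (A `&` [set u]) = mass mu [set u] * \1_A u.
Proof.
rewrite indicE; have [Au|Au] := pselect (A u).
  rewrite mem_set// mulr1 (_ : _ `&` _ = [set u])//.
  by apply/seteqP; split => [x []//|x /= ->].
rewrite memNset// mulr0 (_ : _ `&` _ = set0) ?mass0//.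
by apply/seteqP; split => // x [] /[swap] /= ->.
Qed.

Lemma mass_le mu A X : measurable A -> measurable X -> A `<=` X ->
  mass mu A <= mass mu X.
Proof.
move=> mA mX AX; rewrite /mass fine_le ?fin_num_measure//.
by apply: le_measure; rewrite ?inE.
Qed.

Lemma mass_null mu A X : measurable A -> measurable X -> mass mu X = 0 ->
  mass mu (A `&` X) = 0.
Proof.
move=> mA mX X0; apply/eqP; rewrite eq_le mass_ge0 andbT -X0.
by apply: mass_le => //; exact: measurableI.
Qed.

Lemma mass_one_point mu u A : measurable A -> mass mu (~` [set u]) = 0 ->
  mass mu A = \1_A u.
Proof.
move=> mA z; have mu1 := measurable_point u; have mu2 := measurableC mu1.
have m1 : mass mu [set u] = 1 by have := massT mu mu1; rewrite z addr0.
rewrite (mass_partition mu mu1 mu2 measurable0 (setICr _) (setI0 _) (setI0 _) _ mA).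
  by rewrite mass_point (mass_null mA mu2 z) setI0 mass0 m1 mul1r !addr0.
by rewrite setUv setU0.
Qed.

Lemma mass_two_points mu u1 u2 A : measurable A -> u1 <> u2 ->
  mass mu (~` ([set u1] `|` [set u2])) = 0 ->
  mass mu A = mass mu [set u1] * \1_A u1 + mass mu [set u2] * \1_A u2.
Proof.
move=> mA u12 z; have m1 := measurable_point u1; have m2 := measurable_point u2.
have m3 := measurableC (measurableU _ _ m1 m2).
rewrite (mass_partition mu m1 m2 m3 _ _ _ _ mA).
- by rewrite !mass_point (mass_null mA m3 z) addr0.
- by apply/seteqP; split => // x [/= -> ].
- by apply/seteqP; split => // x [/= -> ]; apply; left.
- by apply/seteqP; split => // x [/= -> ]; apply; right.
- by rewrite setUv.
Qed.

Lemma mixture_dirac mu (a b : R) u1 u2 :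
  mixture mu a b (@dirac _ T u1 R) (@dirac _ T u2 R) <->
  forall A, measurable A -> mass mu A = a * \1_A u1 + b * \1_A u2.
Proof.
split=> h A mA.
  by rewrite /mass h// !diracE -!EFinM -EFinD /= !indicE.
by rewrite massE// h// !diracE -!EFinM -EFinD !indicE.
Qed.

Lemma extreme_form mu : extreme_points admissible mu ->
  (exists u, [/\ B u, V u, L u <= 0 &
     mixture mu 1 0 (@dirac _ T u R) (@dirac _ T u R)]) \/
  exists (a : R) u1 u2, [/\ 0 < a < 1, [/\ B u1, V u1, B u2 & V u2], N u1 = N u2,
    [/\ L u1 < 0, 0 < L u2 & a * L u1 + (1 - a) * L u2 = 0] &
    mixture mu a (1 - a) (@dirac _ T u1 R) (@dirac _ T u2 R)].
Proof.
move=> mue; have muC := mue.1; have [muB Eoo _] := muC.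
have J1 := admissible_J muC weight1.
have [[u mu1]|[u1 [u2 [u12 p1 p2 p12]]]] := two_atoms mue.
  have p : 0 < mass mu [set u] by rewrite mu1.
  have m1 := measurable_point u; have m2 := measurableC m1.
  have C0 : mass mu (~` [set u]) = 0 by have := massT mu m1; rewrite mu1; lra.
  have Vu := atom_V Eoo p.
  left; exists u; split => //; first exact: atom_sub mB muB p; last first.
    by apply/mixture_dirac => A mA; rewrite mul0r addr0 mul1r; exact: mass_one_point.
  rewrite (J_partition m1 m2 measurable0 (setICr _) (setI0 _) (setI0 _) _
    (integrable_weight Eoo weight1)) in J1; last by rewrite setUv setU0.
  move: J1; rewrite J_point// (J_null m2 weight1 C0) (J_null measurable0 weight1 (mass0 mu)).
  by rewrite mu1 /= mul1r mulr1 !addr0.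
have V1 := atom_V Eoo p1; have V2 := atom_V Eoo p2.
have B1 := atom_sub mB muB p1; have B2 := atom_sub mB muB p2.
have [r Nr] := extreme_N_const mue.
have mNr : measurable [set u | N u = r].
  by have := mN measurableT (measurable_set1 r); rewrite setTI.
have N1 : N u1 = r := atom_sub mNr Nr p1.
have N2 : N u2 = r := atom_sub mNr Nr p2.
have m1 := measurable_point u1; have m2 := measurable_point u2.
pose X3 := ~` ([set u1] `|` [set u2]).
have m12 := measurableU _ _ m1 m2; have m3 : measurable X3 by exact: measurableC.
have d12 : [set u1] `&` [set u2] = set0.
  by apply/seteqP; split => // x [/= -> ].
have d13 : [set u1] `&` X3 = set0.
  by apply/seteqP; split => // x [/= -> ]; apply; left.
have d23 : [set u2] `&` X3 = set0.
  by apply/seteqP; split => // x [/= -> ]; apply; right.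
have X123 : [set u1] `|` [set u2] `|` X3 = setT by rewrite setUv.
have z3 : mass mu X3 = 0.
  have := mass_partition mu m1 m2 m3 d12 d13 d23 X123 measurableT.
  rewrite !setTI {1}/mass probability_setT /= p12; lra.
move: (J1); rewrite (J_partition m1 m2 m3 d12 d13 d23 X123 (integrable_weight Eoo weight1)).
rewrite !J_point// (J_null m3 weight1 z3) /= !mul1r addr0.
set a := mass mu [set u1] in p1 p12 *; set b := mass mu [set u2] in p2 p12 *.
move=> K0.
(* The perturbation e (b, -a, 0) preserves the total mass and changes the integral K of L by e D or
   -e D. If K + e |D| <= 0, both perturbed measures are admissible, which extremality excludes. *)
have noeps (e : R) : 0 < e -> e <= 1 ->
    L u1 * a + L u2 * b + `|e * (b * (L u1 * a) - a * (L u2 * b))| <= 0 -> False.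
  move=> e0 e1 eK.
  have eb : 0 <= e * b by rewrite mulr_ge0// ltW.
  have ea : 0 <= e * a by rewrite mulr_ge0// ltW.
  have eb1 : e * b <= 1 by rewrite mulr_ile1// ?ltW//; lra.
  have ea1 : e * a <= 1 by rewrite mulr_ile1// ?ltW//; lra.
  have [|||||q1 _ _] := @perturbation mu [set u1] [set u2] X3 m1 m2 m3 d12 d13 d23 X123
    (e * b) (- (e * a)) 0 mue.
  - by rewrite ger0_norm.
  - by rewrite normrN ger0_norm.
  - by rewrite normr0.
  - by rewrite -/a -/b z3; ring.
  - move=> g s wg s1; rewrite !J_point// N1 N2 (J_null m3 wg z3) -/a -/b mulr0 addr0.
    rewrite (_ : _ + _ = g r * (L u1 * a + L u2 * b +
      s * (e * (b * (L u1 * a) - a * (L u2 * b))))); last by ring.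
    apply: mulr_ge0_le0; first by case: wg.
    apply: le_trans eK; rewrite lerD2l.
    case: s1 => ->; first by rewrite mul1r ler_norm.
    by rewrite mulN1r -normrN ler_norm.
  move/eqP: q1; rewrite -/a !mulf_eq0 !gt_eqF//.
set K := L u1 * a + L u2 * b in K0 noeps.
set D := b * (L u1 * a) - a * (L u2 * b) in noeps.
have Kz : K = 0.
  apply/eqP; rewrite eq_le K0 /= leNgt; apply/negP => Kn.
  have S0 : 0 < 1 + `|D| - K by have := normr_ge0 D; lra.
  (* With this e in ]0, 1[, e |D| = -K |D| / (1 + |D| - K) <= -K. *)
  apply: (noeps (- K / (1 + `|D| - K))).
  - by rewrite divr_gt0// oppr_gt0.
  - by rewrite ler_pdivrMr// mul1r; have := normr_ge0 D; lra.
  - rewrite normrM gtr0_norm; last by rewrite divr_gt0// oppr_gt0.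
    rewrite -subr_ge0 sub0r opprD -mulrA -mulrN mulrC.
    have : `|D| / (1 + `|D| - K) <= 1 by rewrite ler_pdivrMr// mul1r; lra.
    have Kn' : 0 < - K by rewrite oppr_gt0.
    rewrite [_^-1 * _]mulrC => hD; nra.
have Dn : D != 0.
  apply/eqP => D0; apply: (noeps 1) => //.
  by rewrite D0 mulr0 normr0 addr0 Kz.
have La : L u1 != 0.
  apply: contra Dn => /eqP L10; move: Kz; rewrite /D /K L10 !mul0r !mulr0 add0r => ->.
  by rewrite mulr0 subrr.
have bE : b = 1 - a by rewrite -p12 [a + b]addrC addrK.
have aE : a = 1 - b by rewrite -p12 addrK.
have z3' : mass mu (~` ([set u2] `|` [set u1])) = 0 by rewrite setUC.
(* As K = 0, the sign of [L u2] is opposite to that of [L u1]; the atom with negative L is listed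
   first. *)
right; have [L1|L1|L1] := ltgtP (L u1) 0; last by rewrite L1 eqxx in La.
  exists a, u1, u2; rewrite -bE; split => //.
  - by rewrite p1; lra.
  - by rewrite N1 N2.
  - split => //; last by rewrite mulrC [_ * L u2]mulrC.
    have La0 : L u1 * a < 0 by rewrite nmulr_rlt0.
    have : 0 < L u2 * b by move: Kz; rewrite /K; lra.
    by rewrite pmulr_lgt0.
  - by apply/mixture_dirac => A mA; exact: mass_two_points.
exists b, u2, u1; rewrite -aE; split => //.
- by rewrite p2; lra.
- by rewrite N1 N2.
- split => //; last by rewrite addrC mulrC [_ * L u2]mulrC.
  have La0 : 0 < L u1 * a by rewrite mulr_gt0.
  have : L u2 * b < 0 by move: Kz; rewrite /K; lra.
  by rewrite pmulr_llt0.
- apply/mixture_dirac => A mA; apply: mass_two_points => //.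
  by move=> /esym.
Qed.

(** * The converse: mixtures of one or two Dirac masses *)

Section mixture.
Variables (mu : probability T R) (a b : R) (u1 u2 : T).
Hypotheses (a0 : 0 <= a) (b0 : 0 <= b)
  (mix : mixture mu a b (@dirac _ T u1 R) (@dirac _ T u2 R)).

Lemma mixture_ge0_integral (f : T -> \bar R) : measurable_fun setT f ->
  (forall x, 0 <= f x)%E -> (\int[mu]_x f x = a%:E * f u1 + b%:E * f u2)%E.
Proof.
move=> mf f0.
pose m1 : {measure set T -> \bar R} := mscale (NngNum a0) (@dirac _ T u1 R).
pose m2 : {measure set T -> \bar R} := mscale (NngNum b0) (@dirac _ T u2 R).
transitivity (\int[measure_add m1 m2]_x f x)%E.
  by apply: eq_measure_integral => X mX _; exact: etrans (mix mX) (esym (measure_addE m1 m2 X)).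
rewrite ge0_integral_measure_add//; congr (_ + _)%E.
  by rewrite ge0_integral_mscale// integral_dirac// diracT mul1e.
by rewrite ge0_integral_mscale// integral_dirac// diracT mul1e.
Qed.

Lemma mixture_Rintegral (f : T -> R) : measurable_fun setT f ->
  \int[mu]_x f x = a * f u1 + b * f u2.
Proof.
move=> mf; have mf' : measurable_fun setT (EFin \o f) by exact/measurable_EFinP.
rewrite /Rintegral integralE !mixture_ge0_integral//; last 2 first.
- exact: measurable_funeneg.
- exact: measurable_funepos.
pose p x := Num.max (f x) 0; pose q x := Num.max (- f x) 0.
have pE x : ((EFin \o f)^\+ x = (p x)%:E)%E by rewrite funeposE /p EFin_max.
have qE x : ((EFin \o f)^\- x = (q x)%:E)%E by rewrite funenegE /q EFin_max.
have pq x : f x = p x - q x.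
  by rewrite /p /q; case: (leP (f x) 0) => fx; case: leP; lra.
by rewrite !pE !qE -!EFinM -!EFinD /= (pq u1) (pq u2); ring.
Qed.

Lemma admissible_mixture : mu B = 1%E -> V u1 -> V u2 ->
  (forall g, weight g -> a * (g (N u1) * L u1) + b * (g (N u2) * L u2) <= 0) ->
  admissible mu.
Proof.
move=> muB V1 V2 gle.
have Eoo : (\int[mu]_u E u < +oo)%E.
  rewrite mixture_ge0_integral// lte_add_pinfty//.
    by apply: lte_mul_pinfty; rewrite ?lee_fin//; exact/EV.
  by apply: lte_mul_pinfty; rewrite ?lee_fin//; exact/EV.
split=> // g wg; have [cg _ _] := wg; rewrite JE// lee_fin /J mixture_Rintegral.
  by rewrite !LVE//; exact: gle.
exact/measurable_gLV/measurable_gN.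
Qed.

End mixture.

Lemma mixture_mass mu (y z : probability T R) (t : R) A :
  measurable A -> mixture mu (1 - t) t y z ->
  mass mu A = (1 - t) * mass y A + t * mass z A.
Proof. by move=> mA /(_ A mA); rewrite /= !massE// -!EFinM -EFinD => -[]. Qed.

Lemma mixture_null mu (y z : probability T R) (t : R) A : measurable A -> 0 < t < 1 ->
  mixture mu (1 - t) t y z -> mass mu A = 0 -> mass y A = 0 /\ mass z A = 0.
Proof.
move=> mA /andP[t0 t1] mix mA0; have := mixture_mass mA mix; rewrite mA0.
have y0 := mass_ge0 y A; have z0 := mass_ge0 z A.
have p1 : 0 <= (1 - t) * mass y A by rewrite mulr_ge0//; lra.
have p2 : 0 <= t * mass z A by rewrite mulr_ge0//; lra.
move=> s0; have q1 : (1 - t) * mass y A == 0 by apply/eqP; lra.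
have q2 : t * mass z A == 0 by apply/eqP; lra.
move: q1 q2; rewrite !mulf_eq0 subr_eq0 (gt_eqF t1) (gt_eqF t0) /=.
by move=> /eqP -> /eqP ->.
Qed.

(** The complement of u is null for mu, hence for y and for z, so both are the Dirac measure at
    u. *)
Lemma extreme_one_point mu u : mu B = 1%E ->
  mixture mu 1 0 (@dirac _ T u R) (@dirac _ T u R) -> V u -> L u <= 0 ->
  extreme_points admissible mu.
Proof.
move=> muB mix Vu Lu; split.
  apply: (admissible_mixture ler01 (lexx 0) mix) => // g [_ g0 _].
  by rewrite mul0r addr0 mul1r mulr_ge0_le0.
move=> [y [z [t [yC zC [A mA yzA] t01 yz]]]]; apply: yzA.
have mC := measurableC (measurable_point u).
have mu0 : mass mu (~` [set u]) = 0.
  move/mixture_dirac : mix => ->//; rewrite indicE in_setC mem_set//=.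
  by rewrite mulr0 mul0r addr0.
have [y0 z0] := mixture_null mC t01 yz mu0.
by rewrite !massE// (mass_one_point mA y0) (mass_one_point mA z0).
Qed.

Lemma extreme_two_points mu (a : R) u1 u2 : mu B = 1%E -> 0 < a < 1 ->
  mixture mu a (1 - a) (@dirac _ T u1 R) (@dirac _ T u2 R) -> V u1 -> V u2 ->
  N u1 = N u2 -> L u1 < 0 -> 0 < L u2 -> a * L u1 + (1 - a) * L u2 = 0 ->
  extreme_points admissible mu.
Proof.
move=> muB /andP[a0 a1] mix V1 V2 N12 L1 L2 aL.
have b0 : 0 <= 1 - a by lra.
have u12 : u1 <> u2 by move=> u12; move: L1 L2; rewrite u12; lra.
split.
  apply: (admissible_mixture (ltW a0) b0 mix) => // g _; rewrite N12.
  rewrite (_ : _ + _ = g (N u2) * (a * L u1 + (1 - a) * L u2)); last by ring.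
  by rewrite aL mulr0.
move=> [y [z [t [yC zC [A mA yzA] t01 yz]]]]; apply: yzA.
have m1 := measurable_point u1; have m2 := measurable_point u2.
have m12 := measurableU _ _ m1 m2; have m3 := measurableC m12.
have mu0 : mass mu (~` ([set u1] `|` [set u2])) = 0.
  move/mixture_dirac : mix => ->//; rewrite !indicE !in_setC !mem_set//=.
  - by rewrite !mulr0 addr0.
  - by right.
  - by left.
have [y0 z0] := mixture_null m3 t01 yz mu0.
(* With weight 1 the constraint reads m L u1 + (1 - m) L u2 <= 0 for m = x(u1). The left side
   decreases in m and vanishes at m = a. *)
have two x : admissible x -> mass x (~` ([set u1] `|` [set u2])) = 0 ->
    mass x [set u1] + mass x [set u2] = 1 /\ a <= mass x [set u1].
  move=> xC x0.
  have xE X : measurable X -> mass x X = mass x [set u1] * \1_X u1 + mass x [set u2] * \1_X u2.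
    by move=> mX; exact: mass_two_points.
  have x1 : mass x [set u1] + mass x [set u2] = 1.
    have := xE setT measurableT; rewrite /mass probability_setT /= !indicT !mulr1.
    by move=> ->.
  split=> //.
  have xmix : mixture x (mass x [set u1]) (mass x [set u2])
      (@dirac _ T u1 R) (@dirac _ T u2 R) by apply/mixture_dirac.
  have := admissible_J xC weight1.
  rewrite /J (mixture_Rintegral (mass_ge0 _ _) (mass_ge0 _ _) xmix); last first.
    by apply: (@measurable_gLV (cst 1)); exact: measurable_cst.
  rewrite !LVE// /= !mul1r => xL.
  have E2 : mass x [set u2] = 1 - mass x [set u1] by rewrite -x1; ring.
  rewrite E2 in xL; nra.
have [y1 ya] := two y yC y0; have [z1 za] := two z zC z0.
have mu1 : mass mu [set u1] = a.
  move/mixture_dirac : mix => ->//; rewrite !indicE mem_set// memNset; last by move=> /esym.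
  by rewrite mulr1 mulr0 addr0.
have := mixture_mass m1 yz; rewrite mu1 => aE.
have /andP[t0 t1] := t01.
have yE : mass y [set u1] = a by nra.
have zE : mass z [set u1] = a by nra.
rewrite !massE// (mass_two_points mA u12 y0) (mass_two_points mA u12 z0).
have -> : mass y [set u2] = 1 - a by rewrite -y1 yE; ring.
have -> : mass z [set u2] = 1 - a by rewrite -z1 zE; ring.
by rewrite yE zE.
Qed.

End extremal.

(** * Functions psi and their derivatives *)

Section C1.
Variable R : realType.
Implicit Types (psi dpsi g : R -> R).

(** Quotients from the right suffice, and they remain available at t = 0. *)
Lemma C1_ge0 psi dpsi t : C1_with_derivative psi dpsi ->
  (forall s t : R, 0 <= s -> s <= t -> psi s <= psi t) -> 0 <= t -> 0 <= dpsi t.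
Proof.
move=> [dpsiP _] mono t0.
have h : (psi s - psi t) / (s - t) @[s --> t^'+] --> dpsi t.
  apply: cvg_trans (dpsiP t t0); apply: cvg_app => P.
  move=> Pt; have {}Pt : \forall s \near t, s != t -> 0 <= s -> P s by exact: Pt.
  suff : \forall s \near t, t < s -> P s by [].
  apply: filterS Pt => s hs st; apply: hs; first by rewrite gt_eqF.
  by apply: le_trans t0 _; exact: ltW.
rewrite -(cvg_lim _ h)//; apply: limr_ge; first exact: cvgP h.
near=> s.
have ts : t < s by near: s; exact: nbhs_right_gt.
by rewrite divr_ge0 ?subr_ge0 ?mono// ltW.
Unshelve. all: by end_near. Qed.

(** Truncation at 0 is 1-Lipschitz, so composing with it extends [dpsi] continuously to the line
    without changing its values at the numbers $|u|^2$. *)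
Lemma C1_weight psi dpsi : C1_with_derivative psi dpsi ->
  (forall s t : R, 0 <= s -> s <= t -> psi s <= psi t) ->
  (exists M : R, forall t : R, 0 <= t -> `|dpsi t| <= M) ->
  weight (fun t => dpsi (Num.max t 0)).
Proof.
move=> C1 mono [M dM].
have m0 (t : R) : 0 <= Num.max t 0 by rewrite le_max lexx orbT.
split.
- move=> t; apply/cvgrPdist_le => e e0.
  have [_ /subspace_continuousP/(_ (Num.max t 0))] := C1.
  rewrite /= in_itv /= andbT => /(_ (m0 t)) /cvgrPdist_le/(_ e e0).
  move=> hn; have {hn} : \forall s \near Num.max t 0, `[0, +oo[%classic s ->
      `|dpsi (Num.max t 0) - dpsi s| <= e by exact: hn.
  move=> /nbhs_ballP[r /= r0 rP].
  apply/nbhs_ballP; exists r => //= s ts; apply: rP; last by rewrite /= in_itv /= andbT m0.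
  move: ts; rewrite -!ball_normE /=; apply: le_lt_trans.
  rewrite !maxEle; case: ifP => t0; case: ifP => s0.
  + by rewrite subrr normr0.
  + rewrite sub0r normrN; have : 0 < s by rewrite ltNge s0.
    move=> s1; rewrite gtr0_norm// ler0_norm; lra.
  + rewrite subr0; have : 0 < t by rewrite ltNge t0.
    move=> t1; rewrite !ger0_norm; lra.
  + by [].
- by move=> t; exact: C1_ge0 C1 mono (m0 t).
- by exists M => t; apply: le_trans (ler_norm _) _; exact: dM.
Qed.

Lemma weight_C1 g : weight g -> exists psi,
  [/\ C1_with_derivative psi g, forall t : R, 0 <= t -> 0 <= psi t &
   forall s t : R, 0 <= s -> s <= t -> psi s <= psi t].
Proof.
move=> [cg g0 _].
pose mu := @lebesgue_measure R.
have ig (y : R) : mu.-integrable `[-1, y] (EFin \o g).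
  apply: continuous_compact_integrable; first exact: segment_compact.
  exact: continuous_subspaceT.
(* Starting at -1 makes every t >= 0 an interior point, so the fundamental theorem of calculus gives
   the derivative at 0 as well. *)
pose psi x := \int[mu]_(t in `[-1, x]) g t.
exists psi; split.
- split; last exact: continuous_subspaceT.
  move=> t t0.
  have t1 : -1 < t by lra.
  have tt : t < t + 1 by lra.
  have [dpsi psi'] := continuous_FTC1_closed tt (ig (t + 1)) t1 (cg t).
  have := dpsi; rewrite /derivable => /cvg_ex[l hl].
  have lE : l = g t.
    rewrite -psi' derive1E; apply/esym/cvg_lim => //.
  rewrite lE in hl.
  apply/cvgrPdist_le => e e0.
  have /cvgrPdist_le/(_ e e0) := hl.
  move=> hn; have {hn} : \forall h \near (0:R), h != 0 ->
      `|g t - h^-1 *: (psi (h *: 1 + t) - psi t)| <= e by exact: hn.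
  move=> /nbhs_ballP[r /= r0 rP].
  suff : \forall s \near t, s != t -> 0 <= s ->
      `|g t - (psi s - psi t) / (s - t)| <= e by [].
  apply/nbhs_ballP; exists r => //= s ts st s0.
  have := rP (s - t).
  rewrite -ball_normE /= sub0r normrN distrC /GRing.scale /= mulr1 subrK mulrC; apply.
    by move: ts; rewrite -ball_normE.
  by rewrite subr_eq0.
- by move=> t _; apply: Rintegral_ge0 => x _; exact: g0.
- move=> s t s0 st; rewrite /psi /Rintegral fine_le//.
  + by apply: integrable_fin_num => //; exact: ig.
  + by apply: integrable_fin_num => //; exact: ig.
  apply: ge0_subset_integral => //.
  + by have /integrableP[] := ig t.
  + by move=> x _; rewrite lee_fin g0.
  + by apply: subset_itvl; rewrite bnd_simp.
Qed.

End C1.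

(** * Stationary measures *)

Section stationary_measures.
Variables (R : realType) (Omega : bounded_domain R).
Variables (nu : R) (f : Hspace Omega -> R) (B : set (Hspace Omega)).
Local Notation Hs := (Hspace Omega).
Local Notation bH := (borel Hs).

Definition sqnorm (u : bH) : R := `|u : Hs| ^+ 2.

Lemma Pfp_admissible :
  Pfp nu f B = admissible (Vspace : set bH) B sqnorm (ell nu f) (@enstrophy R Omega).
Proof.
apply/seteqP; split=> mu [muB Eoo muJ]; split=> //.
  move=> g wg; have [psi [C1 psi0 psi_mono]] := weight_C1 wg.
  apply: (muJ psi) => //.
  by have [_ g0 [M gM]] := wg; exists M => t _; rewrite ger0_norm.
move=> psi dpsi C1 _ mono dM.
have := muJ _ (C1_weight C1 mono dM).
by under eq_integral do rewrite max_l ?sqr_ge0//.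
Qed.

Lemma measurable_sqnorm : measurable_fun setT sqnorm.
Proof.
apply: measurable_funX; apply: (@continuous_borel R Omega (fun u : Hs => `|u|)).
exact: norm_continuous.
Qed.

Lemma enstrophy_ge0 (u : Hs) : (0 <= enstrophy u)%E.
Proof. by rewrite /enstrophy; case: asboolP => _ //; rewrite lee_fin sqr_ge0. Qed.

Lemma enstrophy_fin (u : Hs) : (enstrophy u < +oo)%E <-> Vspace u.
Proof. by rewrite /enstrophy; case: asboolP => Vu; rewrite ?ltry ?ltxx. Qed.

Lemma ell_enstrophy_bound : Vdual f -> exists c : R,
  forall u : Hs, Vspace u -> (`|ell nu f u|%:E <= c%:E * (enstrophy u + 1))%E.
Proof.
move=> /(ell_bound nu)[c [_ cP]]; exists c => u Vu.
by rewrite /enstrophy; case: asboolP => // _; rewrite -EFinD -EFinM lee_fin; exact: cP.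
Qed.

End stationary_measures.

Theorem corollary4p3 (R : realType) (Omega : bounded_domain R) (nu : R)
    (f : Hspace Omega -> R) (B : set (Hspace Omega)) :
  0 < nu -> Vdual f -> weakly_compact B ->
  extreme_points (Pfp nu f B) =
  [set mu | carried B mu /\ exists theta1 theta2 u1 u2,
     Bf nu f B (theta1, theta2, u1, u2) /\
     mixture mu theta1 theta2
       (@dirac _ (borel (Hspace Omega)) u1 R)
       (@dirac _ (borel (Hspace Omega)) u2 R)].
Proof.
move=> _ Vf cB; rewrite Pfp_admissible.
have mV := @measurable_Vspace R Omega.
have mB := closed_borel (weakly_compact_closed_H cB).
have mN := @measurable_sqnorm R Omega.
have mL := measurable_ell nu Vf.
have mE := @measurable_enstrophy R Omega.
have [c LE] := ell_enstrophy_bound nu Vf.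
have [phi [cphi sphi]] := separating_family Omega.
have mphi n := continuous_borel (cphi n).
have E0 := @enstrophy_ge0 R Omega.
have EV := @enstrophy_fin R Omega.
apply/seteqP; split=> [mu mue|mu [muB [t1 [t2 [u1 [u2 [Bfu mix]]]]]]].
  split; first by have [[]] := mue.
  have [[u [Bu Vu Lu mix]]|[a [u1 [u2 [a01 Buv N12 [L1 L2 LL] mix]]]]] :=
      extreme_form mV mB mN mL mE E0 EV LE mphi sphi mue.
    by exists 1, 0, u, u; split => //; left; exists u.
  exists a, (1 - a), u1, u2; split => //; right; split => //.
  - by move/eqP: N12; rewrite /sqnorm eqrXn2 ?normr_ge0// => /eqP.
  - by split=> //; apply/andP.
case: Bfu => [[u [Bu Vu Lu] [E1 E2 Eu1 Eu2]]|].
  rewrite -E1 -E2 -Eu1 -Eu2 in mix.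
  exact: (extreme_one_point mV mN mL mE E0 EV LE mphi sphi muB mix Vu Lu).
move=> [t01 t2E [B1 V1 B2 V2] N12 [/andP[L1 L2] LL]]; rewrite t2E in mix LL.
have N12' : sqnorm u1 = sqnorm u2 by rewrite /sqnorm N12.
exact: (extreme_two_points mV mN mL mE E0 EV LE mphi sphi muB t01 mix V1 V2 N12' L1 L2 LL).
Qed.
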